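(* Let $H=\mathcal{O}(\mathrm{G})$ be a CQG algebra, $V$ a finite-dimensional right $H$-comodule, $F'\subseteq F$ an inclusion of finite sets, and let $$\mathbf{d}=(d_i)_{i\in F},\qquad \boldsymbol{\ell}=(\ell_j\in[0,d_j])_{j\in F'}$$ be tuples of non-negative integers. Put $\mathbb{G}(\mathbf{d},V):=\prod_{i\in F}\mathbb{G}(d_i,V)$. Then the set $$\left\{(W_i)_{i\in F}\in\mathbb{G}(\mathbf{d},V) : H_{(W_i\le V)_{i\in F}} \text{ is } \ell_j\text{-constrained on } W_j \text{ for every } j\in F'\right\}\subseteq \mathbb{G}(\mathbf{d},V)$$ is open in the Zariski topology on $\mathrm{Res}_{\mathbb{C}/\mathbb{R}}\mathbb{G}(\mathbf{d},V)$, and hence dense in the standard (Hausdorff) topology if it is non-empty.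
   Context: A CQG algebra is a complex Hopf $*$-algebra $H$ all of whose finite-dimensional right comodules $V\to V\otimes H$, $v\mapsto v_0\otimes v_1$, are unitarizable, i.e. admit an inner product with $\langle v_0\mid w\rangle v_1^*=\langle v\mid w_0\rangle S(w_1)$ for all $v,w\in V$ ($S$ the antipode). Morphisms of CQG algebras are Hopf $*$-algebra morphisms. The notation $H=\mathcal{O}(\mathrm{G})$ records that $H$ is regarded as the function algebra of a compact quantum group $\mathrm{G}$. $\mathbb{G}(d,V)$ is the Grassmannian of $d$-dimensional complex linear subspaces of $V$. For a family $(W_i)_{i\in F}$ of linear subspaces of $V$, $H\to H_{(W_i\le V)_{i\in F}}$ denotes the morphism of CQG algebras that is initial among CQG algebra morphisms $H\to H'$ for which every $W_i$ is an $H'$-subcomodule of $V$ (with $V$ regarded as an $H'$-comodule along $H\to H'$); it is a quotient of $H$. Thus each $W_i$ is an $H_{(W_i\le V)_i}$-comodule. For $\ell\in\mathbb{Z}_{\ge0}$, a coalgebra (here with distinguished trivial comodule, e.g. a CQG algebra) $K$ is $\ell$-constrained on a finite-dimensional right $K$-comodule $X$ if all non-trivial irreducible $K$-comodules appearing as subquotients of $X$ have dimension $\le\ell$. For $\ell=0$ this means that all irreducible subquotients of $X$ are trivial. $\mathrm{Res}_{\mathbb{C}/\mathbb{R}}$ is Weil restriction: $\mathrm{Res}_{\mathbb{C}/\mathbb{R}}\mathbb{G}(\mathbf{d},V)$ is the real algebraic variety whose real points are the complex points of $\mathbb{G}(\mathbf{d},V)$; its Zariski-closed sets are those locally cut out by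 real polynomials in the real and imaginary parts of the coordinates. *)

(* Defs.v *)
From HB Require Import structures.
From mathcomp Require Import all_boot all_order all_algebra sesquilinear.
From mathcomp Require Import all_classical all_reals all_analysis.
From mathcomp Require Import complex.
(* The notations of mpoly clash with those of mathcomp-analysis.              *)
From mathcomp Require mpoly.
Import (canonicals) mpoly.

Set Implicit Arguments.
Unset Strict Implicit.
Unset Printing Implicit Defensive.
Import Order.TTheory GRing.Theory Num.Theory.
Import numFieldNormedType.Exports.
Local Open Scope quotient_scope.
Local Open Scope classical_set_scope.
Local Open Scope complex_scope.
Local Open Scope ring_scope.

(* The tensor product of two K-modules, as a quotient of the formal sums of   *)
(* pairs: two formal sums are identified when every balanced biadditive map   *)
(* (into every abelian group) takes the same value on them.  Using balanced   *)
(* biadditive maps rather than bilinear ones also covers the antilinear map   *)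
(* x (x) y |-> x^* (x) y^*.                                                   *)
Section Tensor.
Variables (K : comNzRingType) (U V : lmodType K).

Definition balanced (W : zmodType) (b : U -> V -> W) : Prop :=
  [/\ forall v, {morph b^~ v : x y / x + y},
      forall u, {morph b u : x y / x + y}
    & forall k u v, b (k *: u) v = b u (k *: v)].

Definition formal_eval (W : zmodType) (b : U -> V -> W) (s : seq (U * V)) : W :=
  \sum_(p <- s) b p.1 p.2.

Definition tensor_eq (s t : seq (U * V)) : bool :=
  `[< forall (W : zmodType) (b : U -> V -> W),
        balanced b -> formal_eval b s = formal_eval b t >].

Lemma tensor_eq_refl : reflexive tensor_eq.
Proof. by move=> s; apply/asboolP. Qed.

Lemma tensor_eq_sym : symmetric tensor_eq.
Proof.
by move=> s t; apply/asboolP/asboolP => st W b bb; rewrite (st W b bb).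
Qed.

Lemma tensor_eq_trans : transitive tensor_eq.
Proof.
move=> t s r /asboolP st /asboolP tr; apply/asboolP => W b bb.
by rewrite (st W b bb) (tr W b bb).
Qed.

Canonical tensor_equiv :=
  EquivRel tensor_eq tensor_eq_refl tensor_eq_sym tensor_eq_trans.

Definition tensor := {eq_quot tensor_eq}.
HB.instance Definition _ := Choice.on tensor.
HB.instance Definition _ := EqQuotient.on tensor.

(* The additive map on the tensor product induced by b; meaningful when b is  *)
(* balanced, cf. tlift_tens and tliftD.                                       *)
Definition tlift (W : zmodType) (b : U -> V -> W) (x : tensor) : W :=
  formal_eval b (repr x).

Lemma tlift_pi (W : zmodType) (b : U -> V -> W) s :
  balanced b -> tlift b (\pi_tensor s) = formal_eval b s.
Proof. by move=> bb; rewrite /tlift; case: piP => t /eqmodP /asboolP ->. Qed.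

Lemma tensorP (x y : tensor) :
  (forall (W : zmodType) (b : U -> V -> W), balanced b -> tlift b x = tlift b y)
  -> x = y.
Proof.
by move=> xy; rewrite -[x]reprK -[y]reprK; apply/eqmodP/asboolP.
Qed.

Definition tens (u : U) (v : V) : tensor := \pi_tensor [:: (u, v)].
Definition tensor0 : tensor := \pi_tensor [::].
Definition tensor_add (x y : tensor) : tensor :=
  \pi_tensor (repr x ++ repr y).
Definition tensor_scale (k : K) (x : tensor) : tensor :=
  \pi_tensor [seq (k *: p.1, p.2) | p <- repr x].
Definition tensor_opp (x : tensor) : tensor := tensor_scale (-1) x.

Lemma tlift_tens (W : zmodType) (b : U -> V -> W) u v :
  balanced b -> tlift b (tens u v) = b u v.
Proof. by move=> bb; rewrite tlift_pi // /formal_eval big_seq1. Qed.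

Let tlift0 (W : zmodType) (b : U -> V -> W) : balanced b -> tlift b tensor0 = 0.
Proof. by move=> bb; rewrite tlift_pi // /formal_eval big_nil. Qed.

Let tlift_add (W : zmodType) (b : U -> V -> W) x y :
  balanced b -> tlift b (tensor_add x y) = tlift b x + tlift b y.
Proof. by move=> bb; rewrite tlift_pi // /formal_eval big_cat. Qed.

Lemma balanced_scale (W : zmodType) (b : U -> V -> W) k :
  balanced b -> balanced (fun u v => b (k *: u) v).
Proof.
case=> bl br bm; split=> [v x y|u x y|l u v] /=.
- by rewrite scalerDr bl.
- by rewrite br.
- by rewrite scalerA mulrC -scalerA bm.
Qed.

Let tlift_scale (W : zmodType) (b : U -> V -> W) k x :
  balanced b -> tlift b (tensor_scale k x) = tlift (fun u v => b (k *: u) v) x.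
Proof. by move=> bb; rewrite tlift_pi // /formal_eval big_map. Qed.

Let tlift_scaleD (W : zmodType) (b : U -> V -> W) k l x :
  balanced b -> tlift (fun u v => b ((k + l) *: u) v) x =
    tlift (fun u v => b (k *: u) v) x + tlift (fun u v => b (l *: u) v) x.
Proof.
move=> [bl _ _]; rewrite /tlift /formal_eval -big_split /=.
by apply: eq_bigr => p _; rewrite scalerDl bl.
Qed.

Fact tensor_addA : associative tensor_add.
Proof. by move=> x y z; apply: tensorP => W b bb; rewrite !tlift_add // addrA. Qed.

Fact tensor_addC : commutative tensor_add.
Proof. by move=> x y; apply: tensorP => W b bb; rewrite !tlift_add // addrC. Qed.

Fact tensor_add0 : left_id tensor0 tensor_add.
Proof. by move=> x; apply: tensorP => W b bb; rewrite tlift_add // tlift0 // add0r. Qed.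

Fact tensor_addN : left_inverse tensor0 tensor_opp tensor_add.
Proof.
move=> x; apply: tensorP => W b bb; rewrite tlift_add // tlift0 // tlift_scale //.
have -> : tlift b x = tlift (fun u v => b (1 *: u) v) x.
  by rewrite /tlift /formal_eval; apply: eq_bigr => p _; rewrite scale1r.
rewrite -tlift_scaleD // addNr /tlift /formal_eval big1 // => p _.
by case: bb => bl _ _; rewrite scale0r; apply: (addrI (b 0 p.2)); rewrite -bl !addr0.
Qed.

HB.instance Definition _ :=
  GRing.isZmodule.Build tensor tensor_addA tensor_addC tensor_add0 tensor_addN.

Fact tensor_scaleA k l x :
  tensor_scale k (tensor_scale l x) = tensor_scale (k * l) x.
Proof.
apply: tensorP => W b bb.
rewrite !tlift_scale //; last exact: balanced_scale.
by rewrite /tlift /formal_eval; apply: eq_bigr => p _; rewrite scalerA.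
Qed.

Fact tensor_scale1 : left_id 1 tensor_scale.
Proof.
move=> x; apply: tensorP => W b bb; rewrite tlift_scale // /tlift /formal_eval.
by apply: eq_bigr => p _; rewrite scale1r.
Qed.

Fact tensor_scaleDr : right_distributive tensor_scale +%R.
Proof.
move=> k x y; apply: tensorP => W b bb; rewrite [in RHS]tlift_add //.
by rewrite !tlift_scale // tlift_add //; exact: balanced_scale.
Qed.

Fact tensor_scaleDl x : {morph tensor_scale^~ x : k l / k + l}.
Proof.
move=> k l; apply: tensorP => W b bb; rewrite [in RHS]tlift_add //.
by rewrite !tlift_scale // tlift_scaleD.
Qed.

HB.instance Definition _ := GRing.Zmodule_isLmodule.Build K tensor
  tensor_scaleA tensor_scale1 tensor_scaleDr tensor_scaleDl.

Lemma tliftD (W : zmodType) (b : U -> V -> W) :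
  balanced b -> {morph tlift b : x y / x + y}.
Proof. by move=> bb x y; exact: tlift_add. Qed.

Lemma tensZl k u v : tens (k *: u) v = k *: tens u v.
Proof.
apply: tensorP => W b bb; rewrite tlift_scale // !tlift_tens //.
exact: balanced_scale.
Qed.

Lemma balanced_tens : balanced tens.
Proof.
split=> [v x y|u x y|k u v]; apply: tensorP => W b bb.
- by rewrite tliftD // !tlift_tens //; case: bb => -> .
- by rewrite tliftD // !tlift_tens //; case: bb => _ -> .
- by rewrite !tlift_tens //; case: bb => _ _ -> .
Qed.

Lemma tensor_ind (P : tensor -> Prop) :
  P 0 -> (forall u v x, P x -> P (tens u v + x)) -> forall x, P x.
Proof.
move=> P0 PS x; rewrite -[x]reprK; elim: (repr x) => [//|[u v] s IHs].
suff -> : \pi_tensor ((u, v) :: s) = tens u v + \pi_tensor s by exact: PS.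
apply: tensorP => W b bb; rewrite tliftD // tlift_tens // !tlift_pi //.
by rewrite /formal_eval big_cons.
Qed.

End Tensor.

Arguments tensor K (U V)%_type_scope.
Notation "U ⊗ V" := (tensor U V) (at level 40, left associativity).

Section TensorMaps.
Variable K : comNzRingType.

Definition tmap (U V U' V' : lmodType K) (f : U -> U') (g : V -> V') :
  U ⊗ V -> U' ⊗ V' := tlift (fun u v => tens (f u) (g v)).

Definition tassoc (U V W : lmodType K) : (U ⊗ V) ⊗ W -> U ⊗ (V ⊗ W) :=
  tlift (fun x w => tlift (fun u v => tens u (tens v w)) x).

Definition tmul (A : algType K) (x y : A ⊗ A) : A ⊗ A :=
  tlift (fun a b => tlift (fun c d => tens (a * c) (b * d)) y) x.

Lemma balanced_linear (U V U' V' : lmodType K) (f : {linear U -> U'})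
  (g : {linear V -> V'}) : balanced (fun u v => tens (f u) (g v)).
Proof.
have [bl br bm] := balanced_tens U' V'.
by split=> [v x y|u x y|k u v]; rewrite !(linearD, linearZ) /= ?bl ?br ?bm.
Qed.

Lemma tmap_tens (U V U' V' : lmodType K) (f : {linear U -> U'})
  (g : {linear V -> V'}) u v : tmap f g (tens u v) = tens (f u) (g v).
Proof. by rewrite /tmap tlift_tens //; exact: balanced_linear. Qed.

Lemma tmapD (U V U' V' : lmodType K) (f : {linear U -> U'})
  (g : {linear V -> V'}) : {morph tmap f g : x y / x + y}.
Proof. exact/tliftD/balanced_linear. Qed.

Lemma tmap0 (U V U' V' : lmodType K) (f : {linear U -> U'})
  (g : {linear V -> V'}) : tmap f g 0 = 0.
Proof. by apply: (addrI (tmap f g 0)); rewrite -tmapD !addr0. Qed.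

End TensorMaps.

Section HopfStar.
Variable R : realType.
Local Notation C := R[i].

Record hopfStarAlgebra := HopfStarAlgebra {
  hopf_alg :> algType C;
  comul : {linear hopf_alg -> hopf_alg ⊗ hopf_alg};
  counit : {lrmorphism hopf_alg -> C^o};
  antipode : {linear hopf_alg -> hopf_alg};
  star : hopf_alg -> hopf_alg;
  comulA : forall h,
    tassoc (tmap comul idfun (comul h)) = tmap idfun comul (comul h);
  counitl : forall h, tlift (fun a b => counit a *: b) (comul h) = h;
  counitr : forall h, tlift (fun a b => counit b *: a) (comul h) = h;
  comul1 : comul 1 = tens 1 1;
  comulM : forall g h, comul (g * h) = tmul (comul g) (comul h);
  antipodel : forall h,
    tlift (fun a b => antipode a * b) (comul h) = counit h *: 1;
  antipoder : forall h,
    tlift (fun a b => a * antipode b) (comul h) = counit h *: 1;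
  starD : {morph star : g h / g + h};
  starZ : forall (k : C) h, star (k *: h) = Num.conj k *: star h;
  starM : forall g h, star (g * h) = star h * star g;
  starK : involutive star;
  comul_star : forall h, comul (star h) = tmap star star (comul h);
  counit_star : forall h, counit (star h) = Num.conj (counit h)
}.

Arguments comul {_}.
Arguments counit {_}.
Arguments antipode {_}.
Arguments star {_}.

Definition is_hopf_star_morphism (H H' : hopfStarAlgebra)
    (f : {lrmorphism H -> H'}) : Prop :=
  [/\ forall h, comul (f h) = tmap f f (comul h),
      forall h, counit (f h) = counit h,
      forall h, antipode (f h) = f (antipode h)
    & forall h, star (f h) = f (star h)].

Section Comodules.
Variable H : hopfStarAlgebra.

Definition is_comodule (V : vectType C) (rho : V -> V ⊗ H) : Prop :=
  [/\ linear rho,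
      forall v, tassoc (tmap rho idfun (rho v)) = tmap idfun (@comul H) (rho v)
    & forall v, tlift (fun w h => counit h *: w) (rho v) = v].

(* For f : {dot V for Num.conj}, f v w is linear in v and antilinear in w; the   *)
(* inner product <v | w> of the unitarity condition is f w v: it has to be    *)
(* antilinear in v for v0 (x) v1 |-> <v0 | w> v1^* to be well defined.        *)
Definition unitarizable (V : vectType C) (rho : V -> V ⊗ H) : Prop :=
  exists f : {dot V for Num.conj}, forall v w : V,
    tlift (fun v0 v1 => f w v0 *: star v1) (rho v) =
    tlift (fun w0 w1 => f w0 v *: antipode w1) (rho w).

Definition subcomodule (V : vectType C) (rho : V -> V ⊗ H) (W : {vspace V})
    : Prop :=
  forall w, w \in W ->
    exists t : subvs_of W ⊗ H, tmap (@vsval _ _ W) idfun t = rho w.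

(* The coaction on a subcomodule W.  The choice of the projection vsproj W    *)
(* is immaterial, by subcoactionE.                                            *)
Definition subcoaction (V : vectType C) (rho : V -> V ⊗ H) (W : {vspace V})
    (w : subvs_of W) : subvs_of W ⊗ H :=
  tmap (@vsproj _ _ W) idfun (rho (vsval w)).

Definition comodule_iso (X Y : vectType C) (sigma : X -> X ⊗ H)
    (tau : Y -> Y ⊗ H) : Prop :=
  exists f : 'Hom(X, Y),
    [/\ lker f = 0%VS, limg f = fullv
      & forall x, tau (f x) = tmap f idfun (sigma x)].

Definition trivial_coaction (z : C^o) : C^o ⊗ H := tens z 1.

Definition irreducible_comodule (M : vectType C) (sigma : M -> M ⊗ H) : Prop :=
  [/\ is_comodule sigma, \dim {:M} != 0%N
    & forall W : {vspace M}, subcomodule sigma W -> W = 0%VS \/ W = fullv].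

(* (M, sigma) is a quotient of a subcomodule Z of (X, rho); only the values   *)
(* of q on Z matter.                                                          *)
Definition subquotient (X M : vectType C) (rho : X -> X ⊗ H)
    (sigma : M -> M ⊗ H) : Prop :=
  exists (Z : {vspace X}) (q : 'Hom(X, M)),
    [/\ subcomodule rho Z, (q @: Z)%VS = fullv
      & forall z, z \in Z -> sigma (q z) = tmap q idfun (rho z)].

Definition constrained (l : nat) (X : vectType C) (rho : X -> X ⊗ H) : Prop :=
  forall (M : vectType C) (sigma : M -> M ⊗ H),
    irreducible_comodule sigma -> subquotient rho sigma ->
    ~ comodule_iso sigma trivial_coaction -> (\dim {:M} <= l)%N.

Lemma subcoactionE (V : vectType C) (rho : V -> V ⊗ H) (W : {vspace V}) w :
  subcomodule rho W ->
  tmap (@vsval _ _ W) idfun (subcoaction rho w) = rho (vsval w).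
Proof.
move=> /(_ _ (subvsP w)) [t tw]; rewrite /subcoaction -tw; congr (tmap _ _ _).
elim/tensor_ind: t {tw} => [|u h t IHt]; first by rewrite !tmap0.
by rewrite !tmapD IHt !tmap_tens /= vsvalK.
Qed.

End Comodules.

Definition cqg (H : hopfStarAlgebra) : Prop :=
  forall (V : vectType C) (rho : V -> V ⊗ H), is_comodule rho ->
    unitarizable rho.

Definition push_coaction (H H' : hopfStarAlgebra) (f : H -> H')
    (V : vectType C) (rho : V -> V ⊗ H) (v : V) : V ⊗ H' :=
  tmap idfun f (rho v).

(* pi : H -> K is the universal morphism H -> H_(W_i <= V).                   *)
Definition initial_stabilizing (H : hopfStarAlgebra) (V : vectType C)
    (rho : V -> V ⊗ H) (F : Type) (W : F -> {vspace V})
    (K : hopfStarAlgebra) (pi : {lrmorphism H -> K}) : Prop :=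
  [/\ cqg K, is_hopf_star_morphism pi,
      forall i, subcomodule (push_coaction pi rho) (W i)
    & forall (K' : hopfStarAlgebra) (pi' : {lrmorphism H -> K'}),
        cqg K' -> is_hopf_star_morphism pi' ->
        (forall i, subcomodule (push_coaction pi' rho) (W i)) ->
        exists phi : {lrmorphism K -> K'},
          [/\ is_hopf_star_morphism phi, phi \o pi =1 pi'
            & forall psi : {lrmorphism K -> K'}, is_hopf_star_morphism psi ->
                psi \o pi =1 pi' -> psi =1 phi]].

End HopfStar.

Section Grassmannians.
Variables (R : realType) (V : vectType R[i]).
Local Notation C := R[i].

Definition grassmannian (d : nat) := {W : {vspace V} | \dim W == d}.

(* A basis of V split into d and \dim V - d vectors (none if d > \dim V); it  *)
(* gives the affine chart of the subspaces which are graphs of linear maps    *)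
(* from the span of the first vectors to the span of the last ones.           *)
Definition frame (d : nat) :=
  {ab : d.-tuple V * (\dim {:V} - d).-tuple V
      | basis_of fullv (ab.1 ++ ab.2)}.

Definition graph_tuple d (e : frame d) (A : 'M[C]_(d, \dim {:V} - d)) :
  d.-tuple V :=
  [tuple tnth (val e).1 p + \sum_q A p q *: tnth (val e).2 q | p < d].

Lemma dim_graph d (e : frame d) A : \dim <<graph_tuple e A>> == d.
Proof.
set a := (val e).1; set b := (val e).2.
have ab : basis_of fullv (a ++ b) := valP e.
have /andP[/eqP abV /eqP dab] := ab.
have dV : size (a ++ b) = \dim {:V} by rewrite -dab abV.
have dd : (d <= \dim {:V})%N by rewrite -dV size_cat size_tuple leq_addr.
rewrite eqn_leq; apply/andP; split.
  by rewrite -[leqRHS](size_tuple (graph_tuple e A)) dim_span.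
rewrite -(leq_add2r (\dim {:V} - d)) subnKC //.
have db : (\dim <<b>> <= \dim {:V} - d)%N.
  by rewrite -[leqRHS](size_tuple b) dim_span.
apply: leq_trans (leq_add (leqnn _) db).
apply: leq_trans (dimv_add_leqif _ _).1; apply: dimvS.
suff : (<<a ++ b>> <= <<graph_tuple e A>> + <<b>>)%VS by rewrite abV.
apply/span_subvP => v.
have bin q : tnth b q \in <<b>>%VS by exact/memv_span/mem_tnth.
rewrite mem_cat => /orP[/tnthP[p ->]|vb]; last first.
  by apply: (subvP (addvSr _ _)); exact: memv_span.
have -> : tnth a p = tnth (graph_tuple e A) p - \sum_q A p q *: tnth b q.
  by rewrite tnth_mktuple /= addrK.
apply: memv_add; first exact/memv_span/mem_tnth.
by rewrite rpredN; apply: rpred_sum => q _; exact: rpredZ.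
Qed.

Definition graph_point d (e : frame d) A : grassmannian d :=
  exist _ <<graph_tuple e A>>%VS (dim_graph e A).

Variables (F : finType) (d : F -> nat).

Definition multigrass := forall i : F, grassmannian (d i).

(* Real coordinates of a chart: the real (false) and imaginary (true) parts   *)
(* of the matrix entries of the graphs.                                       *)
Definition coord :=
  ({i : F & ('I_(d i) * 'I_(\dim {:V} - d i))%type} * bool)%type.

Definition entry i p q (b : bool) : coord :=
  (Tagged (fun i => ('I_(d i) * 'I_(\dim {:V} - d i))%type)
          ((p, q) : 'I_(d i) * 'I_(\dim {:V} - d i)), b).

Definition coord_mx (x : 'rV[R]_#|{: coord}|) i : 'M[C]_(d i, \dim {:V} - d i) :=
  \matrix_(p, q) (x 0 (enum_rank (entry p q false))
                  +i* x 0 (enum_rank (entry p q true))).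

Definition chart (e : forall i, frame (d i)) (x : 'rV[R]_#|{: coord}|) :
  multigrass := fun i => graph_point (e i) (coord_mx x i).

End Grassmannians.

Section StandardTopology.
Variables (R : realType) (V : vectType R[i]) (F : finType) (d : F -> nat).

HB.instance Definition _ := gen_eqMixin (multigrass V d).
HB.instance Definition _ := gen_choiceMixin (multigrass V d).

Definition chart_open : set_system (multigrass V d) :=
  [set S | forall e, open (chart e @^-1` S)].

Fact chart_openT : chart_open setT.
Proof. by move=> e; rewrite preimage_setT; exact: openT. Qed.

Fact chart_openI : setI_closed chart_open.
Proof. by move=> A B oA oB e; rewrite preimage_setI; exact: openI. Qed.

Fact chart_open_bigU (I : Type) (f : I -> set (multigrass V d)) :
  (forall i, chart_open (f i)) -> chart_open (\bigcup_i f i).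
Proof.
by move=> fo e; rewrite preimage_bigcup; apply: bigcup_open => i _; exact: fo.
Qed.

HB.instance Definition _ := isOpenTopological.Build (multigrass V d)
  chart_openT chart_openI chart_open_bigU.

End StandardTopology.

Section ZariskiTopology.
Variable R : realType.

Definition real_algebraic n (Z : set 'rV[R]_n) : Prop :=
  exists P : set (mpoly.mpoly n R),
    Z = [set x | forall p, P p -> mpoly.meval (fun k => x 0 k) p = 0].

Lemma real_algebraic0 n : real_algebraic (@set0 'rV[R]_n).
Proof.
exists [set 1 : mpoly.mpoly n R]; apply/esym/seteqP; split=> x //= /(_ 1 erefl).
by rewrite mpoly.meval1 => /eqP; rewrite oner_eq0.
Qed.

Lemma real_algebraicU n (Y Z : set 'rV[R]_n) :
  real_algebraic Y -> real_algebraic Z -> real_algebraic (Y `|` Z).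
Proof.
move=> [P ->] [Q ->].
exists [set r | exists p q, [/\ P p, Q q & r = p * q]].
apply/seteqP; split=> x /=.
  move=> + r [p [q [Pp Qq ->]]]; rewrite mpoly.mevalM.
  by case=> [/(_ _ Pp)|/(_ _ Qq)] ->; rewrite ?mul0r ?mulr0.
move=> PQ; apply: contrapT => /not_orP[/existsNP[p /not_implyP[Pp px]]].
move=> /existsNP[q /not_implyP[Qq qx]].
have : mpoly.meval (fun k => x 0 k) (p * q) = 0 by apply: PQ; exists p, q.
by rewrite mpoly.mevalM => /eqP; rewrite mulf_eq0 => /orP[] /eqP.
Qed.

Lemma real_algebraic_bigcap n (J : Type) (Z : J -> set 'rV[R]_n) :
  (forall i, real_algebraic (Z i)) -> real_algebraic (\bigcap_i Z i).
Proof.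
move=> /choice[P ZP]; exists (\bigcup_i P i); apply/seteqP; split=> x /=.
  by move=> Zx p [i _ Pip]; have := Zx i I; rewrite ZP => /(_ p Pip).
by move=> Px i _; rewrite ZP => p Pip; apply: Px; exists i.
Qed.

Variables (V : vectType R[i]) (F : finType) (d : F -> nat).

(* The points of Res_(C/R) G(d, V) are those of G(d, V); this alias carries   *)
(* the real Zariski topology.                                                 *)
Definition weil_multigrass := multigrass V d.
HB.instance Definition _ := Choice.on weil_multigrass.

Definition zariski_open : set_system weil_multigrass :=
  [set S | forall e, real_algebraic (@chart R V F d e @^-1` (~` S))].

Fact zariski_openT : zariski_open setT.
Proof. by move=> e; rewrite setCT preimage_set0; exact: real_algebraic0. Qed.

Fact zariski_openI : setI_closed zariski_open.
Proof.
by move=> A B oA oB e; rewrite setCI preimage_setU; exact: real_algebraicU.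
Qed.

Fact zariski_open_bigU (I : Type) (f : I -> set weil_multigrass) :
  (forall i, zariski_open (f i)) -> zariski_open (\bigcup_i f i).
Proof.
move=> fo e; rewrite setC_bigcup preimage_bigcap.
by apply: real_algebraic_bigcap => i; exact: fo.
Qed.

HB.instance Definition _ := isOpenTopological.Build weil_multigrass
  zariski_openT zariski_openI zariski_open_bigU.

End ZariskiTopology.

Definition constrained_locus (R : realType) (H : hopfStarAlgebra R)
    (V : vectType R[i]) (rho : V -> V ⊗ H) (F : finType) (F' : {set F})
    (d : F -> nat) (l : {j : F | j \in F'} -> nat) : set (multigrass V d) :=
  [set W | exists (K : hopfStarAlgebra R) (pi : {lrmorphism H -> K}),
     initial_stabilizing rho (fun i => val (W i)) pi /\
     forall j : {j : F | j \in F'},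
       constrained (l j)
         (@subcoaction R K V (push_coaction pi rho) (val (W (val j))))].
Arguments constrained_locus {R H V} rho {F F'} d l.

(* Main.v *)
(** The coaction on V is a matrix u over H, unitary for a positive definite Q.
    The kernel of H -> H_(W_i <= V) is the ideal generated by the entries of the
    commutators of u with the Q-orthogonal projections P_i onto the W_i, and by
    a Tannaka-type duality every vector of a corepresentation which is invariant
    modulo this ideal is obtained from the P_i (as invariant vectors of
    u (x) conj u) by intertwiners of H, tensor products, conjugation and
    insertion of dual bases.  In an affine chart the P_i are real rational
    functions of the point without poles, so an invariant vector at one point
    extends to a rational family of invariant vectors.

    For l > 0, a unitary comodule X is l-constrained if and only if the b^i t_k
    span X for some endomorphism b and some vectors t_1, ..., t_l: let b act by
    a different scalar on each irreducible summand and let t_k be the sum of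
    the k-th basis vectors; conversely b is scalar on some copy of any given
    irreducible quotient, which is thus spanned by l vectors.  An endomorphism
    b of W_j is an invariant vector, so it extends to a family, and spanning
    persists where some determinant is nonzero.  For l = 0 the same is done
    with the invariant vectors of W_j.  Density follows from openness since two
    points lie in a common chart, and a nonzero polynomial on the line through
    them has finitely many roots. *)
From HB Require Import structures.
From mathcomp Require Import all_boot all_order all_algebra sesquilinear.
From mathcomp Require Import all_classical all_reals all_analysis.
From mathcomp Require Import complex mxtens.
From mathcomp Require mpoly.
Import (canonicals) mpoly.
Require Import Defs.

Set Implicit Arguments.
Unset Strict Implicit.
Unset Printing Implicit Defensive.
Import Order.TTheory GRing.Theory Num.Theory.
Local Open Scope ring_scope.
(* Defs.coord hides the coordinates with respect to a basis. *)
Local Notation vcoord := mathcomp.algebra.vector.coord.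

(** The duality carries the argument. Its obstacle is that the ideal is known only through
    generators, so that an invariant vector comes with no construction; the proof works with
    matrices and no Haar state. Let [G] consist of the constructible vectors. Their matrix
    coefficients form a subalgebra of [H], a candidate for the functions on the homogeneous space of
    the stabilizer. The coefficients of vectors orthogonal to [G] are stable under right
    multiplication by it; both kinds together span [H], and the counit vanishes on elements of both
    kinds. Insertion of dual bases makes the left ideal generated by the constructible coefficients
    of counit 0 two-sided, and it contains the commutators. So, for the part x2 of an invariant
    vector orthogonal to [G], the entries of y x2 - x2 are b + c with b orthogonal and c
    constructible of counit 0. Then x2 + c is entrywise of both kinds, and its counit x2 is 0.

    [G] stays abstract here; taking for it the values at a point of regular families of invariant
    vectors leaves only closure properties to check. *)

Section Functionals.
Variables (F : fieldType) (E : lmodType F).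

(** A maximal subspace avoiding [a] is a complement of the line of [a], and f reads off the
    coefficient of [a]. The space may have infinite dimension. *)
Lemma functional_separates (a : E) :
  a != 0 -> exists f : {linear E -> F^o}, f a != 0.
Proof.
move=> a0.
(* Membership of 0 is left out so that the union of the empty chain qualifies; for M it follows from
   maximality. *)
pose P (A : set E) :=
  (forall (k : F) x y, A x -> A y -> A (k *: x + y)) /\ ~ A a.
have [|M [[Mlin Ma] Mmax]] := @Zorn_bigcup E P.
  move=> S SP tot; split=> [k x y [X SX Xx] [Y SY Yy]|[X SX]]; last first.
    by case: (SP X SX).
  have [XY|YX] := tot X Y SX SY.
    by exists Y => //; apply: (SP Y SY).1 => //; exact: XY.
  by exists X => //; apply: (SP X SX).1 => //; exact: YX.
have M0 : M 0.
  apply: contrapT => nM0; apply: (Mmax [set 0]%classic).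
    split=> [x Mx|/(_ 0 erefl)//]; case: nM0.
    by have := Mlin (-1) x x Mx Mx; rewrite scaleN1r addNr.
  split=> [k x y /= -> ->|/= aE]; first by rewrite scaler0 addr0.
  by rewrite aE eqxx in a0.
have MZ k x : M x -> M (k *: x) by move=> Mx; rewrite -[_ *: _]addr0; exact: Mlin.
have MD x y : M x -> M y -> M (x + y).
  by move=> Mx My; have := Mlin 1 x y Mx My; rewrite scale1r.
have dec v : exists c : F, M (v - c *: a).
  have [Mv|Mv] := pselect (M v); first by exists 0; rewrite scale0r subr0.
  pose M' : set E := [set w | exists m c, M m /\ w = m + c *: v]%classic.
  have [m [c [Mm aE]]] : M' a.
    apply: contrapT => nM'; apply: (Mmax M'); split => //.
    + by move=> m Mm; exists m, 0; rewrite scale0r addr0.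
    + by move=> /(_ v); apply: contra_not Mv; apply; exists 0, 1; rewrite scale1r add0r.
    - move=> k _ _ [m [c [Mm ->]]] [m' [c' [Mm' ->]]].
      exists (k *: m + m'), (k * c + c'); split; [exact: Mlin|].
      by rewrite scalerDr scalerA addrACA -scalerDl.
  have c0 : c != 0.
    by apply/eqP => c0; apply: Ma; rewrite aE c0 scale0r addr0.
  exists c^-1; rewrite aE scalerDr scalerA mulVf // scale1r opprD addrCA subrr addr0.
  by rewrite -scalerN -scaleN1r; exact: (MZ _ _ (MZ _ _ Mm)).
have uniq v c c' : M (v - c *: a) -> M (v - c' *: a) -> c = c'.
  move=> Mc Mc'; apply/eqP; rewrite -subr_eq0; apply/eqP; apply: contra_notP Ma.
  move=> /eqP cc'; have := Mlin (-1) _ _ Mc Mc'.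
  rewrite scaleN1r opprB addrA subrK -scalerBl => /(MZ (c - c')^-1).
  by rewrite scalerA mulVf // scale1r.
have [f fP] := choice dec.
have flin : linear (f : E -> F^o).
  move=> k x y; apply: (uniq (k *: x + y)); first exact: fP.
  rewrite scalerDl opprD addrACA -scalerA -scalerBr; apply: Mlin; exact: fP.
pose L : {linear E -> F^o} := HB.pack f (GRing.isLinear.Build _ _ _ _ f flin).
exists L => /=; have -> : f a = 1; last exact: oner_neq0.
by apply: (uniq a); [exact: fP | rewrite scale1r subrr].
Qed.

Lemma functional_eq0 (a : E) : (forall f : {linear E -> F^o}, f a = 0) -> a = 0.
Proof.
move=> fa; apply/eqP; apply: contraT => /functional_separates[f].
by rewrite fa eqxx.
Qed.

End Functionals.

(** * Positive definite matrices *)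

Section PositiveDefinite.
Variable C : numClosedFieldType.

Definition ctr m n (A : 'M[C]_(m, n)) : 'M[C]_(n, m) := map_mx Num.conj A^T.

Lemma ctrK m n : cancel (@ctr m n) (@ctr n m).
Proof. by move=> A; apply/matrixP => i j; rewrite !mxE conjCK. Qed.

Lemma ctrM m n p (A : 'M[C]_(m, n)) (B : 'M[C]_(n, p)) :
  ctr (A *m B) = ctr B *m ctr A.
Proof. by rewrite /ctr trmx_mul map_mxM. Qed.

Lemma ctr1 n : ctr (1%:M : 'M[C]_n) = 1%:M.
Proof. by rewrite /ctr trmx1 map_mx1. Qed.

Lemma ctr_inv n (A : 'M[C]_n) : ctr (invmx A) = invmx (ctr A).
Proof. by rewrite /ctr trmx_inv map_invmx. Qed.

Definition injmx m n (B : 'M[C]_(m, n)) :=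
  forall x : 'cV_n, B *m x = 0 -> x = 0.

Lemma injmxP m n (B : 'M[C]_(m, n)) :
  injmx B <-> exists B' : 'M[C]_(n, m), B' *m B = 1%:M.
Proof.
split=> [Binj|[B' B'B] x /(congr1 (mulmx B'))]; last first.
  by rewrite mulmxA B'B mul1mx mulmx0.
suff /row_freeP[B' BB'] : row_free B^T.
  by exists B'^T; apply: trmx_inj; rewrite trmx_mul trmxK BB' trmx1.
rewrite -kermx_eq0; apply/eqP/row_matrixP => i; rewrite row0.
apply: trmx_inj; rewrite trmx0; apply: Binj; apply: trmx_inj.
by rewrite trmx_mul trmxK trmx0 -row_mul mulmx_ker row0.
Qed.

Definition posdef n (Q : 'M[C]_n) : Prop :=
  ctr Q = Q /\ forall x : 'cV_n, x != 0 -> 0 < (ctr x *m Q *m x) 0 0.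

Lemma posdef_unit n (Q : 'M[C]_n) : posdef Q -> Q \in unitmx.
Proof.
move=> [_ Qpos].
have /injmxP[Q' /mulmx1_unit[]//] : injmx Q.
move=> x Qx; apply/eqP; apply: contraT => /Qpos.
by rewrite -mulmxA Qx mulmx0 mxE ltxx.
Qed.

Lemma posdef_inv n (Q : 'M[C]_n) : posdef Q -> posdef (invmx Q).
Proof.
move=> Qp; have Qu := posdef_unit Qp; case: (Qp) => Qh Qpos.
split=> [|x x0]; first by rewrite ctr_inv Qh.
have -> : ctr x *m invmx Q *m x =
    ctr (invmx Q *m x) *m Q *m (invmx Q *m x).
  by rewrite ctrM ctr_inv Qh -!mulmxA mulKVmx.
apply: Qpos; apply: contraNneq x0 => /(congr1 (mulmx Q)).
by rewrite mulKVmx // mulmx0 => ->.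
Qed.

Lemma posdef_sub n r (Q : 'M[C]_n) (B : 'M[C]_(n, r)) :
  posdef Q -> injmx B -> posdef (ctr B *m Q *m B).
Proof.
move=> [Qh Qpos] Binj; split=> [|x x0]; first by rewrite !ctrM ctrK Qh mulmxA.
have -> : ctr x *m (ctr B *m Q *m B) *m x = ctr (B *m x) *m Q *m (B *m x).
  by rewrite ctrM !mulmxA.
by apply: Qpos; apply: contraNneq x0 => /Binj ->.
Qed.

Lemma posdef_conj n (Q : 'M[C]_n) : posdef Q -> posdef (map_mx Num.conj Q).
Proof.
move=> [Qh Qpos]; split=> [|x x0].
  by rewrite -{2}Qh; apply/matrixP => i j; rewrite !mxE.
have x0' : map_mx Num.conj x != 0.
  by apply: contraNneq x0 => x0; rewrite -[x]map_mxCK x0 map_mx0.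
have := Qpos _ x0'; set y := map_mx _ x => ypos.
suff -> : ctr x *m map_mx Num.conj Q *m x = map_mx Num.conj (ctr y *m Q *m y).
  by rewrite mxE geC0_conj // ltW.
rewrite !map_mxM; congr (_ *m _ *m _); apply/matrixP => i j;
  rewrite !mxE; first exact: (esym (conjCK _)).
exact: (esym (conjCK _)).
Qed.

(* The orthogonal projection onto the column space of B for the form          *)
(* (x, y) |-> x^* Q y.                                                        *)
Definition oproj n r (Q : 'M[C]_n) (B : 'M[C]_(n, r)) : 'M[C]_n :=
  B *m (invmx (ctr B *m Q *m B) *m (ctr B *m Q)).

Section OrthogonalProjection.
Variables (n r : nat) (Q : 'M[C]_n) (B : 'M[C]_(n, r)).
Hypotheses (Qp : posdef Q) (Binj : injmx B).

Lemma oproj_left : invmx (ctr B *m Q *m B) *m (ctr B *m Q) *m B = 1%:M.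
Proof. by rewrite -mulmxA mulVmx //; exact/posdef_unit/posdef_sub. Qed.

Lemma oproj_id : oproj Q B *m B = B.
Proof. by rewrite /oproj -mulmxA oproj_left mulmx1. Qed.

Lemma oproj_idem : oproj Q B *m oproj Q B = oproj Q B.
Proof. by rewrite {2}/oproj mulmxA oproj_id. Qed.

Lemma oproj_adj : Q *m oproj Q B = ctr (oproj Q B) *m Q.
Proof.
have [Qh _] := Qp; rewrite /oproj !ctrM ctr_inv !ctrM ctrK Qh.
by rewrite !mulmxA.
Qed.

Lemma oproj_orth : ctr B *m Q *m oproj Q B = ctr B *m Q.
Proof.
by rewrite /oproj !mulmxA mulmxV ?mul1mx //; exact/posdef_unit/posdef_sub.
Qed.

End OrthogonalProjection.

(** [S] is any set of vectors: a largest independent family is taken from [S] itself, so that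
    whatever holds for the elements of [S] holds for the columns. *)
Lemma column_basis n (S : 'cV[C]_n -> Prop) :
  exists r (B : 'M[C]_(n, r)), [/\ injmx B, forall i, S (col i B)
    & forall s, S s -> exists c, s = B *m c].
Proof.
pose p r := `[< exists B : 'M[C]_(n, r), injmx B /\ forall i, S (col i B) >].
have p0 : exists r, p r.
  exists 0; apply/asboolP; exists 0; split=> [x _|[]//].
  by apply/matrixP => -[].
have pn r : p r -> (r <= n)%N.
  by move=> /asboolP[B [/injmxP[B' B'B] _]]; exact: mulmx1_min B'B.
case: (ex_maxnP p0 pn) => r /asboolP[B [Binj BS]] rmax.
exists r, B; split=> // s Ss; apply: contrapT => nc.
suff /rmax : p (r + 1)%N by rewrite addn1 ltnn.
apply/asboolP; exists (row_mx B s); split=> [x|i]; last first.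
  case: (split_ordP i) => k ->; first by rewrite colKl.
  by rewrite colKr ord1 col_id.
rewrite -[x]vsubmxK mul_row_col => xE.
have y0 : dsubmx x = 0.
  rewrite [dsubmx x]mx11_scalar; have [->|y0] := eqVneq (dsubmx x 0 0) 0.
    by rewrite raddf0.
  case: nc; exists (- (dsubmx x 0 0)^-1 *: usubmx x).
  move: xE; rewrite [dsubmx x]mx11_scalar mul_mx_scalar addrC => /eqP.
  rewrite addr_eq0 => /eqP/(congr1 (GRing.scale (dsubmx x 0 0)^-1)).
  by rewrite scalerA mulVf // scale1r => ->; rewrite -scalemxAr scaleNr scalerN [in RHS]mxE.
by move: xE; rewrite y0 mulmx0 addr0 => /Binj ->; rewrite col_mx0.
Qed.

End PositiveDefinite.

(** * Tensor products and corepresentation matrices *)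

Section TensorCalculus.
Variable K : comNzRingType.

Section Bilinear.
Variables (U V : lmodType K).

Lemma tensDl (x y : U) (v : V) : tens (x + y) v = tens x v + tens y v.
Proof. by case: (balanced_tens U V) => ->. Qed.

Lemma tensDr (u : U) (x y : V) : tens u (x + y) = tens u x + tens u y.
Proof. by case: (balanced_tens U V) => _ ->. Qed.

Lemma tensZr k (u : U) (v : V) : tens u (k *: v) = k *: tens u v.
Proof. by case: (balanced_tens U V) => _ _ <-; rewrite tensZl. Qed.

Lemma tens0l (v : V) : tens (0 : U) v = 0.
Proof. by rewrite -(scale0r 0) tensZl scale0r. Qed.

Lemma tens0r (u : U) : tens u (0 : V) = 0.
Proof. by rewrite -(scale0r 0) tensZr scale0r. Qed.

Lemma tens_suml I (r : seq I) (P : pred I) (F : I -> U) (v : V) :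
  tens (\sum_(i <- r | P i) F i) v = \sum_(i <- r | P i) tens (F i) v.
Proof.
by apply: (big_morph (fun x => tens x v)) => [x y|]; rewrite ?tensDl ?tens0l.
Qed.

Lemma tens_sumr I (r : seq I) (P : pred I) (F : I -> V) (u : U) :
  tens u (\sum_(i <- r | P i) F i) = \sum_(i <- r | P i) tens u (F i).
Proof.
by apply: (big_morph (tens u)) => [x y|]; rewrite ?tensDr ?tens0r.
Qed.

Lemma tlift_linear (W : lmodType K) (b : U -> V -> W) : balanced b ->
  (forall k u v, b (k *: u) v = k *: b u v) -> linear (tlift b).
Proof.
move=> bb bZ k x y; rewrite tliftD //; congr (_ + _).
have b0 : tlift b 0 = 0 by apply: (addrI (tlift b 0)); rewrite -tliftD // !addr0.
elim/tensor_ind: x => [|u v x IHx]; first by rewrite scaler0 b0 scaler0.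
by rewrite scalerDr !tliftD // IHx scalerDr -tensZl !tlift_tens // bZ.
Qed.

Lemma tlift_ext (W : zmodType) (b c : U -> V -> W) x :
  (forall u v, b u v = c u v) -> tlift b x = tlift c x.
Proof. by move=> bc; rewrite /tlift /formal_eval; apply: eq_bigr. Qed.

Lemma tlift_sum (W : zmodType) (b : U -> V -> W) I (r : seq I) (P : pred I)
  (F : I -> U ⊗ V) : balanced b ->
  tlift b (\sum_(i <- r | P i) F i) = \sum_(i <- r | P i) tlift b (F i).
Proof.
move=> bb; apply: big_morph; first exact: tliftD.
by apply: (addrI (tlift b 0)); rewrite -tliftD // !addr0.
Qed.

Lemma tlift_comp (W W' : zmodType) (h : {additive W -> W'}) (b : U -> V -> W) x :
  h (tlift b x) = tlift (fun u v => h (b u v)) x.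
Proof. by rewrite /tlift /formal_eval raddf_sum. Qed.

Lemma tensor_ext (W : zmodType) (f g : U ⊗ V -> W) :
  {morph f : x y / x + y} -> {morph g : x y / x + y} ->
  (forall u v, f (tens u v) = g (tens u v)) -> f =1 g.
Proof.
move=> fD gD fg x.
have f0 : f 0 = 0 by apply: (addrI (f 0)); rewrite -fD !addr0.
have g0 : g 0 = 0 by apply: (addrI (g 0)); rewrite -gD !addr0.
by elim/tensor_ind: x => [|u v x IHx]; rewrite ?f0 ?g0 // fD gD fg IHx.
Qed.

Variables (f : {linear U -> K^o}) (g : {linear V -> K^o}).

Definition slicel : U ⊗ V -> V := tlift (fun u v => (f u : K) *: v).
Definition slicer : U ⊗ V -> U := tlift (fun u v => (g v : K) *: u).

Lemma balanced_slicel : balanced (fun (u : U) (v : V) => (f u : K) *: v).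
Proof.
split=> [v x y|u x y|k u v] /=; first by rewrite linearD scalerDl.
  by rewrite scalerDr.
by rewrite (linearZ_LR f) scalerA; congr (_ *: _); rewrite [RHS]mulrC.
Qed.

Lemma balanced_slicer : balanced (fun (u : U) (v : V) => (g v : K) *: u).
Proof.
split=> [v x y|u x y|k u v] /=; first by rewrite scalerDr.
  by rewrite linearD scalerDl.
by rewrite (linearZ_LR g) scalerA; congr (_ *: _); rewrite [LHS]mulrC.
Qed.

Fact slicel_linear : linear slicel.
Proof.
apply: tlift_linear; first exact: balanced_slicel.
by move=> k u v; rewrite (linearZ_LR f) scalerA.
Qed.

Fact slicer_linear : linear slicer.
Proof.
apply: tlift_linear; first exact: balanced_slicer.
by move=> k u v; rewrite !scalerA mulrC.
Qed.

HB.instance Definition _ := GRing.isLinear.Build K (U ⊗ V) V *:%R slicel slicel_linear.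
HB.instance Definition _ := GRing.isLinear.Build K (U ⊗ V) U *:%R slicer slicer_linear.

Lemma slicel_tens u v : slicel (tens u v) = (f u : K) *: v.
Proof. by rewrite /slicel tlift_tens //; exact: balanced_slicel. Qed.

Lemma slicer_tens u v : slicer (tens u v) = (g v : K) *: u.
Proof. by rewrite /slicer tlift_tens //; exact: balanced_slicer. Qed.

End Bilinear.

Fact tmap_linear (U V U' V' : lmodType K) (f : {linear U -> U'})
  (g : {linear V -> V'}) : linear (tmap f g).
Proof.
apply: tlift_linear; first exact: balanced_linear.
by move=> k u v; rewrite linearZ /= tensZl.
Qed.

HB.instance Definition _ (U V U' V' : lmodType K) (f : {linear U -> U'})
  (g : {linear V -> V'}) := GRing.isLinear.Build K (U ⊗ V) (U' ⊗ V') *:%R (tmap f g)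
  (tmap_linear f g).

Lemma balanced_comp (U V U' V' : lmodType K) (W : zmodType)
  (f : {linear U -> U'}) (g : {linear V -> V'}) (b : U' -> V' -> W) :
  balanced b -> balanced (fun u v => b (f u) (g v)).
Proof.
case=> bl br bm; split=> [v x y|u x y|k u v] /=; first by rewrite linearD bl.
  by rewrite linearD br.
by rewrite !linearZ bm.
Qed.

Lemma tlift_tmap (U V U' V' : lmodType K) (W : zmodType)
  (f : {linear U -> U'}) (g : {linear V -> V'}) (b : U' -> V' -> W) x :
  balanced b -> tlift b (tmap f g x) = tlift (fun u v => b (f u) (g v)) x.
Proof.
move=> bb; have bc := balanced_comp f g bb.
apply: (@tensor_ext _ _ _ (fun x => tlift b (tmap f g x))) x => [x y|x y|u v].
- by rewrite tmapD tliftD.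
- by rewrite tliftD.
- by rewrite tmap_tens !tlift_tens.
Qed.

Section Associativity.
Variables (U V W : lmodType K).

Lemma balanced_tens_tens (w : W) :
  balanced (fun (u : U) (v : V) => tens u (tens v w)).
Proof.
split=> [v x y|u x y|k u v] /=; first by rewrite tensDl.
  by rewrite tensDl tensDr.
by rewrite !tensZl tensZr.
Qed.

Lemma balanced_tassoc : balanced (fun (x : U ⊗ V) (w : W) =>
  tlift (fun u v => tens u (tens v w)) x).
Proof.
have lin0 (w : W) : tlift (fun u v => tens u (tens v w)) (0 : U ⊗ V) = 0.
  by apply: (addrI (tlift (fun u v => tens u (tens v w)) 0));
     rewrite -tliftD ?addr0 //; exact: balanced_tens_tens.
split=> [w x y|x w w'|k x w] /=.
- by rewrite tliftD //; exact: balanced_tens_tens.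
- elim/tensor_ind: x => [|u v x IHx].
    by rewrite !lin0 addr0.
  rewrite !tliftD; try exact: balanced_tens_tens.
  rewrite IHx !tlift_tens; try exact: balanced_tens_tens.
  by rewrite !tensDr addrACA.
- elim/tensor_ind: x => [|u v x IHx]; first by rewrite scaler0 !lin0.
  rewrite scalerDr !tliftD; try exact: balanced_tens_tens.
  rewrite IHx -tensZl !tlift_tens; try exact: balanced_tens_tens.
  by rewrite tensZl !tensZr.
Qed.

Fact tassoc_linear : linear (@tassoc K U V W).
Proof.
apply: tlift_linear; first exact: balanced_tassoc.
move=> k x w; have := tlift_linear (balanced_tens_tens w) (fun k u v => tensZl k u _).
move=> /(_ k x 0); rewrite addr0 => ->.
suff -> : tlift (fun u v => tens u (tens v w)) (0 : U ⊗ V) = 0 by rewrite addr0.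
apply: (addrI (tlift (fun u v => tens u (tens v w)) 0)).
by rewrite -tliftD ?addr0 //; exact: balanced_tens_tens.
Qed.

HB.instance Definition _ := GRing.isLinear.Build K ((U ⊗ V) ⊗ W) (U ⊗ (V ⊗ W))
  *:%R (@tassoc K U V W) tassoc_linear.

Lemma tassoc_tens u v w :
  tassoc (tens (tens u v) w) = tens u (tens v w) :> U ⊗ (V ⊗ W).
Proof.
rewrite /tassoc tlift_tens; last exact: balanced_tassoc.
by rewrite tlift_tens //; exact: balanced_tens_tens.
Qed.

End Associativity.

Section TensorAlgebra.
Variable A : algType K.

Lemma balanced_tmul_inner (a b : A) :
  balanced (fun c d : A => tens (a * c) (b * d)).
Proof.
split=> [v x y|u x y|k u v] /=; first by rewrite mulrDr tensDl.
  by rewrite mulrDr tensDr.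
by rewrite -!scalerAr tensZl tensZr.
Qed.

Lemma balanced_tmul (y : A ⊗ A) :
  balanced (fun a b : A => tlift (fun c d : A => tens (a * c) (b * d)) y).
Proof.
have bi := balanced_tmul_inner.
have l0 a b : tlift (fun c d : A => tens (a * c) (b * d)) 0 = 0.
  by apply: (addrI (tlift (fun c d : A => tens (a * c) (b * d)) 0));
     rewrite -tliftD ?addr0.
split=> [b a a'|a b b'|k a b] /=; elim/tensor_ind: y => [|c d y IHy];
  rewrite ?l0 ?addr0 // !tliftD // !tlift_tens // IHy.
- by rewrite mulrDl tensDl addrACA.
- by rewrite mulrDl tensDr addrACA.
- by rewrite -!scalerAl tensZl tensZr.
Qed.

Lemma tmul_tens (a b c d : A) :
  tmul (tens a b) (tens c d) = tens (a * c) (b * d).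
Proof.
rewrite /tmul tlift_tens; last exact: balanced_tmul.
by rewrite tlift_tens //; exact: balanced_tmul_inner.
Qed.

Lemma tmulDl (y : A ⊗ A) : {morph (fun x => tmul x y) : x x' / x + x'}.
Proof. by move=> x x'; exact: (tliftD (balanced_tmul y)). Qed.

Lemma tmulDr (x : A ⊗ A) : {morph tmul x : y y' / y + y'}.
Proof.
move=> y y'; rewrite /tmul /tlift /formal_eval -big_split; apply: eq_bigr => p _.
exact: (tliftD (balanced_tmul_inner _ _)).
Qed.

Lemma tmul_sum I J (r : seq I) (s : seq J) (F : I -> A ⊗ A) (G : J -> A ⊗ A) :
  tmul (\sum_(i <- r) F i) (\sum_(j <- s) G j) =
  \sum_(i <- r) \sum_(j <- s) tmul (F i) (G j).
Proof.
rewrite (big_morph _ (tmulDl _) (id1 := 0)); last first.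
  by apply: (addrI (tmul 0 (\sum_(j <- s) G j))); rewrite -tmulDl !addr0.
apply: eq_bigr => i _; apply: (big_morph _ (tmulDr _)).
by apply: (addrI (tmul (F i) 0)); rewrite -tmulDr !addr0.
Qed.

End TensorAlgebra.

End TensorCalculus.

Lemma mxBE (V : zmodType) m n (A B : 'M[V]_(m, n)) i j :
  (A - B) i j = A i j - B i j.
Proof. by rewrite !mxE. Qed.

(** * Matrices over the Hopf algebra and corepresentation matrices *)

Section Coreps.
Variables (R : realType) (H : hopfStarAlgebra R).
Local Notation C := (R[i]).
Local Notation functional := {linear H -> C^o}.
Implicit Types (chi psi : functional) (a b : H).

Definition sc m n (A : 'M[C]_(m, n)) : 'M[H]_(m, n) := map_mx (in_alg H) A.

Lemma scM m n p (A : 'M[C]_(m, n)) (B : 'M[C]_(n, p)) :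
  sc (A *m B) = sc A *m sc B.
Proof. exact: map_mxM. Qed.

Lemma sc1 n : sc (1%:M : 'M[C]_n) = 1%:M.
Proof. exact: map_mx1. Qed.

Lemma sc0 m n : sc (0 : 'M[C]_(m, n)) = 0.
Proof. exact: map_mx0. Qed.

Lemma scD m n (A B : 'M[C]_(m, n)) : sc (A + B) = sc A + sc B.
Proof. exact: map_mxD. Qed.

Lemma scB m n (A B : 'M[C]_(m, n)) : sc (A - B) = sc A - sc B.
Proof. exact: map_mxB. Qed.

Lemma scN m n (A : 'M[C]_(m, n)) : sc (- A) = - sc A.
Proof. exact: map_mxN. Qed.

Lemma sc_mulE m n p (A : 'M[C]_(m, n)) (u : 'M[H]_(n, p)) i j :
  (sc A *m u) i j = \sum_k A i k *: u k j.
Proof. by rewrite mxE; apply: eq_bigr => k _; rewrite mxE mulr_algl. Qed.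

Lemma mul_scE m n p (u : 'M[H]_(m, n)) (B : 'M[C]_(n, p)) i j :
  (u *m sc B) i j = \sum_k B k j *: u i k.
Proof. by rewrite mxE; apply: eq_bigr => k _; rewrite mxE mulr_algr. Qed.

Definition fmx chi m n (u : 'M[H]_(m, n)) : 'M[C]_(m, n) :=
  \matrix_(i, j) (chi (u i j) : C).

Lemma fmx_scl chi m n p (A : 'M[C]_(m, n)) (u : 'M[H]_(n, p)) :
  fmx chi (sc A *m u) = A *m fmx chi u.
Proof.
apply/matrixP => i j; rewrite mxE sc_mulE linear_sum mxE.
by apply: eq_bigr => k _; rewrite linearZ_LR mxE.
Qed.

Lemma fmx_scr chi m n p (u : 'M[H]_(m, n)) (B : 'M[C]_(n, p)) :
  fmx chi (u *m sc B) = fmx chi u *m B.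
Proof.
apply/matrixP => i j; rewrite mxE mul_scE linear_sum mxE.
by apply: eq_bigr => k _; rewrite linearZ_LR mxE [RHS]mulrC.
Qed.

Lemma fmx0 chi m n : fmx chi (0 : 'M[H]_(m, n)) = 0.
Proof. by apply/matrixP => i j; rewrite !mxE linear0. Qed.

Lemma fmxB chi m n (u v : 'M[H]_(m, n)) : fmx chi (u - v) = fmx chi u - fmx chi v.
Proof. by apply/matrixP => i j; rewrite !mxE raddfB. Qed.

Lemma fmx_eq0 m n (u : 'M[H]_(m, n)) : (forall chi, fmx chi u = 0) -> u = 0.
Proof.
move=> u0; apply/matrixP => i j; rewrite [RHS]mxE; apply: functional_eq0 => chi.
by have /matrixP/(_ i j) := u0 chi; rewrite !mxE.
Qed.

(** The two actions of functionals on [H] by convolution. *)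
Definition lconv chi (a : H) : H := slicel chi (comul H a).
Definition rconv chi (a : H) : H := slicer chi (comul H a).

Fact lconv_linear chi : linear (lconv chi).
Proof. by move=> k x y; rewrite /lconv !linearP. Qed.
Fact rconv_linear chi : linear (rconv chi).
Proof. by move=> k x y; rewrite /rconv !linearP. Qed.

HB.instance Definition _ chi :=
  GRing.isLinear.Build C H H *:%R (lconv chi) (lconv_linear chi).
HB.instance Definition _ chi :=
  GRing.isLinear.Build C H H *:%R (rconv chi) (rconv_linear chi).

(** Coassociativity with [chi] applied to the first factor. *)
Lemma comul_lconv chi a : comul H (lconv chi a) = tmap (lconv chi) idfun (comul H a).
Proof.
have := congr1 (slicel chi) (comulA a).
have -> x : slicel chi (tmap idfun (comul H) x) = comul H (slicel chi x).
  apply: (@tensor_ext _ _ _ _ (slicel chi \o tmap idfun (comul H)) (comul H \o slicel chi))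
    => [y z|y z|u v] /=; rewrite ?linearD //.
  by rewrite tmap_tens !slicel_tens linearZ.
rewrite -/(lconv chi a) => <-.
apply: (@tensor_ext _ _ _ _ (slicel chi \o @tassoc _ H H H \o tmap (comul H) idfun)
  (tmap (lconv chi) idfun)) => [y z|y z|u v] /=; rewrite ?linearD //.
rewrite !tmap_tens /= /lconv.
apply: (@tensor_ext _ _ _ _ (fun y => slicel chi (tassoc (tens y v)))
  (fun y => tens (slicel chi y) v)) => [y z|y z|u' v'] /=.
- by rewrite tensDl !linearD.
- by rewrite linearD tensDl.
- by rewrite tassoc_tens !slicel_tens tensZl.
Qed.

Lemma comul_rconv chi a : comul H (rconv chi a) = tmap idfun (rconv chi) (comul H a).
Proof.
have := congr1 (tmap idfun (slicer chi)) (comulA a).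
have -> x : tmap idfun (slicer chi) (tmap idfun (comul H) x) = tmap idfun (rconv chi) x.
  apply: (@tensor_ext _ _ _ _ (tmap idfun (slicer chi) \o tmap idfun (comul H))
    (tmap idfun (rconv chi))) => [y z|y z|u v] /=; rewrite ?linearD //.
  by rewrite !tmap_tens.
move=> <-.
apply: (@tensor_ext _ _ _ _ (comul H \o slicer chi)
  (tmap idfun (slicer chi) \o @tassoc _ H H H \o tmap (comul H) idfun))
  => [y z|y z|u v] /=; rewrite ?linearD //.
rewrite slicer_tens tmap_tens linearZ /=.
apply: (@tensor_ext _ _ _ _ (fun y => (chi v : C) *: y)
  (fun y => tmap idfun (slicer chi) (tassoc (tens y v)))) => [y z|y z|u' v'] /=.
- by rewrite scalerDr.
- by rewrite tensDl !linearD.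
- by rewrite tassoc_tens tmap_tens /= slicer_tens tensZr.
Qed.

Definition corep n (u : 'M[H]_n) : Prop :=
  (forall i j, comul H (u i j) = \sum_k tens (u i k) (u k j)) /\
  forall i j, counit H (u i j) = (i == j)%:R :> C.

Lemma comul_scr n p (u : 'M[H]_n) (B : 'M[C]_(n, p)) i j : corep u ->
  comul H ((u *m sc B) i j) = \sum_k tens (u i k) ((u *m sc B) k j).
Proof.
move=> [cu _]; rewrite mul_scE (linear_sum (comul H)).
under eq_bigr => k _ do rewrite linearZ_LR /= cu scaler_sumr.
rewrite exchange_big; apply: eq_bigr => l _; rewrite mul_scE tens_sumr.
by apply: eq_bigr => k _; rewrite tensZr.
Qed.

Lemma comul_scl m n (A : 'M[C]_(m, n)) (u : 'M[H]_n) i j : corep u ->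
  comul H ((sc A *m u) i j) = \sum_k tens ((sc A *m u) i k) (u k j).
Proof.
move=> [cu _]; rewrite sc_mulE (linear_sum (comul H)).
under eq_bigr => k _ do rewrite linearZ_LR /= cu scaler_sumr.
rewrite exchange_big; apply: eq_bigr => l _; rewrite sc_mulE tens_suml.
by apply: eq_bigr => k _; rewrite tensZl.
Qed.

Definition rconvmx chi m n (u : 'M[H]_(m, n)) := map_mx (rconv chi) u.

Lemma rconvmx_scl chi m n p (A : 'M[C]_(m, n)) (u : 'M[H]_(n, p)) :
  rconvmx chi (sc A *m u) = sc A *m rconvmx chi u.
Proof.
apply/matrixP => i j; rewrite mxE !sc_mulE linear_sum.
by apply: eq_bigr => k _; rewrite linearZ_LR mxE.
Qed.

Lemma rconvmx_scr chi m n p (u : 'M[H]_(m, n)) (B : 'M[C]_(n, p)) :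
  rconvmx chi (u *m sc B) = rconvmx chi u *m sc B.
Proof.
apply/matrixP => i j; rewrite mxE !mul_scE linear_sum.
by apply: eq_bigr => k _; rewrite linearZ_LR mxE.
Qed.

Lemma rconv_corep chi n (u : 'M[H]_n) :
  corep u -> rconvmx chi u = u *m sc (fmx chi u).
Proof.
move=> [cu _]; apply/matrixP => i j; rewrite mxE mul_scE /rconv cu (linear_sum (slicer chi)).
by apply: eq_bigr => k _ /=; rewrite slicer_tens mxE.
Qed.

Lemma fmx_counit n (u : 'M[H]_n) : corep u -> fmx (counit H) u = 1%:M.
Proof. by move=> [_ eu]; apply/matrixP => i j; rewrite !mxE [LHS]eu. Qed.

Definition antimx m n (u : 'M[H]_(m, n)) := map_mx (antipode H) u.

Lemma antimx_scl m n p (A : 'M[C]_(m, n)) (u : 'M[H]_(n, p)) :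
  antimx (sc A *m u) = sc A *m antimx u.
Proof.
apply/matrixP => i j; rewrite mxE !sc_mulE linear_sum.
by apply: eq_bigr => k _; rewrite linearZ_LR mxE.
Qed.

Lemma antimx_scr m n p (u : 'M[H]_(m, n)) (B : 'M[C]_(n, p)) :
  antimx (u *m sc B) = antimx u *m sc B.
Proof.
apply/matrixP => i j; rewrite mxE !mul_scE linear_sum.
by apply: eq_bigr => k _; rewrite linearZ_LR mxE.
Qed.

Lemma antimxB m n (u v : 'M[H]_(m, n)) : antimx (u - v) = antimx u - antimx v.
Proof. by apply/matrixP => i j; rewrite !mxE raddfB. Qed.

Lemma balanced_mul (f g : {linear H -> H}) : balanced (fun a b => f a * g b).
Proof.
split=> [v x y|u x y|k u v] /=; first by rewrite linearD mulrDl.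
  by rewrite linearD mulrDr.
by rewrite !linearZ_LR -scalerAl -scalerAr.
Qed.

Lemma antimx_mull n (u : 'M[H]_n) : corep u -> antimx u *m u = 1%:M.
Proof.
move=> [cu eu]; apply/matrixP => i j.
have := antipodel (u i j); rewrite eu cu tlift_sum; last exact: balanced_mul _ idfun.
rewrite !mxE => uE; transitivity ((i == j)%:R%:A : H); last by rewrite scaler_nat.
rewrite -uE; apply: eq_bigr => k _.
by rewrite tlift_tens ?mxE //; exact: balanced_mul _ idfun.
Qed.

Lemma antimx_mulr n (u : 'M[H]_n) : corep u -> u *m antimx u = 1%:M.
Proof.
move=> [cu eu]; apply/matrixP => i j.
have := antipoder (u i j); rewrite eu cu tlift_sum; last exact: balanced_mul idfun _.
rewrite !mxE => uE; transitivity ((i == j)%:R%:A : H); last by rewrite scaler_nat.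
rewrite -uE; apply: eq_bigr => k _.
by rewrite tlift_tens ?mxE //; exact: balanced_mul idfun _.
Qed.

Lemma star0 : star (0 : H) = 0.
Proof. by apply: (addrI (star (0 : H))); rewrite -starD !addr0. Qed.

Lemma starB (a b : H) : star (a - b) = star a - star b.
Proof. by rewrite starD -scaleN1r starZ rmorphN rmorph1 scaleN1r. Qed.

Lemma star1 : star (1 : H) = 1.
Proof.
by rewrite -[LHS]mulr1 -{2}(starK (1 : H)) -starM mulr1 starK.
Qed.

Lemma star_sum I (r : seq I) (P : pred I) (F : I -> H) :
  star (\sum_(i <- r | P i) F i) = \sum_(i <- r | P i) star (F i).
Proof. exact: (big_morph _ (@starD _ _) star0). Qed.

Definition hstar m n (u : 'M[H]_(m, n)) : 'M[H]_(n, m) :=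
  map_mx (@star _ H) u^T.

Lemma hstarM m n p (u : 'M[H]_(m, n)) (v : 'M[H]_(n, p)) :
  hstar (u *m v) = hstar v *m hstar u.
Proof.
apply/matrixP => i j; rewrite !mxE star_sum.
by apply: eq_bigr => k _; rewrite !mxE starM.
Qed.

Lemma hstarB m n (u v : 'M[H]_(m, n)) : hstar (u - v) = hstar u - hstar v.
Proof.
by apply/matrixP => i j; rewrite !mxE starB.
Qed.

Lemma hstar_sc m n (A : 'M[C]_(m, n)) : hstar (sc A) = sc (ctr A).
Proof. by apply/matrixP => i j; rewrite !mxE starZ star1. Qed.

(** The two identities say that [invmx Q] u^* Q is a left and a right inverse of [u]; both are
    recorded since the entries do not commute. *)
Definition unitary_for n (Q : 'M[C]_n) (u : 'M[H]_n) : Prop :=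
  [/\ posdef Q, hstar u *m sc Q *m u = sc Q
    & u *m sc (invmx Q) *m hstar u = sc (invmx Q)].

Lemma unitary_forP n (Q : 'M[C]_n) (u : 'M[H]_n) : corep u -> posdef Q ->
  unitary_for Q u <-> hstar u *m sc Q = sc Q *m antimx u.
Proof.
move=> cu Qp; split=> [[_ uQ _]|uQ].
  by rewrite -{2}uQ -!mulmxA antimx_mulr // mulmx1.
have Qu := posdef_unit Qp.
split=> //; first by rewrite uQ -mulmxA antimx_mull // mulmx1.
have -> : hstar u = sc Q *m antimx u *m sc (invmx Q).
  by rewrite -uQ -mulmxA -scM mulmxV // sc1 mulmx1.
rewrite !mulmxA -[_ *m sc (invmx Q) *m sc Q]mulmxA -scM mulVmx // sc1 mulmx1.
by rewrite antimx_mulr // mul1mx.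
Qed.

End Coreps.

(** * Invariant projections and intertwiners *)

Section StableSubspaces.
Variables (R : realType) (H : hopfStarAlgebra R).
Local Notation C := (R[i]).
Local Notation functional := {linear H -> C^o}.
Implicit Types (chi psi : functional) (a b : H).

(** The functional is the convolution of [psi] and [chi]. Hence the matrices [fmx chi u] are closed
    under products. *)
Lemma fmxM psi chi n (u : 'M[H]_n) : corep u ->
  exists phi : functional, fmx phi u = fmx psi u *m fmx chi u.
Proof.
move=> cu; exists (psi \o rconv chi : {linear _ -> _}).
transitivity (fmx psi (rconvmx chi u)); first by apply/matrixP => i j; rewrite !mxE.
by rewrite rconv_corep // fmx_scr.
Qed.

(** The entrywise antipode turns the hypothesis into (1 - P) S(z) P = 0, and the adjoint turns it
    into P S(z) (1 - P) = 0, because z^* Q = Q S(z). So P commutes with S(z), which is the inverse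
    of z. *)
Lemma projection_commutes n (Q P : 'M[C]_n) (z : 'M[H]_n) :
  corep z -> unitary_for Q z -> Q *m P = ctr P *m Q ->
  sc H (1%:M - P) *m z *m sc H P = 0 -> z *m sc H P = sc H P *m z.
Proof.
move=> cz uz PQ zP; have [Qp zQz _] := uz.
have SzP : sc H (1%:M - P) *m antimx z *m sc H P = 0.
  by rewrite -antimx_scl -antimx_scr zP; apply/matrixP => i j; rewrite !mxE linear0.
have P1Q : ctr (1%:M - P) *m Q = Q *m (1%:M - P).
  by rewrite mulmxBr mulmx1 PQ /ctr linearB /= trmx1 map_mxB map_mx1 mulmxBl mul1mx.
have PSz : sc H P *m antimx z *m sc H (1%:M - P) = 0.
  rewrite -[LHS]mul1mx -(sc1 H n) -{1}(mulVmx (posdef_unit Qp)) scM -mulmxA.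
  suff -> : sc H Q *m (sc H P *m antimx z *m sc H (1%:M - P)) = 0 by rewrite mulmx0.
  rewrite !mulmxA -scM PQ scM -[sc H (ctr P) *m _ *m _]mulmxA.
  have /unitary_forP <- // := uz.
  rewrite -!mulmxA -scM -P1Q scM !mulmxA.
  have := congr1 (@hstar R H n n) zP; rewrite !hstarM !hstar_sc mulmxA => ->.
  have -> : hstar (0 : 'M[H]_n) = 0 by apply/matrixP => i j; rewrite !mxE star0.
  by rewrite mul0mx.
have Sz1 : antimx z *m sc H P = sc H P *m antimx z.
  transitivity (sc H P *m antimx z *m sc H P).
    by apply/eqP; rewrite -subr_eq0 -{1}[antimx z]mul1mx -(sc1 H n) -!mulmxBl -scB SzP.
  by apply/eqP; rewrite eq_sym -subr_eq0 -{1}[_ *m antimx z]mulmx1 -(sc1 H n) -mulmxBr -scB PSz.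
rewrite -[LHS]mulmx1 -(antimx_mull cz) -mulmxA [sc H P *m (_ *m z)]mulmxA -Sz1.
by rewrite !mulmxA antimx_mulr // mul1mx.
Qed.

(** The vectors of [S] span a subcomodule, and orthogonality for [Q] makes the projection onto it an
    intertwiner. The last clause carries relations over [H] from [S] to the projection. *)
Lemma stable_projection n (Q : 'M[C]_n) (z : 'M[H]_n) (S : 'cV[C]_n -> Prop) :
  corep z -> unitary_for Q z ->
  (forall chi s, S s -> S (fmx chi z *m s)) ->
  exists P : 'M[C]_n, [/\ [/\ P *m P = P, Q *m P = ctr P *m Q &
      z *m sc H P = sc H P *m z],
    forall s, S s -> P *m s = s
  & forall r (U : 'M[H]_(r, n)), (forall s, S s -> U *m sc H s = 0) ->
      U *m sc H P = 0].
Proof.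
move=> cz uz Sz; have [Qp zQz _] := uz.
have [r [B [Binj BS SB]]] := column_basis S.
pose P := oproj Q B; have PP : P *m P = P := oproj_idem Qp Binj.
have PQ : Q *m P = ctr P *m Q := oproj_adj B Qp.
have PS s : S s -> P *m s = s.
  by move=> /SB[c ->]; rewrite mulmxA oproj_id.
have UP m (U : 'M[H]_(m, n)) : (forall s, S s -> U *m sc H s = 0) -> U *m sc H P = 0.
  move=> US; rewrite scM mulmxA.
  suff -> : U *m sc H B = 0 by rewrite mul0mx.
  apply/matrixP => i j; have /matrixP/(_ i 0) := US _ (BS j).
  rewrite mul_scE [RHS]mxE => US0; rewrite mul_scE [RHS]mxE -[RHS]US0.
  by apply: eq_bigr => k _; rewrite [col j B k 0]mxE.
exists P; split=> //; split=> //.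
have zP : sc H (1%:M - P) *m z *m sc H P = 0.
  apply: UP => s Ss; apply: fmx_eq0 => chi; rewrite fmx_scr fmx_scl -mulmxA.
  by rewrite mulmxBl mul1mx PS ?subrr //; exact: Sz.
exact: (projection_commutes cz uz PQ zP).
Qed.

(** On the subcomodule of z generated by the columns of [T] the matrix [Psi] intertwines already;
    composing it with the projection onto this subcomodule gives an intertwiner on the whole
    space. *)
Lemma intertwiner_of_matrix_coefs m n k (Q : 'M[C]_n) (y : 'M[H]_m)
    (z : 'M[H]_n) (X : 'M[C]_(m, k)) (T : 'M[C]_(n, k)) (Psi : 'M[C]_(m, n)) :
  corep y -> corep z -> unitary_for Q z ->
  y *m sc H X = sc H Psi *m z *m sc H T ->
  exists A : 'M[C]_(m, n), y *m sc H A = sc H A *m z /\ A *m T = X.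
Proof.
move=> cy cz uz yz.
pose S (s : 'cV[C]_n) := exists chi w, s = fmx chi z *m T *m w.
have [|P [[_ _ zP] PS UP]] := @stable_projection n Q z S cz uz.
  move=> psi s [chi [w ->]]; have [phi phiE] := fmxM psi chi cz.
  by exists phi, w; rewrite phiE !mulmxA.
exists (Psi *m P); split.
  rewrite [in RHS]scM -[RHS]mulmxA -zP [RHS]mulmxA; apply/eqP.
  rewrite -subr_eq0 scM mulmxA -mulmxBl; apply/eqP/UP => s [chi [w ->]].
  rewrite mulmxBl; apply/eqP; rewrite subr_eq0; apply/eqP.
  rewrite -(mulmxA y) -scM.
  have yX := congr1 (@fmx R H chi m k) yz.
  rewrite fmx_scr -(mulmxA (sc H Psi)) fmx_scl fmx_scr in yX.
  (* Convolution with [chi] gives y chi(y) X = Psi z chi(z) T, while evaluation gave chi(y) X = Psi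
     chi(z) T. *)
  have := congr1 (@rconvmx R H chi m k) yz.
  rewrite rconvmx_scr -(mulmxA (sc H Psi)) rconvmx_scl rconvmx_scr !rconv_corep //.
  rewrite -mulmxA -scM yX => /(congr1 (mulmxr (sc H w))) /=.
  by rewrite -!mulmxA -!scM !mulmxA.
have PT : P *m T = T.
  apply/matrixP => i j.
  have /PS/matrixP/(_ i 0) : S (T *m delta_mx j 0).
    by exists (counit H), (delta_mx j 0); rewrite fmx_counit // mul1mx.
  by rewrite mulmxA -!colE ![col _ _ _ _]mxE.
rewrite -mulmxA PT; have := congr1 (@fmx R H (counit H) m k) yz.
by rewrite !(fmx_scr, fmx_scl) !fmx_counit // mulmx1 mul1mx.
Qed.

End StableSubspaces.

(** * Local finiteness: elements as matrix coefficients *)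

Section MatrixCoefficients.
Variables (R : realType) (H : hopfStarAlgebra R).
Local Notation C := (R[i]).
Local Notation functional := {linear H -> C^o}.
Implicit Types (chi psi : functional) (a b : H).

Definition combine r (c : 'cV[C]_r) (psi : 'I_r -> functional) (a : H) : C^o :=
  \sum_i c i 0 *: psi i a.

Fact combine_linear r (c : 'cV[C]_r) (psi : 'I_r -> functional) :
  linear (combine c psi).
Proof.
move=> k x y; rewrite /combine scaler_sumr -big_split; apply: eq_bigr => i _ /=.
by rewrite linearP scalerDr !scalerA mulrC.
Qed.

HB.instance Definition _ r (c : 'cV[C]_r) (psi : 'I_r -> functional) :=
  GRing.isLinear.Build C H C^o *:%R (combine c psi) (combine_linear c psi).

Definition independent r (B : 'cV[H]_r) : Prop :=
  forall L : 'rV[C]_r, sc H L *m B = 0 -> L = 0.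

(** The vectors [fmx psi B] span the whole space: a row annihilating all of them gives a combination
    of the entries of [B] that every functional kills, hence a linear relation. *)
Lemma dual_functional r (B : 'cV[H]_r) (w : 'cV[C]_r) :
  independent B -> exists psi, fmx psi B = w.
Proof.
move=> Bi; have [k [D [_ DS SD]]] := column_basis (fun s => exists psi, fmx psi B = s).
have [psi psiD] := choice DS.
have DT : injmx D^T.
  move=> x Dx; apply: trmx_inj; rewrite trmx0; apply: Bi; apply: fmx_eq0 => chi.
  rewrite fmx_scl; have [c ->] := SD _ (ex_intro _ chi erefl).
  by rewrite mulmxA -[D]trmxK -trmx_mul Dx trmx0 mul0mx.
have /injmxP[D' D'D] := DT.
have wE : w = D *m (D'^T *m w).
  by rewrite mulmxA -[D]trmxK -trmx_mul D'D trmx1 mul1mx.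
exists (combine (D'^T *m w) psi : {linear _ -> _}).
apply/matrixP => i j; rewrite ord1 mxE [in RHS]wE [RHS]mxE /= /combine.
apply: eq_bigr => l _; have /matrixP/(_ i 0) := psiD l; rewrite !mxE => <-.
by rewrite [RHS]mulrC.
Qed.

Lemma comul_counitl chi a : chi (slicel (counit H) (comul H a)) = chi a.
Proof. by congr (chi _); exact: counitl. Qed.

Lemma slice_swap chi psi (x : H ⊗ H) : chi (slicer psi x) = psi (slicel chi x).
Proof.
apply: (@tensor_ext _ _ _ _ (chi \o slicer psi) (psi \o slicel chi))
  => [y z|y z|u v] /=; rewrite ?linearD //.
by rewrite slicel_tens slicer_tens !linearZ_LR [LHS]mulrC.
Qed.

Lemma dependentP r (B : 'cV[H]_r.+1) : ~ independent B ->
  exists k (c : 'I_r -> C), B k 0 = \sum_i c i *: B (lift k i) 0.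
Proof.
move=> /existsNP[L /not_implyP[LB L0]].
have [k Lk] : exists k, L 0 k != 0.
  apply: contra_notP L0 => /forallNP L0; apply/matrixP => i j; rewrite ord1 mxE.
  by apply/eqP; apply: contraT => /L0.
exists k, (fun i => - ((L 0 k)^-1 * L 0 (lift k i))).
have /matrixP/(_ 0 0) := LB; rewrite sc_mulE mxE (bigD1_ord k) //= => /eqP.
rewrite addr_eq0 => /eqP/(congr1 (GRing.scale (L 0 k)^-1)).
rewrite scalerA mulVf // scale1r => ->; rewrite scalerN scaler_sumr -sumrN.
by apply: eq_bigr => i _; rewrite scaleNr scalerA.
Qed.

(** A shortest expression as a sum of elementary tensors is independent on both sides, since a
    relation on either side would shorten it. *)
Lemma comul_independent a : exists r (A B : 'cV[H]_r),
  [/\ independent A, independent B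
    & comul H a = \sum_i tens (A i 0) (B i 0)].
Proof.
pose p r := `[< exists A B : 'cV[H]_r, comul H a = \sum_i tens (A i 0) (B i 0) >].
have p0 : exists r, p r.
  elim/tensor_ind: (comul H a) @p => [|u v x [r /asboolP[A [B ->]]]].
    by exists 0; apply/asboolP; exists 0, 0; rewrite big_ord0.
  exists (1 + r)%N; apply/asboolP; exists (col_mx u%:M A), (col_mx v%:M B).
  rewrite big_split_ord /= big_ord1 !col_mxEu !mxE eqxx !mulr1n; congr (_ + _).
  by apply: eq_bigr => i _; rewrite !col_mxEd.
case: (ex_minnP p0) => r /asboolP[A [B aE]] rmin.
exists r, A, B; split=> //.
- case: r A B aE rmin => [A B _ _|r A B aE rmin].
    by move=> L _; apply/matrixP => i [].
  apply: contrapT => /dependentP[k [c kE]].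
  suff /rmin : p r by rewrite ltnn.
  apply/asboolP; exists (\col_i A (lift k i) 0), (\col_i (B (lift k i) 0 + c i *: B k 0)).
  rewrite aE (bigD1_ord k) //= kE tens_suml -big_split; apply: eq_bigr => i _ /=.
  by rewrite !mxE tensDr addrC tensZl tensZr.
- case: r A B aE rmin => [A B _ _|r A B aE rmin].
    by move=> L _; apply/matrixP => i [].
  apply: contrapT => /dependentP[k [c kE]].
  suff /rmin : p r by rewrite ltnn.
  apply/asboolP; exists (\col_i (A (lift k i) 0 + c i *: A k 0)), (\col_i B (lift k i) 0).
  rewrite aE (bigD1_ord k) //= kE tens_sumr -big_split; apply: eq_bigr => i _ /=.
  by rewrite !mxE tensDl addrC tensZl tensZr.
Qed.

(** Functionals dual to the [A i 0] produce the [B j 0] from [a]; these therefore span a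
    finite-dimensional comodule inside [H], whose matrix is [u]. *)
Lemma matrix_coefficient a : exists n (u : 'M[H]_n) (l : 'rV[C]_n) (c : 'cV[C]_n),
  corep u /\ a = (sc H l *m u *m sc H c) 0 0.
Proof.
have [r [A [B [Ai Bi aE]]]] := comul_independent a.
have [chi chiE] := choice (fun j : 'I_r => dual_functional (delta_mx j 0) Ai).
have [psi psiE] := choice (fun j : 'I_r => dual_functional (delta_mx j 0) Bi).
have chiA j i : chi j (A i 0) = (i == j)%:R.
  by have /matrixP/(_ i 0) := chiE j; rewrite !mxE eqxx andbT.
have psiB j i : psi j (B i 0) = (i == j)%:R.
  by have /matrixP/(_ i 0) := psiE j; rewrite !mxE eqxx andbT.
have lconvE j : lconv (chi j) a = B j 0.
  rewrite /lconv aE (linear_sum (slicel (chi j))) (bigD1 j) //= slicel_tens chiA eqxx.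
  rewrite scale1r big1 ?addr0 // => i /negPf ij.
  by rewrite slicel_tens chiA ij scale0r.
pose u : 'M[H]_r := \matrix_(j, i) lconv (chi j) (A i 0).
have comulB j : comul H (B j 0) = \sum_i tens (u j i) (B i 0).
  rewrite -lconvE comul_lconv aE linear_sum; apply: eq_bigr => i _ /=.
  by rewrite tmap_tens mxE.
(* This second description of [u], through functionals dual to [B], gives its comultiplication from
   that of the [B j 0]. *)
have rconvB j i : rconv (psi i) (B j 0) = u j i.
  rewrite /rconv comulB (linear_sum (slicer (psi i))) (bigD1 i) //= slicer_tens psiB eqxx.
  rewrite scale1r big1 ?addr0 // => k /negPf ki.
  by rewrite slicer_tens psiB ki scale0r.
have cu : corep u.
  split=> j i; rewrite -rconvB; last first.
    by rewrite /rconv [LHS]slice_swap comul_counitl psiB.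
  rewrite comul_rconv comulB linear_sum; apply: eq_bigr => k _ /=.
  by rewrite tmap_tens /= rconvB.
exists r, u, (\row_i (counit H (A i 0) : C)), (\col_i (counit H (B i 0) : C)); split=> //.
rewrite -mulmxA sc_mulE -[LHS]counitl aE tlift_sum; last exact: balanced_slicel.
apply: eq_bigr => i _; rewrite tlift_tens; last exact: balanced_slicel.
rewrite mul_scE mxE; congr (_ *: _).
rewrite -[LHS]counitr comulB tlift_sum; last exact: balanced_slicer.
by apply: eq_bigr => k _; rewrite tlift_tens ?mxE //; exact: balanced_slicer.
Qed.

End MatrixCoefficients.

(** * Comodules and invariant forms in a basis *)

Section CoactionMatrix.
Variables (R : realType) (H : hopfStarAlgebra R).
Local Notation C := (R[i]).
Variables (X : vectType C) (n : nat) (e : n.-tuple X) (eb : basis_of fullv e).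

Lemma basis_expand x : x = \sum_(i < n) vcoord e i x *: tnth e i.
Proof.
rewrite [LHS](coord_basis eb (memvf x)).
by apply: eq_bigr => i _; rewrite (tnth_nth 0).
Qed.

Lemma coord_tnth i j : vcoord e i (tnth e j) = (j == i)%:R.
Proof. by rewrite (tnth_nth 0) coord_free // (basis_free eb). Qed.

Lemma basis_tensor (Y : lmodType C) (T : X ⊗ Y) :
  T = \sum_(i < n) tens (tnth e i) (slicel (vcoord e i : {linear X -> C^o}) T).
Proof.
elim/tensor_ind: T => [|x y T IHT].
  by rewrite big1 // => i _; rewrite linear0 tens0r.
rewrite {1}IHT {1}[x]basis_expand tens_suml -big_split; apply: eq_bigr => i _ /=.
by rewrite linearD /= slicel_tens tensDr tensZl tensZr.
Qed.

Lemma slicel_basis (Y : lmodType C) (y : 'I_n -> Y) i :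
  slicel (vcoord e i : {linear X -> C^o}) (\sum_j tens (tnth e j) (y j)) = y i.
Proof.
rewrite (linear_sum (slicel _)) (bigD1 i) //= slicel_tens /= coord_tnth eqxx scale1r big1 ?addr0 //.
by move=> j /negPf ji; rewrite /= slicel_tens /= coord_tnth ji scale0r.
Qed.

Definition coaction_mx (rho : X -> X ⊗ H) : 'M[H]_n :=
  \matrix_(i, j) slicel (vcoord e i : {linear X -> C^o}) (rho (tnth e j)).

Lemma coaction_mxE (rho : X -> X ⊗ H) j :
  rho (tnth e j) = \sum_i tens (tnth e i) (coaction_mx rho i j).
Proof. by rewrite [LHS]basis_tensor; apply: eq_bigr => i _; rewrite mxE. Qed.

Lemma linear_basis_ext (Y : lmodType C) (f g : X -> Y) : linear f -> linear g ->
  (forall j, f (tnth e j) = g (tnth e j)) -> f =1 g.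
Proof.
move=> fl gl fg x.
pose fL : {linear X -> Y} := HB.pack f (GRing.isLinear.Build _ _ _ _ f fl).
pose gL : {linear X -> Y} := HB.pack g (GRing.isLinear.Build _ _ _ _ g gl).
rewrite -[f]/(fL : X -> Y) -[g]/(gL : X -> Y) [x]basis_expand !linear_sum.
by apply: eq_bigr => j _; rewrite !linearZ /=; congr (_ *: _); exact: fg.
Qed.

Lemma comodule_corep (rho : X -> X ⊗ H) : linear rho ->
  is_comodule rho <-> corep (coaction_mx rho).
Proof.
move=> rl.
pose rL : {linear X -> X ⊗ H} := HB.pack rho (GRing.isLinear.Build _ _ _ _ rho rl).
have rE : rho = rL by [].
set u := coaction_mx rho.
have Ej j : tassoc (tmap rho idfun (rho (tnth e j))) =
    \sum_i tens (tnth e i) (\sum_k tens (u i k) (u k j)).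
  rewrite [rho (tnth e j)]coaction_mxE {1}rE (linear_sum (tmap rL idfun)).
  rewrite (linear_sum (@tassoc _ X H H)).
  transitivity (\sum_k \sum_i tens (tnth e i) (tens (u i k) (u k j))).
    apply: eq_bigr => k _; rewrite /= (tmap_tens rL idfun) /= -?rE coaction_mxE tens_suml.
    rewrite (linear_sum (@tassoc _ X H H)).
    by apply: eq_bigr => i _; rewrite /= tassoc_tens.
  by rewrite exchange_big /=; apply: eq_bigr => i _; rewrite tens_sumr.
have Fj j : tmap idfun (comul H) (rho (tnth e j)) = \sum_i tens (tnth e i) (comul H (u i j)).
  rewrite [rho _]coaction_mxE linear_sum; apply: eq_bigr => i _ /=.
  by rewrite tmap_tens.
have Gj j : slicer (counit H) (rho (tnth e j)) = \sum_i (counit H (u i j) : C) *: tnth e i.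
  rewrite [rho _]coaction_mxE linear_sum; apply: eq_bigr => i _ /=.
  by rewrite slicer_tens.
split=> [[_ rA r1]|[uA u1]].
- split=> i j.
    have := rA (tnth e j); rewrite Ej Fj => /(congr1 (slicel (vcoord e i : {linear X -> C^o}))).
    by rewrite !slicel_basis.
  have := Gj j; rewrite [slicer _ _]r1 => /(congr1 (vcoord e i)).
  rewrite coord_tnth linear_sum (bigD1 i) //= linearZ_LR /= coord_tnth eqxx big1.
    by rewrite addr0 mulr1 => <-; rewrite eq_sym.
  by move=> k /negPf ki; rewrite linearZ_LR /= coord_tnth ki mulr0.
- split=> //.
    apply: linear_basis_ext => [k x y|k x y|j].
    + by rewrite rE linearP; exact: (linearP (@tassoc _ X H H \o tmap rL idfun)).
    + by rewrite rl linearP.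
    + by rewrite Ej Fj; apply: eq_bigr => i _; rewrite uA.
  apply: linear_basis_ext => [k x y|//|j].
    by rewrite rl; exact: (linearP (slicer (counit H))).
  rewrite [LHS]Gj (bigD1 j) //= u1 eqxx scale1r big1 ?addr0 // => i /negPf ij.
  by rewrite u1 ij scale0r.
Qed.

End CoactionMatrix.

Section Unitarizability.
Variables (R : realType) (H : hopfStarAlgebra R).
Local Notation C := (R[i]).

Section InBasis.
Variables (X : vectType C) (n : nat) (e : n.-tuple X) (eb : basis_of fullv e).

Definition coord_col (x : X) : 'cV[C]_n := \col_i vcoord e i x.

Fact coord_col_linear : linear coord_col.
Proof. by move=> k x y; apply/matrixP => i j; rewrite !mxE linearP. Qed.
HB.instance Definition _ :=
  GRing.isLinear.Build C X 'cV[C]_n *:%R coord_col coord_col_linear.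

Definition vec_of_col (c : 'cV[C]_n) : X := \sum_i c i 0 *: tnth e i.

Lemma coord_colK : cancel coord_col vec_of_col.
Proof.
move=> x; rewrite [RHS](basis_expand eb).
by apply: eq_bigr => i _; rewrite mxE.
Qed.

Lemma vec_of_colK : cancel vec_of_col coord_col.
Proof.
move=> c; apply/matrixP => i j; rewrite ord1 mxE linear_sum (bigD1 i) //=.
rewrite linearZ_LR /= (coord_tnth eb) eqxx mulr1 big1 ?addr0 // => k /negPf ki.
by rewrite linearZ_LR /= (coord_tnth eb) ki mulr0.
Qed.

Lemma coord_col_tnth j : coord_col (tnth e j) = delta_mx j 0.
Proof.
by apply/matrixP => i k; rewrite !mxE (coord_tnth eb) ord1 eqxx andbT eq_sym.
Qed.

Section Linear.
Variables (rho : X -> X ⊗ H) (rl : linear rho).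
Let u := coaction_mx e rho.

Lemma coaction_mx_vec x :
  rho x = \sum_i tens (tnth e i) ((u *m sc H (coord_col x)) i 0).
Proof.
pose rL : {linear X -> X ⊗ H} := HB.pack rho (GRing.isLinear.Build _ _ _ _ rho rl).
rewrite {1}[x](basis_expand eb) -[rho]/(rL : X -> X ⊗ H) linear_sum.
transitivity (\sum_j \sum_i tens (tnth e i) (coord_col x j 0 *: u i j)).
  apply: eq_bigr => j _; rewrite linearZ /= (coaction_mxE eb) scaler_sumr.
  by apply: eq_bigr => i _; rewrite [coord_col x j 0]mxE tensZr.
rewrite exchange_big /=; apply: eq_bigr => i _.
by rewrite mul_scE tens_sumr.
Qed.

Lemma unitarizable_mx : unitarizable rho <->
  exists2 Q : 'M[C]_n, posdef Q & hstar u *m sc H Q = sc H Q *m antimx u.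
Proof.
have bl (f : {dot X for Num.conj}) w :
    balanced (fun v0 (v1 : H) => (f w v0 : C) *: star v1).
  split=> [v x y|x v v'|k x v] /=; first by rewrite linearDr scalerDl.
    by rewrite starD scalerDr.
  by rewrite linearZr_LR /= starZ scalerA mulrC.
have br (f : {dot X for Num.conj}) v :
    balanced (fun w0 (w1 : H) => (f w0 v : C) *: antipode H w1).
  split=> [w x y|x w w'|k x w] /=; first by rewrite linearDl scalerDl.
    by rewrite linearD scalerDr.
  by rewrite linearZl_LR /= linearZ_LR scalerA mulrC.
split=> [[f fP]|[Q Qp uQ]].
(* The Gram matrix is transposed: [f] is linear in its first argument, whereas [ctr x *m Q *m x] is
   linear in the right one. *)
- exists (\matrix_(j, k) (f (tnth e k) (tnth e j) : C)).
    split=> [|x x0].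
      by apply/matrixP => i j; rewrite !mxE [in RHS](hermC f) expr0 mul1r.
    have -> : (ctr x *m (\matrix_(j, k) (f (tnth e k) (tnth e j) : C)) *m x) 0 0
        = f (vec_of_col x) (vec_of_col x).
      rewrite mxE /vec_of_col linear_sumlz; apply: eq_bigr => k _.
      rewrite linearZl_LR linear_sumr mxE /= mulrC; congr (_ * _).
      by apply: eq_bigr => j _; rewrite linearZr_LR !mxE.
    rewrite dnorm_gt0; apply: contraNneq x0 => x0.
    by rewrite -[x]vec_of_colK x0 linear0.
  apply/matrixP => j l; rewrite mul_scE sc_mulE.
  have := fP (tnth e j) (tnth e l); rewrite !(coaction_mxE eb) !tlift_sum //.
  move=> E; etransitivity; last (etransitivity; first exact: E).
    by apply: eq_bigr => i _; rewrite tlift_tens // !mxE.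
  by apply: eq_bigr => i _; rewrite tlift_tens // !mxE.
pose f (v w : X) : C := (ctr (coord_col w) *m Q *m coord_col v) 0 0.
have ctrD m p (A B : 'M[C]_(m, p)) : ctr (A + B) = ctr A + ctr B.
  by rewrite /ctr linearD /= map_mxD.
have ctrN m p (A : 'M[C]_(m, p)) : ctr (- A) = - ctr A.
  by rewrite /ctr linearN /= map_mxN.
have f1 u' : zmod_morphism (f^~ u') by move=> x y; rewrite /f linearB mulmxBr !mxE.
have f2 u' : zmod_morphism (f u').
  by move=> x y; rewrite /f linearB ctrD ctrN !mulmxBl !mxE.
have f3 u' : scalable_for *%R (f^~ u').
  by move=> k x; rewrite /f linearZ_LR -scalemxAr mxE.
have f4 u' : scalable_for (Num.conj \; *%R) (f u').
  by move=> k x; rewrite /f linearZ_LR /ctr linearZ_LR map_mxZ -!scalemxAl mxE.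
have f5 x y : f x y = (-1) ^+ false * Num.conj (f y x).
  case: Qp => Qh _; rewrite expr0 mul1r /f.
  transitivity (ctr (ctr (coord_col x) *m Q *m coord_col y) 0 0); last by rewrite !mxE.
  by rewrite !ctrM ctrK Qh mulmxA.
have f6 x : x != 0 -> 0 < f x x.
  move=> x0; apply: (proj2 Qp); apply: contraNneq x0 => x0.
  by rewrite -[x]coord_colK x0 /vec_of_col big1 // => i _; rewrite mxE scale0r.
pose F : {dot X for Num.conj} := HB.pack f
  (isBilinear.Build C X X C *%R (Num.conj \; *%R) f f1 f2 f3 f4)
  (isHermitianSesquilinear.Build C X false Num.conj f f5)
  (isDotProduct.Build C X f f6).
have FE x y : F x y = f x y by [].
clearbody F.
exists F => v w; rewrite !coaction_mx_vec !tlift_sum //.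
have E : hstar (u *m sc H (coord_col v)) *m sc H (Q *m coord_col w) =
   sc H (ctr (coord_col v) *m Q) *m antimx (u *m sc H (coord_col w)).
  by rewrite hstarM hstar_sc antimx_scr !scM !mulmxA -[_ *m hstar u *m _]mulmxA uQ mulmxA.
have fe x i : F x (tnth e i) = (Q *m coord_col x) i 0.
  rewrite FE /f coord_col_tnth -mulmxA mxE (bigD1 i) //= big1 ?addr0.
    by rewrite !mxE !eqxx conjC1 mul1r.
  by move=> k /negPf ki; rewrite !mxE ki conjC0 mul0r.
have ef x i : F (tnth e i) x = (ctr (coord_col x) *m Q) 0 i.
  by rewrite FE /f coord_col_tnth -colE mxE.
transitivity ((hstar (u *m sc H (coord_col v)) *m sc H (Q *m coord_col w)) 0 0).
  by rewrite mul_scE; apply: eq_bigr => i _; rewrite tlift_tens //= fe !mxE.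
rewrite E sc_mulE; apply: eq_bigr => i _; rewrite tlift_tens //= ef.
by rewrite [antimx _ _ _]mxE.
Qed.

End Linear.
End InBasis.
End Unitarizability.

(** * Unitary corepresentations, direct sums, conjugates and tensor products *)

Section CqgMatrices.
Variables (R : realType) (H : hopfStarAlgebra R).
Local Notation C := (R[i]).

Lemma cqg_unitary n (u : 'M[H]_n) : cqg H -> corep u -> exists Q, unitary_for Q u.
Proof.
move=> cqgH cu; pose X : vectType C := 'rV[C]_n.
have [e eb] : exists e : n.-tuple X, basis_of fullv e.
  have dX : \dim {:X} = n by rewrite dimvf /dim /= mul1n.
  have := vbasisP {:X}; move: (vbasis _); rewrite dX => e eb; by exists e.
pose rho (x : X) : X ⊗ H := \sum_i tens (tnth e i) ((u *m sc H (coord_col e x)) i 0).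
have rl : linear rho.
  move=> k x y; rewrite /rho scaler_sumr -big_split; apply: eq_bigr => i _ /=.
  rewrite -tensZr -tensDr; congr tens; rewrite !mul_scE scaler_sumr -big_split.
  by apply: eq_bigr => j _ /=; rewrite linearP !mxE scalerDl scalerA.
have rE : coaction_mx e rho = u.
  apply/matrixP => i j; rewrite mxE /rho (slicel_basis eb) (coord_col_tnth eb) mul_scE.
  rewrite (bigD1 j) //= mxE !eqxx scale1r big1 ?addr0 // => k /negPf kj.
  by rewrite mxE kj scale0r.
have /(unitarizable_mx eb rl)[Q Qp] : unitarizable rho.
  by apply: cqgH; apply/(comodule_corep eb rl); rewrite rE.
by rewrite rE => uQ; exists Q; apply/unitary_forP.
Qed.

Lemma unitary_cqg :
  (forall n (u : 'M[H]_n), corep u -> exists Q, unitary_for Q u) -> cqg H.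
Proof.
move=> uH V rho rhoP; have [rl _ _] := rhoP.
have eb := vbasisP {:V}; apply/(unitarizable_mx eb rl).
have /(comodule_corep eb rl) cu := rhoP.
have [Q uQ] := uH _ _ cu; exists Q; first by case: uQ.
by apply/unitary_forP => //; case: uQ.
Qed.

(** The factorization yields an intertwiner B from z to y with B T = 1. So y is a quotient of z, and
    B Q^-1 B^* is the inverse of an invariant form for it. *)
Lemma unitary_of_coefs m n (Q : 'M[C]_n) (y : 'M[H]_m) (z : 'M[H]_n)
    (A : 'M[C]_(m, n)) (T : 'M[C]_(n, m)) :
  corep y -> corep z -> unitary_for Q z -> y = sc H A *m z *m sc H T ->
  exists Q', unitary_for Q' y.
Proof.
move=> cy cz uz yE.
have [|B [yB BT]] := @intertwiner_of_matrix_coefs _ _ _ _ _ Q y z 1%:M T A cy cz uz.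
  by rewrite sc1 mulmx1.
have [Qp zQz zQ'z] := uz.
have Gp : posdef (B *m invmx Q *m ctr B).
  rewrite -[in X in posdef (X *m _ *m _)](ctrK B); apply: posdef_sub (posdef_inv Qp) _.
  apply/injmxP; exists (ctr T); by rewrite -ctrM BT ctr1.
exists (invmx (B *m invmx Q *m ctr B)); set G := (B *m _ *m _) in Gp *.
have yGy : y *m sc H G *m hstar y = sc H G.
  have : hstar (y *m sc H B) = hstar (sc H B *m z) by rewrite yB.
  rewrite !hstarM !hstar_sc => yB'.
  rewrite /G !scM !mulmxA yB -[_ *m hstar y]mulmxA yB' !mulmxA.
  by rewrite -[sc H B *m z *m _ *m _]mulmxA -[sc H B *m z *m _]mulmxA [z *m (_ *m _)]mulmxA zQ'z.
apply/unitary_forP => //; first exact: posdef_inv.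
have Gu := posdef_unit Gp.
have : sc H G *m hstar y = antimx y *m sc H G.
  by rewrite -[in RHS]yGy -!mulmxA [RHS]mulmxA antimx_mull // mul1mx.
move=> /(congr1 (mulmx (sc H (invmx G)))); rewrite mulmxA -scM mulVmx // sc1 mul1mx => ->.
by rewrite -!mulmxA -scM mulmxV // sc1 mulmx1.
Qed.

Lemma corep_one n : corep (1%:M : 'M[H]_n).
Proof.
split=> i j; rewrite mxE; last by case: (i == j); rewrite ?rmorph1 ?rmorph0.
rewrite (bigD1 i) //= !mxE eqxx big1 ?addr0 => [|k /negPf ki].
  by case: (i == j); rewrite /= ?mulr1n ?mulr0n ?comul1 ?tens0r ?linear0.
by rewrite !mxE eq_sym ki tens0l.
Qed.

Lemma corep_conj n (u : 'M[H]_n) : corep u -> corep (map_mx (@star _ H) u).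
Proof.
move=> [cu eu]; split=> i j; rewrite mxE; last first.
  by rewrite counit_star eu rmorph_nat.
have bs : balanced (fun a b : H => tens (star a) (star b)).
  split=> [v x y|x v v'|k x v] /=; first by rewrite starD tensDl.
    by rewrite starD tensDr.
  by rewrite !starZ tensZl tensZr.
rewrite comul_star cu /tmap tlift_sum //; apply: eq_bigr => k _.
by rewrite tlift_tens // !mxE.
Qed.

Lemma corep_block m n (u : 'M[H]_m) (v : 'M[H]_n) :
  corep u -> corep v -> corep (block_mx u 0 0 v).
Proof.
move=> [cu eu] [cv ev]; split=> i j.
  rewrite big_split_ord /=; case: (split_ordP i) => i' ->; case: (split_ordP j) => j' ->;
    rewrite ?block_mxEul ?block_mxEur ?block_mxEdl ?block_mxEdr ?mxE ?linear0.
  - rewrite cu [X in _ + X]big1 ?addr0.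
      by apply: eq_bigr => k _; rewrite !block_mxEul.
    by move=> k _; rewrite block_mxEur mxE tens0l.
  - rewrite !big1 ?addr0 // => k _.
      by rewrite block_mxEur mxE tens0l.
    by rewrite block_mxEul block_mxEur mxE tens0r.
  - rewrite !big1 ?addr0 // => k _.
      by rewrite block_mxEdr block_mxEdl mxE tens0r.
    by rewrite block_mxEdl mxE tens0l.
  - rewrite cv [X in X + _]big1 ?add0r.
      by apply: eq_bigr => k _; rewrite !block_mxEdr.
    by move=> k _; rewrite block_mxEdl mxE tens0l.
case: (split_ordP i) => i' ->; case: (split_ordP j) => j' ->;
  rewrite ?block_mxEul ?block_mxEur ?block_mxEdl ?block_mxEdr ?mxE ?rmorph0.
- by rewrite eu eq_lshift.
- by rewrite eq_lrshift.
- by rewrite eq_rlshift.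
- by rewrite ev eq_rshift.
Qed.

Lemma sum_tensor_index (W : zmodType) m n (F : 'I_(m * n) -> W) :
  \sum_k F k = \sum_i \sum_j F (mxtens_index (i, j)).
Proof.
rewrite pair_big /= (reindex (@mxtens_index m n)) /=.
  by apply: eq_bigr => -[].
by exists (@mxtens_unindex m n) => k _; rewrite ?mxtens_indexK ?mxtens_unindexK.
Qed.

Lemma corep_tens m n (u : 'M[H]_m) (v : 'M[H]_n) :
  corep u -> corep v -> corep (tensmx u v).
Proof.
move=> [cu eu] [cv ev]; split=> i j.
  case: (mxtens_indexP i) => i1 i2; case: (mxtens_indexP j) => j1 j2.
  rewrite tensmxE comulM cu cv tmul_sum sum_tensor_index.
  apply: eq_bigr => k1 _; apply: eq_bigr => k2 _.
  by rewrite tmul_tens !tensmxE.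
case: (mxtens_indexP i) => i1 i2; case: (mxtens_indexP j) => j1 j2.
rewrite tensmxE rmorphM /= eu ev -natrM mulnb; congr (_%:R); congr nat_of_bool.
apply/andP/eqP => [[/eqP-> /eqP->//]|/(congr1 (@mxtens_unindex m n))].
by rewrite !mxtens_indexK => -[-> ->].
Qed.

End CqgMatrices.

(** * Quotients by Hopf ideals and the initial stabilizing quotient *)

Local Open Scope quotient_scope.

Section QuotientAlgebra.
Variables (K : comNzRingType) (A : algType K).

(** The field [ideal_proper] makes 1 differ from 0 in the quotient ring. *)
Record two_sided_ideal := TwoSidedIdeal {
  ideal_mem :> A -> Prop;
  ideal_add : forall a b, ideal_mem a -> ideal_mem b -> ideal_mem (a + b);
  ideal_scale : forall k a, ideal_mem a -> ideal_mem (k *: a);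
  ideal_mull : forall a b, ideal_mem b -> ideal_mem (a * b);
  ideal_mulr : forall a b, ideal_mem a -> ideal_mem (a * b);
  ideal_zero : ideal_mem 0;
  ideal_proper : ~ ideal_mem 1
}.

Variable J : two_sided_ideal.

Lemma ideal_opp a : J a -> J (- a).
Proof. by rewrite -scaleN1r; exact: ideal_scale. Qed.

Definition ideal_eq (a b : A) : bool := `[< J (a - b) >].

Fact ideal_eq_refl : reflexive ideal_eq.
Proof. by move=> a; apply/asboolP; rewrite subrr; exact: ideal_zero. Qed.

Fact ideal_eq_sym : symmetric ideal_eq.
Proof.
by move=> a b; apply/asboolP/asboolP => /ideal_opp; rewrite opprB.
Qed.

Fact ideal_eq_trans : transitive ideal_eq.
Proof.
move=> b a c /asboolP ab /asboolP bc; apply/asboolP.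
by have := ideal_add ab bc; rewrite addrA subrK.
Qed.

Canonical ideal_equiv := EquivRel ideal_eq ideal_eq_refl ideal_eq_sym ideal_eq_trans.

Definition quot_alg := {eq_quot ideal_eq}.
HB.instance Definition _ := Choice.on quot_alg.
HB.instance Definition _ := EqQuotient.on quot_alg.

Definition qpi (a : A) : quot_alg := \pi_quot_alg a.

Lemma qpiP a b : qpi a = qpi b <-> J (a - b).
Proof. by split=> [/eqmodP/asboolP|ab]; last apply/eqmodP/asboolP. Qed.

Lemma qpi_repr x : qpi (repr x) = x.
Proof. exact: reprK. Qed.

Lemma repr_qpi a : J (repr (qpi a) - a).
Proof. by apply/qpiP; rewrite qpi_repr. Qed.

Definition qadd (x y : quot_alg) := qpi (repr x + repr y).
Definition qmul (x y : quot_alg) := qpi (repr x * repr y).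
Definition qscale k (x : quot_alg) := qpi (k *: repr x).
Definition qopp (x : quot_alg) := qpi (- repr x).

Let qaddE a b : qadd (qpi a) (qpi b) = qpi (a + b).
Proof.
by apply/qpiP; rewrite opprD addrACA; apply: ideal_add; exact: repr_qpi.
Qed.

Let qmulE a b : qmul (qpi a) (qpi b) = qpi (a * b).
Proof.
apply/qpiP; set a' := repr (qpi a); set b' := repr (qpi b).
have -> : a' * b' - a * b = (a' - a) * b' + a * (b' - b).
  by rewrite mulrBl mulrBr addrA subrK.
by apply: ideal_add; [apply: ideal_mulr|apply: ideal_mull]; exact: repr_qpi.
Qed.

Let qscaleE k a : qscale k (qpi a) = qpi (k *: a).
Proof. by apply/qpiP; rewrite -scalerBr; apply/ideal_scale/repr_qpi. Qed.

Let qoppE a : qopp (qpi a) = qpi (- a).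
Proof. by apply/qpiP; rewrite -opprD; apply/ideal_opp/repr_qpi. Qed.

Fact qaddA : associative qadd.
Proof.
by move=> x y z; rewrite -[x]qpi_repr -[y]qpi_repr -[z]qpi_repr !qaddE addrA.
Qed.

Fact qaddC : commutative qadd.
Proof. by move=> x y; rewrite /qadd addrC. Qed.

Fact qadd0 : left_id (qpi 0) qadd.
Proof. by move=> x; rewrite -[x]qpi_repr qaddE add0r. Qed.

Fact qaddN : left_inverse (qpi 0) qopp qadd.
Proof. by move=> x; rewrite -[x]qpi_repr qoppE qaddE addNr. Qed.

HB.instance Definition _ := GRing.isZmodule.Build quot_alg qaddA qaddC qadd0 qaddN.

Fact qmulA : associative qmul.
Proof.
by move=> x y z; rewrite -[x]qpi_repr -[y]qpi_repr -[z]qpi_repr !qmulE mulrA.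
Qed.

Fact qmul1 : left_id (qpi 1) qmul.
Proof. by move=> x; rewrite -[x]qpi_repr qmulE mul1r. Qed.

Fact qmulr1 : right_id (qpi 1) qmul.
Proof. by move=> x; rewrite -[x]qpi_repr qmulE mulr1. Qed.

Fact qmulDl : left_distributive qmul +%R.
Proof.
move=> x y z; rewrite -[x]qpi_repr -[y]qpi_repr -[z]qpi_repr.
by rewrite [_ + _]qaddE !qmulE [RHS]qaddE mulrDl.
Qed.

Fact qmulDr : right_distributive qmul +%R.
Proof.
move=> x y z; rewrite -[x]qpi_repr -[y]qpi_repr -[z]qpi_repr.
by rewrite [_ + _]qaddE !qmulE [RHS]qaddE mulrDr.
Qed.

Fact qone_neq0 : qpi 1 != 0.
Proof. by apply/eqP => /qpiP; rewrite subr0; exact: ideal_proper. Qed.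

HB.instance Definition _ := GRing.Zmodule_isNzRing.Build quot_alg
  qmulA qmul1 qmulr1 qmulDl qmulDr qone_neq0.

Fact qscaleA k l x : qscale k (qscale l x) = qscale (k * l) x.
Proof. by rewrite -[x]qpi_repr !qscaleE scalerA. Qed.

Fact qscale1 : left_id 1 qscale.
Proof. by move=> x; rewrite -[x]qpi_repr qscaleE scale1r. Qed.

Fact qscaleDr : right_distributive qscale +%R.
Proof.
move=> k x y; rewrite -[x]qpi_repr -[y]qpi_repr.
by rewrite [_ + _]qaddE !qscaleE [RHS]qaddE scalerDr.
Qed.

Fact qscaleDl x : {morph qscale^~ x : k l / k + l}.
Proof.
by move=> k l; rewrite -[x]qpi_repr !qscaleE [RHS]qaddE scalerDl.
Qed.

HB.instance Definition _ := GRing.Zmodule_isLmodule.Build K quot_alg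
  qscaleA qscale1 qscaleDr qscaleDl.

Fact qscaleAl k (x y : quot_alg) : k *: (x * y) = k *: x * y.
Proof.
have M a b : qpi a * qpi b = qpi (a * b) := qmulE a b.
have S a : k *: qpi a = qpi (k *: a) := qscaleE k a.
by rewrite -[x]qpi_repr -[y]qpi_repr !(M, S) scalerAl.
Qed.

Fact qscaleAr k (x y : quot_alg) : k *: (x * y) = x * (k *: y).
Proof.
have M a b : qpi a * qpi b = qpi (a * b) := qmulE a b.
have S a : k *: qpi a = qpi (k *: a) := qscaleE k a.
by rewrite -[x]qpi_repr -[y]qpi_repr !(M, S) scalerAr.
Qed.

HB.instance Definition _ := GRing.Lmodule_isLalgebra.Build K quot_alg qscaleAl.
HB.instance Definition _ := GRing.Lalgebra_isAlgebra.Build K quot_alg qscaleAr.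

Fact qpi_linear : linear qpi.
Proof. by move=> k a b; rewrite [k *: qpi a]qscaleE [RHS]qaddE. Qed.
HB.instance Definition _ := GRing.isLinear.Build K A quot_alg *:%R qpi qpi_linear.

Fact qpi_monoid : monoid_morphism qpi.
Proof. by split=> // a b; rewrite [RHS]qmulE. Qed.
HB.instance Definition _ := GRing.isMonoidMorphism.Build A quot_alg qpi qpi_monoid.

Lemma qpi_eq0 a : qpi a = 0 <-> J a.
Proof. by rewrite -[X in J X]subr0; exact: qpiP. Qed.

Section Lift.
Variables (B : algType K) (f : {lrmorphism A -> B}) (fJ : forall a, J a -> f a = 0).

Definition qlift (x : quot_alg) : B := f (repr x).

Lemma qlift_pi a : qlift (qpi a) = f a.
Proof. by have := fJ (repr_qpi a); rewrite raddfB => /eqP; rewrite subr_eq0 => /eqP. Qed.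

End Lift.

End QuotientAlgebra.
Arguments qpi {K A} J a.

(** * Quotient by a Hopf star ideal *)

Section QuotientHopf.
Variables (R : realType) (H : hopfStarAlgebra R).
Local Notation C := (R[i]).
Variable J : two_sided_ideal H.
(** The coideal condition is stated as the vanishing of the comultiplication after projecting both
    factors, which avoids a description of the kernel of this projection. *)
Hypotheses
  (J_comul : forall a, J a -> tmap (qpi J) (qpi J) (comul H a) = 0)
  (J_counit : forall a, J a -> counit H a = 0)
  (J_antipode : forall a, J a -> J (antipode H a))
  (J_star : forall a, J a -> J (star a)).

Let pi : {lrmorphism H -> quot_alg J} := qpi J.
Let A : algType C := quot_alg J.
Let pi_ind (P : A -> Prop) : (forall a, P (pi a)) -> forall x, P x.
Proof. by move=> Ppi x; rewrite -[x]qpi_repr; exact: Ppi. Qed.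
Let repr_pi a : J (repr (pi a) - a). Proof. exact: repr_qpi. Qed.

Definition quot_comul (x : A) : A ⊗ A := tmap pi pi (comul H (repr x)).
Let comul_pi a : quot_comul (pi a) = tmap pi pi (comul H a).
Proof.
by have := J_comul (repr_pi a); rewrite !linearB /= => /eqP; rewrite subr_eq0 => /eqP.
Qed.
Fact quot_comul_linear : linear quot_comul.
Proof.
move=> k; elim/pi_ind => a; elim/pi_ind => b.
by rewrite -linearP !comul_pi !linearP.
Qed.
HB.instance Definition _ := GRing.isLinear.Build C A (A ⊗ A) *:%R quot_comul quot_comul_linear.

Definition quot_counit (x : A) : C^o := counit H (repr x).
Let counit_pi a : quot_counit (pi a) = counit H a.
Proof.
by have := J_counit (repr_pi a); rewrite raddfB => /eqP; rewrite subr_eq0 => /eqP.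
Qed.
Fact quot_counit_linear : linear quot_counit.
Proof.
move=> k; elim/pi_ind => a; elim/pi_ind => b.
by rewrite -linearP !counit_pi linearP.
Qed.
Fact quot_counit_monoid : monoid_morphism quot_counit.
Proof.
split; first by rewrite -(rmorph1 pi) counit_pi rmorph1.
by elim/pi_ind => a; elim/pi_ind => b; rewrite -rmorphM !counit_pi rmorphM.
Qed.
HB.instance Definition _ := GRing.isLinear.Build C A C^o *:%R quot_counit quot_counit_linear.
HB.instance Definition _ := GRing.isMonoidMorphism.Build A C^o quot_counit quot_counit_monoid.

Definition quot_antipode (x : A) : A := pi (antipode H (repr x)).
Let antipode_pi a : quot_antipode (pi a) = pi (antipode H a).
Proof. by apply/qpiP; rewrite -linearB; apply/J_antipode/repr_pi. Qed.
Fact quot_antipode_linear : linear quot_antipode.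
Proof.
move=> k; elim/pi_ind => a; elim/pi_ind => b.
by rewrite -linearP !antipode_pi !linearP.
Qed.
HB.instance Definition _ := GRing.isLinear.Build C A A *:%R quot_antipode quot_antipode_linear.

Definition quot_star (x : A) : A := pi (star (repr x)).
Let star_pi a : quot_star (pi a) = pi (star a).
Proof. by apply/qpiP; rewrite -starB; apply/J_star/repr_pi. Qed.

Fact quot_comulA x :
  tassoc (tmap quot_comul idfun (quot_comul x)) = tmap idfun quot_comul (quot_comul x).
Proof.
elim/pi_ind: x => a; rewrite comul_pi.
transitivity (tmap pi (tmap pi pi) (tassoc (tmap (comul H) idfun (comul H a)))).
  apply: (@tensor_ext _ _ _ _ (@tassoc _ A A A \o tmap quot_comul idfun \o tmap pi pi)
     (tmap pi (tmap pi pi) \o @tassoc _ H H H \o tmap (comul H) idfun))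
    => [y z|y z|u v] /=; rewrite ?linearD //.
  rewrite !tmap_tens /= comul_pi.
  apply: (@tensor_ext _ _ _ _ (fun y => tassoc (tens (tmap pi pi y) (pi v)))
     (fun y => tmap pi (tmap pi pi) (tassoc (tens y v)))) => [y z|y z|u' v'] /=.
  - by rewrite linearD /= tensDl linearD.
  - by rewrite tensDl !linearD.
  - by rewrite !(tmap_tens, tassoc_tens) /= tmap_tens.
rewrite comulA.
apply: (@tensor_ext _ _ _ _ (tmap pi (tmap pi pi) \o tmap idfun (comul H))
     (tmap idfun quot_comul \o tmap pi pi))
    => [y z|y z|u v] /=; rewrite ?linearD //.
by rewrite !tmap_tens /= comul_pi.
Qed.

Fact quot_counitl x : tlift (fun a b => (quot_counit a : C) *: b) (quot_comul x) = x.
Proof.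
elim/pi_ind: x => a; rewrite comul_pi tlift_tmap; last exact: (balanced_slicel A quot_counit).
rewrite -[in RHS](counitl a) tlift_comp; apply: tlift_ext => u v.
by rewrite counit_pi; exact: (esym (linearZ_LR pi _ _)).
Qed.

Fact quot_counitr x : tlift (fun a b => (quot_counit b : C) *: a) (quot_comul x) = x.
Proof.
elim/pi_ind: x => a; rewrite comul_pi tlift_tmap; last exact: (balanced_slicer A quot_counit).
rewrite -[in RHS](counitr a) tlift_comp; apply: tlift_ext => u v.
by rewrite counit_pi; exact: (esym (linearZ_LR pi _ _)).
Qed.

Fact quot_comul1 : quot_comul 1 = tens 1 1.
Proof. by rewrite -(rmorph1 pi) comul_pi comul1 tmap_tens. Qed.

Lemma tmap_tmul (B B' : algType C) (f : {lrmorphism B -> B'}) x y :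
  tmap f f (tmul x y) = tmul (tmap f f x) (tmap f f y).
Proof.
apply: (@tensor_ext _ _ _ _ (fun x => tmap f f (tmul x y))
  (fun x => tmul (tmap f f x) (tmap f f y))) => [z z'|z z'|u v] /=.
- by rewrite tmulDl linearD.
- by rewrite linearD /= tmulDl.
apply: (@tensor_ext _ _ _ _ (fun y => tmap f f (tmul (tens u v) y))
  (fun y => tmul (tmap f f (tens u v)) (tmap f f y))) => [z z'|z z'|u' v'] /=.
- by rewrite tmulDr linearD.
- by rewrite linearD /= tmulDr.
- by rewrite !tmap_tens !tmul_tens tmap_tens !rmorphM.
Qed.

Fact quot_comulM x y : quot_comul (x * y) = tmul (quot_comul x) (quot_comul y).
Proof.
elim/pi_ind: x => a; elim/pi_ind: y => b.
by rewrite -rmorphM !comul_pi comulM tmap_tmul.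
Qed.

Let balanced_qmul (f g : {linear A -> A}) : balanced (fun a b => f a * g b).
Proof.
split=> [v x y|u x y|k u v] /=; first by rewrite linearD mulrDl.
  by rewrite linearD mulrDr.
by rewrite !linearZ_LR -scalerAl -scalerAr.
Qed.

Fact quot_antipodel x :
  tlift (fun a b => quot_antipode a * b) (quot_comul x) = quot_counit x *: 1.
Proof.
elim/pi_ind: x => a; rewrite comul_pi tlift_tmap; last exact: (balanced_qmul quot_antipode idfun).
rewrite counit_pi -(rmorph1 pi) -linearZ /= -(antipodel a) tlift_comp.
by apply: tlift_ext => u v; rewrite antipode_pi; exact: (esym (rmorphM pi _ _)).
Qed.

Fact quot_antipoder x :
  tlift (fun a b => a * quot_antipode b) (quot_comul x) = quot_counit x *: 1.
Proof.
elim/pi_ind: x => a; rewrite comul_pi tlift_tmap; last exact: (balanced_qmul idfun quot_antipode).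
rewrite counit_pi -(rmorph1 pi) -linearZ /= -(antipoder a) tlift_comp.
by apply: tlift_ext => u v; rewrite antipode_pi; exact: (esym (rmorphM pi _ _)).
Qed.

Fact quot_starD : {morph quot_star : g h / g + h}.
Proof.
by elim/pi_ind => a; elim/pi_ind => b; rewrite -raddfD !star_pi starD raddfD.
Qed.

Fact quot_starZ (k : C) h : quot_star (k *: h) = Num.conj k *: quot_star h.
Proof. by elim/pi_ind: h => a; rewrite -linearZ !star_pi starZ linearZ. Qed.

Fact quot_starM g h : quot_star (g * h) = quot_star h * quot_star g.
Proof.
by elim/pi_ind: g => a; elim/pi_ind: h => b; rewrite -rmorphM !star_pi starM rmorphM.
Qed.

Fact quot_starK : involutive quot_star.
Proof. by elim/pi_ind => a; rewrite !star_pi starK. Qed.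

Fact quot_comul_star h :
  quot_comul (quot_star h) = tmap quot_star quot_star (quot_comul h).
Proof.
elim/pi_ind: h => a; rewrite star_pi !comul_pi comul_star.
have bq : balanced (fun u v => tens (quot_star u) (quot_star v)).
  split=> [v x y|u x y|k u v] /=; first by rewrite quot_starD tensDl.
    by rewrite quot_starD tensDr.
  by rewrite !quot_starZ tensZl tensZr.
rewrite {2}/tmap tlift_comp [RHS]tlift_tmap //.
by apply: tlift_ext => u v; rewrite /= tmap_tens !star_pi.
Qed.

Fact quot_counit_star h : quot_counit (quot_star h) = Num.conj (quot_counit h : C).
Proof. by elim/pi_ind: h => a; rewrite star_pi !counit_pi counit_star. Qed.

Definition quot_hopf : hopfStarAlgebra R := @HopfStarAlgebra R A quot_comul
  quot_counit quot_antipode quot_star quot_comulA quot_counitl quot_counitr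
  quot_comul1 quot_comulM quot_antipodel quot_antipoder quot_starD quot_starZ
  quot_starM quot_starK quot_comul_star quot_counit_star.

Definition quot_pi : {lrmorphism H -> quot_hopf} := pi.

Lemma quot_pi_morphism : is_hopf_star_morphism quot_pi.
Proof.
split=> a.
- exact: comul_pi.
- exact: counit_pi.
- exact: antipode_pi.
- exact: star_pi.
Qed.

Lemma quot_pi_surj x : exists a, quot_pi a = x.
Proof. by exists (repr x); exact: qpi_repr. Qed.

Lemma quot_pi_eq0 a : quot_pi a = 0 <-> J a.
Proof. exact: qpi_eq0. Qed.

Lemma quot_hopf_lift (K : hopfStarAlgebra R) (f : {lrmorphism H -> K}) :
  is_hopf_star_morphism f -> (forall a, J a -> f a = 0) ->
  exists phi : {lrmorphism quot_hopf -> K},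
    is_hopf_star_morphism phi /\ phi \o quot_pi =1 f.
Proof.
move=> [fD fe fS fs] fJ.
pose g : A -> K := qlift f.
have gE a : g (pi a) = f a by exact: qlift_pi.
have g1 : linear g.
  by move=> k; elim/pi_ind => a; elim/pi_ind => b; rewrite -linearP !gE linearP.
have g2 : monoid_morphism g.
  split; first by rewrite -(rmorph1 pi) gE rmorph1.
  by elim/pi_ind => a; elim/pi_ind => b; rewrite -rmorphM !gE rmorphM.
pose phi : {lrmorphism quot_hopf -> K} := HB.pack g
  (GRing.isLinear.Build C A K *:%R g g1) (GRing.isMonoidMorphism.Build A K g g2).
exists phi; split; last by move=> a; exact: gE.
have phiE a : phi (pi a) = f a by exact: gE.
split; elim/pi_ind => a; rewrite phiE.
- rewrite fD [comul quot_hopf _]comul_pi /tmap.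
  rewrite [RHS]tlift_tmap; last exact: balanced_linear.
  by apply: tlift_ext => u v; rewrite !phiE.
- by rewrite fe [RHS]counit_pi.
- by rewrite fS [antipode quot_hopf _]antipode_pi phiE.
- by rewrite fs (_ : @star R quot_hopf (pi a) = pi (star a)) ?phiE //; exact: star_pi.
Qed.

End QuotientHopf.

Section Morphisms.
Variables (R : realType) (H K : hopfStarAlgebra R).
Local Notation C := (R[i]).
Variables (f : {lrmorphism H -> K}) (fm : is_hopf_star_morphism f).

Lemma map_sc m n (A : 'M[C]_(m, n)) : map_mx f (sc H A) = sc K A.
Proof. by apply/matrixP => i j; rewrite !mxE linearZ_LR rmorph1. Qed.

Lemma map_hstar m n (u : 'M[H]_(m, n)) : map_mx f (hstar u) = hstar (map_mx f u).
Proof. by case: fm => _ _ _ fs; apply/matrixP => i j; rewrite !mxE fs. Qed.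

Lemma corep_map n (u : 'M[H]_n) : corep u -> corep (map_mx f u).
Proof.
case: fm => fD fe _ _ [cu eu]; split=> i j; last by rewrite mxE fe.
rewrite mxE fD cu linear_sum; apply: eq_bigr => k _ /=.
by rewrite tmap_tens !mxE.
Qed.

Lemma unitary_map n (Q : 'M[C]_n) (u : 'M[H]_n) :
  unitary_for Q u -> unitary_for Q (map_mx f u).
Proof.
move=> [Qp uQ uQ']; split=> //.
  by have := congr1 (map_mx f) uQ; rewrite !map_mxM map_hstar !map_sc.
by have := congr1 (map_mx f) uQ'; rewrite !map_mxM map_hstar !map_sc.
Qed.

End Morphisms.

(** * Matrices of coefficients and the antipode of a product *)

Section Coefficients.
Variables (R : realType) (H : hopfStarAlgebra R).
Local Notation C := (R[i]).

Definition coefs m n (y : 'M[H]_(m, n)) : Prop :=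
  exists N (z : 'M[H]_N) (A : 'M[C]_(m, N)) (T : 'M[C]_(N, n)),
    corep z /\ y = sc H A *m z *m sc H T.

Lemma coefs0 m n : coefs (0 : 'M[H]_(m, n)).
Proof.
exists 0, 1%:M, 0, 0; split; first exact: corep_one.
by rewrite !sc0 mulmx0.
Qed.

Lemma coefsD m n (y y' : 'M[H]_(m, n)) : coefs y -> coefs y' -> coefs (y + y').
Proof.
move=> [N [z [A [T [cz ->]]]]] [N' [z' [A' [T' [cz' ->]]]]].
exists (N + N')%N, (block_mx z 0 0 z'), (row_mx A A'), (col_mx T T').
split; first exact: corep_block.
rewrite /sc map_row_mx map_col_mx -!/(sc H _) mul_row_block !mulmx0 addr0 add0r.
by rewrite mul_row_col.
Qed.

(** Direct sums collect the corepresentations of the single entries into one that serves the whole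
    matrix. *)
Lemma matrix_coefficients m n (y : 'M[H]_(m, n)) : coefs y.
Proof.
rewrite [y]matrix_sum_delta.
apply: (big_ind (@coefs m n)) => [||i _]; [exact: coefs0|exact: coefsD|].
apply: (big_ind (@coefs m n)) => [||j _]; [exact: coefs0|exact: coefsD|].
have [N [z [l [c [cz zE]]]]] := matrix_coefficient (y i j).
exists N, z, (delta_mx i 0 *m l), (c *m delta_mx 0 j); split=> //.
transitivity (sc H (delta_mx i 0) *m (sc H l *m z *m sc H c) *m sc H (delta_mx 0 j));
  last by rewrite !scM !mulmxA.
rewrite [sc H l *m z *m sc H c]mx11_scalar -zE; apply/matrixP => a b.
rewrite ![RHS]mxE big_ord1 [X in _ = X * _]mxE big_ord1 !mxE !eqxx !andbT /= mulr1n.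
by case: (a == i) (b == j) => -[]; rewrite /= ?scale0r ?scale1r ?(mul0r, mulr0, mul1r, mulr1).
Qed.

(** Reduces linear identities to entries of corepresentations, where the comultiplication is
    explicit. *)
Lemma entry_ind (P : H -> Prop) : P 0 -> (forall a b, P a -> P b -> P (a + b)) ->
  (forall k a, P a -> P (k *: a)) ->
  (forall n (u : 'M[H]_n) i j, corep u -> P (u i j)) -> forall a, P a.
Proof.
move=> P0 PD PZ Pu a; have [n [u [l [c [cu ->]]]]] := matrix_coefficient a.
rewrite mul_scE; apply: (big_ind P) => // j _; rewrite sc_mulE; apply/PZ.
by apply: (big_ind P) => // i _; apply/PZ/Pu.
Qed.

End Coefficients.

Section AntipodeProduct.
Variables (R : realType) (H : hopfStarAlgebra R).
Local Notation C := (R[i]).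

(** Uniqueness of inverses: the products S(z) S(y) form a right inverse of the tensor product of y
    and z, and its antipode matrix is a left inverse. *)
Lemma antipode_tens m n (y : 'M[H]_m) (z : 'M[H]_n) i j k l :
  corep y -> corep z ->
  antipode H (y i j * z k l) = antipode H (z k l) * antipode H (y i j).
Proof.
move=> cy cz; have cyz := corep_tens cy cz.
pose w : 'M[H]_(m * n) := \matrix_(a, b)
  (antimx z (mxtens_unindex a).2 (mxtens_unindex b).2 *
   antimx y (mxtens_unindex a).1 (mxtens_unindex b).1).
have yzw : tensmx y z *m w = 1%:M.
  apply/matrixP => a b; case: (mxtens_indexP a) => i1 k1; case: (mxtens_indexP b) => j1 l1.
  rewrite mxE sum_tensor_index.
  transitivity (\sum_p y i1 p * (z *m antimx z) k1 l1 * antimx y p j1).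
    apply: eq_bigr => p _; rewrite mxE mulr_sumr mulr_suml; apply: eq_bigr => q _.
    by rewrite tensmxE [w _ _]mxE !mxtens_indexK /= !mulrA.
  rewrite antimx_mulr // !mxE.
  have -> : (mxtens_index (i1, k1) == mxtens_index (j1, l1)) = (i1 == j1) && (k1 == l1).
    by rewrite (can_eq (@mxtens_indexK m n)).
  case: (k1 == l1); last first.
    by rewrite andbF big1 // => p _; rewrite mulr0 mul0r.
  rewrite andbT; have /matrixP/(_ i1 j1) := antimx_mulr cy; rewrite !mxE => <-.
  by apply: eq_bigr => p _; rewrite mulr1.
have wE : antimx (tensmx y z) = w.
  by rewrite -[LHS]mulmx1 -yzw mulmxA antimx_mull // mul1mx.
have /matrixP/(_ (mxtens_index (i, k)) (mxtens_index (j, l))) := wE.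
by rewrite [w _ _]mxE !mxE !mxtens_indexK.
Qed.

Lemma antipodeM a b : antipode H (a * b) = antipode H b * antipode H a.
Proof.
elim/entry_ind: a => [|a a' IHa IHa'|k a IHa|m y i j cy].
- by rewrite mul0r !linear0 mulr0.
- by rewrite mulrDl !linearD /= IHa IHa' mulrDr.
- by rewrite -scalerAl !linearZ_LR IHa scalerAr.
elim/entry_ind: b => [|b b' IHb IHb'|k b IHb|n z p q cz].
- by rewrite mulr0 !linear0 mul0r.
- by rewrite mulrDr !linearD /= IHb IHb' mulrDl.
- by rewrite -scalerAr !linearZ_LR IHb scalerAl.
exact: antipode_tens.
Qed.

End AntipodeProduct.

(** * The ideal of the stabilizer *)

Section StabilizerIdeal.
Variables (R : realType) (H : hopfStarAlgebra R).
Local Notation C := (R[i]).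
Variables (n : nat) (Q : 'M[C]_n) (u : 'M[H]_n) (F : Type) (P : F -> 'M[C]_n).
Hypotheses (cu : corep u) (uu : unitary_for Q u)
  (PQ : forall i, Q *m P i = ctr (P i) *m Q).

Definition is_ideal (J : H -> Prop) : Prop :=
  [/\ J 0, forall a b, J a -> J b -> J (a + b), forall k a, J a -> J (k *: a),
      forall a b, J b -> J (a * b) & forall a b, J a -> J (a * b)].

Definition commutator i : 'M[H]_n := u *m sc H (P i) - sc H (P i) *m u.

Lemma commutatorE i p q :
  commutator i p q = (u *m sc H (P i)) p q - (sc H (P i) *m u) p q.
Proof. exact: mxBE. Qed.

(** As an intersection, it is contained in any condition that is shown to be an ideal containing the
    commutators. *)
Definition stab_mem (a : H) : Prop :=
  forall J, is_ideal J -> (forall i p q, J (commutator i p q)) -> J a.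

Lemma stab_mem_ideal : is_ideal stab_mem.
Proof.
split=> [|a b Ia Ib|k a Ia|a b Ib|a b Ia] J Jid Jg; have [J0 JD JZ Jl Jr] := Jid.
- exact: J0.
- by apply: JD; [exact: Ia|exact: Ib].
- by apply: JZ; exact: Ia.
- by apply: Jl; exact: Ib.
- by apply: Jr; exact: Ia.
Qed.

Lemma stab_commutator i p q : stab_mem (commutator i p q).
Proof. by move=> J _; exact. Qed.

Lemma commutator_counit i p q : counit H (commutator i p q) = 0.
Proof.
have : fmx (counit H) (commutator i) = 0.
  by rewrite fmxB fmx_scr fmx_scl fmx_counit // mul1mx mulmx1 subrr.
by move=> /matrixP/(_ p q); rewrite !mxE.
Qed.

Lemma stab_counit a : stab_mem a -> counit H a = 0.
Proof.
move=> /(_ (fun a => counit H a = 0)); apply; last exact: commutator_counit.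
split=> [|a' b' Ja Jb|k a' Ja|a' b' Jb|a' b' Ja].
- by rewrite linear0.
- by rewrite linearD /= Ja Jb addr0.
- by rewrite linearZ_LR /= Ja scaler0.
- by rewrite rmorphM /= Jb mulr0.
- by rewrite rmorphM /= Ja mul0r.
Qed.

Fact stab_proper : ~ stab_mem 1.
Proof. by move=> /stab_counit/eqP; rewrite rmorph1 oner_eq0. Qed.

Definition stab_ideal : two_sided_ideal H :=
  let: And5 I0 ID IZ Il Ir := stab_mem_ideal in
  TwoSidedIdeal ID IZ Il Ir I0 stab_proper.

Lemma stab_idealE a : stab_ideal a = stab_mem a.
Proof. by rewrite /stab_ideal; case: stab_mem_ideal. Qed.

Definition stab_mx m p (M : 'M[H]_(m, p)) : Prop := forall i j, stab_mem (M i j).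

Lemma stab_sum I (r : seq I) (p : pred I) (E : I -> H) :
  (forall i, p i -> stab_mem (E i)) -> stab_mem (\sum_(i <- r | p i) E i).
Proof.
have [I0 ID _ _ _] := stab_mem_ideal.
by move=> IE; apply: (big_ind stab_mem).
Qed.

Lemma stab_mx_mull m p q (M : 'M[H]_(m, p)) (N : 'M[H]_(p, q)) :
  stab_mx N -> stab_mx (M *m N).
Proof.
have [_ _ _ Il _] := stab_mem_ideal.
by move=> IN i j; rewrite mxE; apply: stab_sum => k _; exact: Il.
Qed.

Lemma stab_mx_mulr m p q (M : 'M[H]_(m, p)) (N : 'M[H]_(p, q)) :
  stab_mx M -> stab_mx (M *m N).
Proof.
have [_ _ _ _ Ir] := stab_mem_ideal.
by move=> IM i j; rewrite mxE; apply: stab_sum => k _; exact: Ir.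
Qed.

Lemma stab_antipode a : stab_mem a -> stab_mem (antipode H a).
Proof.
have [I0 ID IZ Il Ir] := stab_mem_ideal.
move=> /(_ (fun a => stab_mem (antipode H a))); apply;
  first split=> [|a' b' Ja Jb|k a' Ja|a' b' Jb|a' b' Ja].
- by rewrite linear0.
- by rewrite linearD; exact: ID.
- by rewrite linearZ_LR; exact: IZ.
- by rewrite antipodeM; exact: Ir.
- by rewrite antipodeM; exact: Il.
move=> i p q; suff : stab_mx (antimx (commutator i)) by move=> /(_ p q); rewrite mxE.
(* S(u) is the inverse of u, and S(u) P - P S(u) is the commutator multiplied by it on both sides,
   up to sign. *)
have -> : antimx (commutator i) = - (antimx u *m commutator i *m antimx u).
  have -> : antimx (commutator i) = antimx u *m sc H (P i) - sc H (P i) *m antimx u.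
    by rewrite antimxB antimx_scl antimx_scr.
  rewrite /commutator mulmxBr mulmxBl !mulmxA antimx_mull // mul1mx.
  by rewrite -!mulmxA antimx_mulr // mulmx1 opprB.
rewrite -mulNmx; apply: stab_mx_mulr; rewrite -mulNmx; apply: stab_mx_mull.
by move=> a' b'; exact: stab_commutator.
Qed.

Lemma stab_star a : stab_mem a -> stab_mem (star a).
Proof.
have [I0 ID IZ Il Ir] := stab_mem_ideal.
move=> /(_ (fun a => stab_mem (star a))); apply;
  first split=> [|a' b' Ja Jb|k a' Ja|a' b' Jb|a' b' Ja].
- by rewrite star0.
- by rewrite starD; exact: ID.
- by rewrite starZ; exact: IZ.
- by rewrite starM; exact: Ir.
- by rewrite starM; exact: Il.
move=> i p q; suff : stab_mx (hstar (commutator i)) by move=> /(_ q p); rewrite !mxE.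
have [Qp _ _] := uu; have uQ := (unitary_forP cu Qp).1 uu.
have Qu := posdef_unit Qp.
have uE : hstar u = sc H Q *m antimx u *m sc H (invmx Q).
  by rewrite -uQ -mulmxA -scM mulmxV // sc1 mulmx1.
have PE : sc H (ctr (P i)) = sc H Q *m sc H (P i) *m sc H (invmx Q).
  by rewrite -!scM PQ -mulmxA mulmxV // mulmx1.
(* Both u^* = Q S(u) Q^-1 and P^* = Q P Q^-1 hold, so that the star is reduced to the antipode. *)
have -> : hstar (commutator i) = - (sc H Q *m antimx (commutator i) *m sc H (invmx Q)).
  have -> : antimx (commutator i) = antimx u *m sc H (P i) - sc H (P i) *m antimx u.
    by rewrite antimxB antimx_scl antimx_scr.
  have qiq : sc H (invmx Q) *m sc H Q = 1%:M by rewrite -scM mulVmx // sc1.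
  rewrite /commutator hstarB !hstarM !hstar_sc uE PE mulmxBr mulmxBl opprB.
  by rewrite -!mulmxA !(mulmxA (sc H (invmx Q)) (sc H Q)) qiq !mul1mx.
rewrite -mulNmx; apply: stab_mx_mulr; rewrite -mulNmx; apply: stab_mx_mull.
by move=> a1 b1; rewrite [antimx _ a1 b1]mxE; apply: stab_antipode; exact: stab_commutator.
Qed.

(** On a generator, uP and Pu may be exchanged in either factor of the coproduct modulo the ideal,
    and both halves become the sum of the u p k P k l ⊗ u l q. *)
Lemma stab_comul a : stab_mem a ->
  tmap (qpi stab_ideal) (qpi stab_ideal) (comul H a) = 0.
Proof.
pose pi : {lrmorphism H -> quot_alg stab_ideal} := qpi stab_ideal.
rewrite -/pi; have tmul0l y : tmul (0 : quot_alg stab_ideal ⊗ quot_alg stab_ideal) y = 0.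
  by apply: (addrI (tmul 0 y)); rewrite -tmulDl !addr0.
have tmul0r y : tmul y (0 : quot_alg stab_ideal ⊗ quot_alg stab_ideal) = 0.
  by apply: (addrI (tmul y 0)); rewrite -tmulDr !addr0.
move=> /(_ (fun a => tmap pi pi (comul H a) = 0)); apply;
  first split=> [|a' b' Ja Jb|k a' Ja|a' b' Jb|a' b' Ja].
- by rewrite !linear0.
- by rewrite !linearD /= Ja Jb addr0.
- by rewrite !linearZ_LR /= Ja scaler0.
- by rewrite comulM tmap_tmul Jb tmul0r.
- by rewrite comulM tmap_tmul Ja tmul0l.
move=> i p q.
have piP k l : qpi stab_ideal ((u *m sc H (P i)) k l) = qpi stab_ideal ((sc H (P i) *m u) k l).
  apply/qpiP; rewrite stab_idealE; have := @stab_commutator i k l.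
  by rewrite commutatorE.
rewrite commutatorE !linearB /= comul_scr // comul_scl // !(linear_sum (tmap pi pi)).
under eq_bigr => l _ do rewrite /= tmap_tens /= piP sc_mulE linear_sum tens_sumr.
under [X in _ - X]eq_bigr => l _ do rewrite /= tmap_tens /= -piP mul_scE linear_sum tens_suml.
rewrite exchange_big /= -sumrB big1 // => k _; rewrite -sumrB big1 // => l _.
by rewrite !linearZ_LR /= tensZl tensZr subrr.
Qed.

End StabilizerIdeal.

(** * The initial stabilizing quotient *)

Section StabilizingQuotient.
Variables (R : realType).
Local Notation C := (R[i]).

(** An entrywise lift of a corepresentation of [K] need not be a corepresentation, but its entries
    are coefficients of a unitary corepresentation of [H], and [unitary_of_coefs] applies to the
    image of the latter. *)
Lemma cqg_surjective (H K : hopfStarAlgebra R) (f : {lrmorphism H -> K}) :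
  is_hopf_star_morphism f -> (forall x, exists a, f a = x) -> cqg H -> cqg K.
Proof.
move=> fm fsurj cqgH; apply: unitary_cqg => n m cm.
have [g gE] := choice fsurj.
have mE : m = map_mx f (map_mx g m) by apply/matrixP => i j; rewrite !mxE gE.
have [N [z [A [T [cz yE]]]]] := matrix_coefficients (map_mx g m).
have [Q uz] := cqg_unitary cqgH cz.
apply: (unitary_of_coefs cm (corep_map fm cz) (unitary_map fm uz) (A := A) (T := T)).
by rewrite {1}mE yE !map_mxM !map_sc.
Qed.

Section Pushforward.
Variables (H K : hopfStarAlgebra R) (f : {lrmorphism H -> K}).
Variables (V : vectType C) (rho : V -> V ⊗ H) (rl : linear rho).

Lemma push_linear : linear (push_coaction f rho).
Proof. by move=> k x y; rewrite /push_coaction rl linearP. Qed.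

Lemma push_mx n (e : n.-tuple V) :
  coaction_mx e (push_coaction f rho) = map_mx f (coaction_mx e rho).
Proof.
apply/matrixP => i j; rewrite !mxE /push_coaction.
set c : {linear V -> C^o} := vcoord e i.
apply: (@tensor_ext _ _ _ _ (slicel c \o tmap idfun f) (f \o slicel c))
  => [y z|y z|u v] /=; rewrite ?linearD //.
by rewrite tmap_tens !slicel_tens linearZ.
Qed.

End Pushforward.

Definition projects_onto (V : vectType C) n (e : n.-tuple V) (W : {vspace V})
    (P : 'M[C]_n) : Prop :=
  P *m P = P /\ forall w, w \in W <-> P *m coord_col e w = coord_col e w.

(** [P] is orthogonal for a form preserved by the coaction, so that stability of [W] entails
    stability of its complement. *)
Lemma subcomodule_mx (K : hopfStarAlgebra R) (V : vectType C)
    (sigma : V -> V ⊗ K) n (e : n.-tuple V) (W : {vspace V}) (Q P : 'M[C]_n) :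
  basis_of fullv e -> is_comodule sigma -> unitary_for Q (coaction_mx e sigma) ->
  projects_onto e W P -> Q *m P = ctr P *m Q ->
  subcomodule sigma W <->
  coaction_mx e sigma *m sc K P = sc K P *m coaction_mx e sigma.
Proof.
move=> eb sP uv [PP PW] PQ; have [sl _ _] := sP.
set v := coaction_mx e sigma in uv *.
have cv : corep v by apply/(comodule_corep eb sl).
split=> [Wsub|vP w wW].
  apply: (projection_commutes cv uv PQ).
  suff vW w : w \in W -> sc K (1%:M - P) *m v *m sc K (coord_col e w) = 0.
    apply/matrixP => i j.
    have : vec_of_col e (col j P) \in W.
      by apply/PW; rewrite (vec_of_colK eb) colE mulmxA PP.
    move=> /vW; rewrite (vec_of_colK eb) => /matrixP/(_ i 0).
    rewrite mul_scE => E; rewrite mul_scE [RHS]mxE -[RHS](_ : (0 : 'M[K]_(n, 1)) i 0 = 0);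
      last by rewrite mxE.
    by rewrite -E; apply: eq_bigr => k _; rewrite [col j P k 0]mxE.
  move=> wW; have [t tE] := Wsub w wW.
  rewrite -mulmxA; apply/matrixP => i j; rewrite ord1 sc_mulE [RHS]mxE.
  have vE k : (v *m sc K (coord_col e w)) k 0 = slicel (vcoord e k : {linear V -> C^o}) (sigma w).
    by rewrite (coaction_mx_vec eb sl) (slicel_basis eb).
  under eq_bigr => k _ do rewrite vE -tE.
  elim/tensor_ind: t {tE} => [|s h t IHt].
    by rewrite big1 // => k _; rewrite !linear0.
  under eq_bigr => k _ do rewrite !linearD /= tmap_tens slicel_tens scalerA.
  rewrite big_split /= IHt addr0 -scaler_suml.
  have /PW/matrixP/(_ i 0) := subvsP s.
  rewrite !mxE => sE; rewrite (_ : \sum_k _ = 0) ?scale0r //.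
  under eq_bigr => k _ do rewrite !mxE mulrBl.
  rewrite sumrB; apply/eqP; rewrite subr_eq0; apply/eqP.
  rewrite (bigD1 i) //= eqxx mul1r big1 ?addr0.
    by rewrite -{1}sE; apply: eq_bigr => k _; rewrite mxE.
  by move=> k /negPf ki; rewrite eq_sym ki mul0r.
pose b k : V := vec_of_col e (col k P).
have bW k : b k \in W by apply/PW; rewrite (vec_of_colK eb) colE mulmxA PP.
pose y := v *m sc K (coord_col e w).
exists (\sum_k tens (Subvs (bW k)) (y k 0)).
rewrite linear_sum (coaction_mx_vec eb sl).
have -> : v *m sc K (coord_col e w) = sc K P *m y.
  by rewrite /y mulmxA -vP -mulmxA -scM (PW w).1.
transitivity (\sum_k \sum_i tens (P i k *: tnth e i) (y k 0)).
  apply: eq_bigr => k _; rewrite /= tmap_tens /= /b /vec_of_col tens_suml.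
  by apply: eq_bigr => i _; rewrite mxE.
rewrite exchange_big /=; apply: eq_bigr => i _; rewrite sc_mulE tens_sumr.
by apply: eq_bigr => k _; rewrite tensZl tensZr.
Qed.

Section InitialQuotient.
Variables (H : hopfStarAlgebra R) (cqgH : cqg H) (V : vectType C)
  (rho : V -> V ⊗ H) (rhoP : is_comodule rho).
Variables (n : nat) (e : n.-tuple V) (eb : basis_of fullv e).
Let u := coaction_mx e rho.
Variables (Q : 'M[C]_n) (uu : unitary_for Q u).
Variables (F : Type) (W : F -> {vspace V}) (P : F -> 'M[C]_n).
Hypotheses (PW : forall i, projects_onto e (W i) (P i))
  (PQ : forall i, Q *m P i = ctr (P i) *m Q).

Let rl : linear rho. Proof. by case: rhoP. Qed.
Let cu : corep u. Proof. exact/(comodule_corep eb rl). Qed.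

Lemma push_subcomodule (K : hopfStarAlgebra R) (f : {lrmorphism H -> K}) i :
  is_hopf_star_morphism f ->
  subcomodule (push_coaction f rho) (W i) <-> map_mx f (commutator u P i) = 0.
Proof.
move=> fm; rewrite (subcomodule_mx eb _ _ (PW i) (PQ i)).
- rewrite push_mx -/u /commutator map_mxB !map_mxM !map_sc.
  by split=> [->|/eqP]; [rewrite subrr|rewrite subr_eq0 => /eqP].
- apply/(comodule_corep eb (push_linear f rl)); rewrite push_mx; exact: corep_map.
- by rewrite push_mx; exact: unitary_map.
Qed.

Lemma stab_kernel (K : hopfStarAlgebra R) (f : {lrmorphism H -> K}) a :
  (forall i, map_mx f (commutator u P i) = 0) -> stab_mem u P a -> f a = 0.
Proof.
move=> fc /(_ (fun a => f a = 0)); apply; last first.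
  by move=> i p q; have /matrixP/(_ p q) := fc i; rewrite mxE [RHS]mxE.
split=> [|a' b' Ja Jb|k a' Ja|a' b' Jb|a' b' Ja].
- by rewrite linear0.
- by rewrite linearD /= Ja Jb addr0.
- by rewrite linearZ_LR /= Ja scaler0.
- by rewrite rmorphM /= Jb mulr0.
- by rewrite rmorphM /= Ja mul0r.
Qed.

Lemma initial_quotient : exists (K : hopfStarAlgebra R) (pi : {lrmorphism H -> K}),
  initial_stabilizing rho W pi /\ forall a, pi a = 0 <-> stab_mem u P a.
Proof.
pose J := stab_ideal P cu.
have JE a : J a = stab_mem u P a := stab_idealE P cu a.
have J1 a : J a -> tmap (qpi J) (qpi J) (comul H a) = 0.
  by rewrite JE; exact: stab_comul.
have J2 a : J a -> counit H a = 0 by rewrite JE; exact: stab_counit.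
have J3 a : J a -> J (antipode H a) by rewrite !JE; exact: stab_antipode.
have J4 a : J a -> J (star a) by rewrite !JE; exact: (stab_star cu uu PQ).
pose K := quot_hopf J1 J2 J3 J4; pose pi : {lrmorphism H -> K} := quot_pi J1 J2 J3 J4.
have pim : is_hopf_star_morphism pi := quot_pi_morphism J1 J2 J3 J4.
have pi0 a : pi a = 0 <-> stab_mem u P a by rewrite -JE; exact: quot_pi_eq0.
have pisurj : forall x, exists a, pi a = x := fun x => quot_pi_surj x.
exists K, pi; split=> //; split=> //.
- exact: cqg_surjective pim pisurj cqgH.
- move=> i; apply/push_subcomodule => //; apply/matrixP => p q; rewrite mxE [RHS]mxE.
  by apply/pi0; exact: stab_commutator.
move=> K' pi' cqgK' pim' W'.
have fc i : map_mx pi' (commutator u P i) = 0 by apply/push_subcomodule.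
have [|phi [phim phiE]] := quot_hopf_lift J1 J2 J3 J4 pim'.
  by move=> a; rewrite JE; exact: stab_kernel.
exists phi; split=> // psi psim psiE x; have [a <-] := pisurj x.
by have := psiE a; rewrite -(phiE a).
Qed.

(** By universality the explicit quotient factors through [pi], which bounds the kernel of [pi] from
    above. *)
Lemma initial_kernel (K : hopfStarAlgebra R) (pi : {lrmorphism H -> K}) a :
  initial_stabilizing rho W pi -> pi a = 0 <-> stab_mem u P a.
Proof.
move=> [cqgK pim piW piU].
split=> [pia|]; last by apply: stab_kernel => i; apply/push_subcomodule.
have [K' [pi' [[cqgK' pim' pi'W _] pi'0]]] := initial_quotient.
have [phi [_ phiE _]] := piU K' pi' cqgK' pim' pi'W.
by apply/pi'0; rewrite -[LHS]phiE /= pia linear0.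
Qed.

End InitialQuotient.

End StabilizingQuotient.

(** * Invariant vectors of a stabilizer *)

Section Duality.
Variables (R : realType) (H : hopfStarAlgebra R) (cqgH : cqg H).
Local Notation C := (R[i]).

Definition conjmx m n (y : 'M[H]_(m, n)) : 'M[H]_(m, n) := map_mx (@star _ H) y.

Lemma conjmxK m n : involutive (@conjmx m n).
Proof. by move=> y; apply/matrixP => i j; rewrite !mxE starK. Qed.

Lemma hstar_conjmx m n (y : 'M[H]_(m, n)) : hstar (conjmx y) = y^T.
Proof. by apply/matrixP => i j; rewrite !mxE starK. Qed.

Lemma trmx_scl m n p (A : 'M[C]_(m, n)) (y : 'M[H]_(n, p)) :
  (sc H A *m y)^T = y^T *m sc H A^T.
Proof.
apply/matrixP => i j; rewrite mxE sc_mulE mul_scE.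
by apply: eq_bigr => k _; rewrite !mxE.
Qed.

Lemma trmx_scr m n p (y : 'M[H]_(m, n)) (A : 'M[C]_(n, p)) :
  (y *m sc H A)^T = sc H A^T *m y^T.
Proof.
apply/matrixP => i j; rewrite mxE sc_mulE mul_scE.
by apply: eq_bigr => k _; rewrite !mxE.
Qed.

Lemma fmx_counit_sc m n (A : 'M[C]_(m, n)) : fmx (counit H) (sc H A) = A.
Proof. by rewrite -[sc H A]mulmx1 fmx_scl fmx_counit ?mulmx1 //; exact: corep_one. Qed.

Definition vecmx m n (A : 'M[C]_(m, n)) : 'cV[C]_(m * n) :=
  \col_k A (mxtens_unindex k).1 (mxtens_unindex k).2.

(* The tensor with coordinates t j * A r s in ((r, j), s).                    *)
Definition insert_vec m n (t : 'cV[C]_m) (A : 'M[C]_n) : 'cV[C]_(n * m * n) :=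
  \col_k (t (mxtens_unindex (mxtens_unindex k).1).2 0 *
    A (mxtens_unindex (mxtens_unindex k).1).1 (mxtens_unindex k).2).

Lemma vecmx_mulE m (y : 'M[H]_m) (X : 'M[C]_m) i j :
  (tensmx y (conjmx y) *m sc H (vecmx X)) (mxtens_index (i, j)) 0 =
  (y *m sc H X *m hstar y) i j.
Proof.
rewrite mul_scE sum_tensor_index exchange_big [RHS]mxE; apply: eq_bigr => s _.
rewrite mul_scE mulr_suml; apply: eq_bigr => r _.
rewrite tensmxE [vecmx X _ 0]mxE mxtens_indexK /= -scalerAl.
by rewrite [hstar y s j]mxE [y^T s j]mxE [conjmx y j s]mxE.
Qed.

Lemma insert_mulE m p (y : 'M[H]_m) (z : 'M[H]_p) (t : 'cV[C]_m) (A : 'M[C]_p) i j k :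
  (tensmx (tensmx z y) (conjmx z) *m sc H (insert_vec t A))
     (mxtens_index (mxtens_index (i, k), j)) 0 =
  \sum_s \sum_r (A r s *: (z i r * (y *m sc H t) k 0)) * star (z j s).
Proof.
rewrite [LHS]mul_scE sum_tensor_index exchange_big /=; apply: eq_bigr => s _.
rewrite sum_tensor_index; apply: eq_bigr => r _.
rewrite mul_scE mulr_sumr scaler_sumr mulr_suml; apply: eq_bigr => k' _.
rewrite mxE !mxtens_indexK /= !tensmxE mxE -scalerAr scalerA -scalerAl.
by rewrite [t k' 0 * _]mulrC.
Qed.

Lemma tens_mulE m p (y : 'M[H]_m) (z : 'M[H]_p) (s : 'cV[C]_m) (t : 'cV[C]_p) i j :
  (tensmx y z *m sc H (tensmx s t : 'cV_(m * p))) (mxtens_index (i, j)) 0 =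
  (y *m sc H s) i 0 * (z *m sc H t) j 0.
Proof.
rewrite !mul_scE sum_tensor_index mulr_suml; apply: eq_bigr => i' _.
rewrite mulr_sumr; apply: eq_bigr => j' _; rewrite -scalerAl -scalerAr scalerA.
by rewrite tensmxE mxE !mxtens_indexK /= !ord1.
Qed.

Variables (n : nat) (u : 'M[H]_n) (Q : 'M[C]_n) (F : Type) (P : F -> 'M[C]_n).
Hypotheses (cu : corep u) (uu : unitary_for Q u).

(* G y is the space of the invariant vectors of y under the stabilizer that    *)
(* are known to be constructible; the theorem is that these are all of them.  *)
Variable G : forall m, 'M[H]_m -> 'cV[C]_m -> Prop.
Hypotheses
  (G0 : forall m (y : 'M[H]_m), G y 0)
  (GD : forall m (y : 'M[H]_m) s t, G y s -> G y t -> G y (s + t))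
  (GZ : forall m (y : 'M[H]_m) k t, G y t -> G y (k *: t))
  (G_intertwiner : forall m p (y : 'M[H]_m) (z : 'M[H]_p) (A : 'M[C]_(m, p)) t,
     corep y -> corep z -> y *m sc H A = sc H A *m z -> G z t -> G y (A *m t))
  (G_tens : forall m p (y : 'M[H]_m) (z : 'M[H]_p) s t,
     corep y -> corep z -> G y s -> G z t -> G (tensmx y z) (tensmx s t))
  (G_conj : forall m (y : 'M[H]_m) t, corep y -> G y t ->
     G (conjmx y) (map_mx Num.conj t))
  (G_one : G (1%:M : 'M[H]_1) 1%:M)
  (G_insert : forall m p (y : 'M[H]_m) (z : 'M[H]_p) (S : 'M[C]_p) t,
     corep y -> corep z -> unitary_for S z -> G y t ->
     G (tensmx (tensmx z y) (conjmx z)) (insert_vec t (invmx S)))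
  (G_proj : forall i, G (tensmx u (conjmx u)) (vecmx (P i *m invmx Q)))
  (G_stab : forall m (y : 'M[H]_m) t i, corep y -> G y t ->
     stab_mem u P ((y *m sc H t - sc H t) i 0)).

Lemma G_sum m (y : 'M[H]_m) I (r : seq I) (E : I -> 'cV[C]_m) :
  (forall i, G y (E i)) -> G y (\sum_(i <- r) E i).
Proof. by move=> GE; apply: (big_ind (G y)) => //; exact: GD. Qed.

(** The relation on [A] says that (x, t) -> x^T A t is an invariant pairing of y with z.
    Orthogonality is tested by all such pairings instead of one inner product, so that it passes to
    intertwiners and tensor products. *)
Definition perp m (y : 'M[H]_m) (x : 'cV[C]_m) : Prop :=
  forall p (z : 'M[H]_p) (t : 'cV[C]_p) (A : 'M[C]_(m, p)), corep z -> G z t ->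
    y^T *m sc H A *m z = sc H A -> x^T *m A *m t = 0.

Lemma perpD m (y : 'M[H]_m) s t : perp y s -> perp y t -> perp y (s + t).
Proof.
move=> ys yt p z w A cz Gw yA.
by rewrite linearD /= !mulmxDl (ys p z w A) // (yt p z w A) // addr0.
Qed.

Lemma perpZ m (y : 'M[H]_m) k t : perp y t -> perp y (k *: t).
Proof.
move=> yt p z w A cz Gw yA.
by rewrite linearZ /= -!scalemxAl (yt p z w A) // scaler0.
Qed.

Lemma perp_intertwiner m p (y : 'M[H]_m) (z : 'M[H]_p) (A : 'M[C]_(m, p)) t :
  y *m sc H A = sc H A *m z -> perp z t -> perp y (A *m t).
Proof.
move=> yA zt q w s B cw Gs yB; rewrite trmx_mul -(mulmxA t^T); apply: (zt q w) => //.
rewrite scM !mulmxA -trmx_scl -yA trmx_scr -!mulmxA; congr (_ *m _).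
by rewrite mulmxA.
Qed.

(** The invariant form of the conjugate of y is an invariant pairing of y with its conjugate, and it
    is positive on x and conj x. *)
Lemma perp_G m (y : 'M[H]_m) x : corep y -> G y x -> perp y x -> x = 0.
Proof.
move=> cy Gx yx; have cy' : corep (conjmx y) := corep_conj cy.
have [S [Sp yS _]] := cqg_unitary cqgH cy'.
apply/eqP; apply: contraT => x0; have [_ Spos] := Sp.
have := Spos (map_mx Num.conj x) _.
rewrite (_ : ctr _ = x^T); last by apply/matrixP => i j; rewrite !mxE conjCK.
rewrite (yx _ (conjmx y) (map_mx Num.conj x) S) //; last by rewrite -hstar_conjmx.
  rewrite mxE ltxx; apply; apply: contraNneq x0 => x0.
  by rewrite -[x]map_mxCK x0 map_mx0.
exact: G_conj.
Qed.

(** Unitarity of the conjugate of y turns an invariant pairing with a vector of [G] into an inner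
    product with a vector of [G y]. Hence the orthogonal complement of [G y] for a single form lies
    in [perp]. *)
Lemma perp_decomposition m (y : 'M[H]_m) x : corep y ->
  exists x1 x2, [/\ x = x1 + x2, G y x1 & perp y x2].
Proof.
move=> cy; have cy' : corep (conjmx y) := corep_conj cy.
have [S [Sp yS yS']] := cqg_unitary cqgH cy'; rewrite hstar_conjmx in yS yS'.
have [r [B [Binj BG GB]]] := column_basis (G y).
have Scp := posdef_conj Sp; set Sc := map_mx _ S in Scp.
have Sh : S^T = Sc.
  by case: Sp => Sh _; rewrite /Sc -{2}Sh; apply/matrixP => i j; rewrite !mxE conjCK.
have BE : forall c : 'cV_r, G y (B *m c).
  move=> c; suff -> : B *m c = \sum_k c k 0 *: col k B by apply: G_sum => k; exact: GZ.
  by apply/matrixP => i j; rewrite ord1 mxE summxE; apply: eq_bigr => k _; rewrite !mxE mulrC.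
have [D [DG DB]] : exists D, (forall x, G y (D *m x)) /\ ctr B *m Sc *m D = ctr B *m Sc.
  exists (oproj Sc B); split; last exact: oproj_orth.
  by move=> x'; rewrite /oproj -!mulmxA; exact: BE.
exists (D *m x), (x - D *m x); split; [by rewrite addrC subrK|exact: DG|].
move=> p z t A cz Gt yA.
have : G y (map_mx Num.conj (invmx S *m A *m t)).
  rewrite -[y]conjmxK; apply: G_conj => //; apply: G_intertwiner Gt => //.
  by rewrite !scM -{1}yA !mulmxA yS'.
move=> /GB[c cE].
have tE : A *m t = S *m map_mx Num.conj (B *m c).
  by rewrite -cE map_mxCK !mulmxA mulmxV ?mul1mx //; exact: posdef_unit.
rewrite -mulmxA tE mulmxA; apply: trmx_inj; rewrite trmx0 !trmx_mul trmxK Sh.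
have -> : (map_mx Num.conj (B *m c))^T = ctr c *m ctr B.
  by rewrite map_trmx -[LHS]/(ctr (B *m c)) ctrM.
by rewrite -!mulmxA (mulmxA (ctr B)) mulmxBr [ctr B *m Sc *m (_ *m _)]mulmxA DB subrr mulmx0.
Qed.

(** The projection D onto the subcomodule generated by x1 + x2 satisfies A D = 0 and preserves [G]
    and [perp]. Now x1 - D x1 = D x2 - x2 lies in both, so that D fixes x1. *)
Lemma split_relation m k (y : 'M[H]_m) (x1 x2 : 'cV[C]_m) (A : 'M[C]_(k, m)) :
  corep y -> G y x1 -> perp y x2 -> sc H A *m y *m sc H (x1 + x2) = 0 ->
  A *m x1 = 0.
Proof.
move=> cy Gx px yA; have [S uy] := cqg_unitary cqgH cy.
pose X (s : 'cV[C]_m) := exists chi, s = fmx chi y *m (x1 + x2).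
have [|D [[_ _ yD] DX AD]] := @stable_projection R H m S y X cy uy.
  move=> psi s [chi ->]; have [phi phiE] := fmxM psi chi cy.
  by exists phi; rewrite mulmxA phiE.
have Dx : D *m (x1 + x2) = x1 + x2.
  by apply: DX; exists (counit H); rewrite fmx_counit // mul1mx.
have AD0 : A *m D = 0.
  rewrite -[LHS]fmx_counit_sc scM AD.
    by rewrite fmx0.
  by move=> s [chi ->]; rewrite -scM mulmxA -fmx_scl -fmx_scr yA fmx0 sc0.
suff -> : x1 = D *m x1 by rewrite mulmxA AD0 mul0mx.
apply/eqP; rewrite -subr_eq0; apply/eqP; apply: (perp_G cy).
  apply: GD => //; rewrite -scaleN1r; apply: GZ.
  exact: (G_intertwiner cy cy yD Gx).
have -> : x1 - D *m x1 = D *m x2 - x2.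
  by apply/eqP; rewrite subr_eq addrAC eq_sym subr_eq addrC -mulmxDr Dx.
apply: perpD; first exact: (perp_intertwiner yD px).
by rewrite -scaleN1r; exact: perpZ.
Qed.

(** By [G_stab] these coefficients are invariant under right translation by the stabilizer. *)
Definition good_coef (b : H) : Prop := exists m (y : 'M[H]_m) (l : 'rV[C]_m) t,
  [/\ corep y, G y t & b = (sc H l *m y *m sc H t) 0 0].

Definition perp_coef (b : H) : Prop := exists m (y : 'M[H]_m) (l : 'rV[C]_m) t,
  [/\ corep y, perp y t & b = (sc H l *m y *m sc H t) 0 0].

Lemma block_coef m p (y : 'M[H]_m) (z : 'M[H]_p) (l : 'rV[C]_m) (l' : 'rV[C]_p)
    (s : 'cV[C]_m) (t : 'cV[C]_p) :
  sc H (row_mx l l') *m block_mx y 0 0 z *m sc H (col_mx s t) =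
  sc H l *m y *m sc H s + sc H l' *m z *m sc H t.
Proof.
rewrite /sc map_row_mx map_col_mx -!/(sc H _) mul_row_block !mulmx0 addr0 add0r.
by rewrite mul_row_col.
Qed.

Lemma block_inl m p (y : 'M[H]_m) (z : 'M[H]_p) :
  block_mx y 0 0 z *m sc H (col_mx 1%:M 0) = sc H (col_mx 1%:M 0) *m y.
Proof.
rewrite /sc !map_col_mx -!/(sc H _) !sc1 !sc0 mul_block_col mul_col_mx.
by rewrite !mulmx0 !mulmx1 mul1mx mul0mx !addr0.
Qed.

Lemma block_inr m p (y : 'M[H]_m) (z : 'M[H]_p) :
  block_mx y 0 0 z *m sc H (col_mx 0 1%:M) = sc H (col_mx 0 1%:M) *m z.
Proof.
rewrite /sc !map_col_mx -!/(sc H _) !sc1 !sc0 mul_block_col mul_col_mx.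
by rewrite !mulmx0 !mulmx1 mul1mx mul0mx !add0r.
Qed.

Lemma good_coefD b c : good_coef b -> good_coef c -> good_coef (b + c).
Proof.
move=> [m [y [l [s [cy Gs ->]]]]] [p [z [l' [t [cz Gt ->]]]]].
have cyz := corep_block cy cz.
exists (m + p)%N, (block_mx y 0 0 z), (row_mx l l'), (col_mx s t); split=> //.
  have -> : col_mx s t = col_mx 1%:M 0 *m s + col_mx 0 1%:M *m t.
    by rewrite !mul_col_mx !mul1mx !mul0mx add_col_mx addr0 add0r.
  by apply: GD; [apply: G_intertwiner (block_inl y z) Gs|
    apply: G_intertwiner (block_inr y z) Gt].
by rewrite block_coef [RHS]mxE.
Qed.

Lemma perp_coefD b c : perp_coef b -> perp_coef c -> perp_coef (b + c).
Proof.
move=> [m [y [l [s [cy ps ->]]]]] [p [z [l' [t [cz pt ->]]]]].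
have cyz := corep_block cy cz.
exists (m + p)%N, (block_mx y 0 0 z), (row_mx l l'), (col_mx s t); split=> //.
  have -> : col_mx s t = col_mx 1%:M 0 *m s + col_mx 0 1%:M *m t.
    by rewrite !mul_col_mx !mul1mx !mul0mx add_col_mx addr0 add0r.
  by apply: perpD; [apply: perp_intertwiner (block_inl y z) ps|
    apply: perp_intertwiner (block_inr y z) pt].
by rewrite block_coef [RHS]mxE.
Qed.

Lemma good_coefZ k b : good_coef b -> good_coef (k *: b).
Proof.
move=> [m [y [l [s [cy Gs ->]]]]]; exists m, y, (k *: l), s; split=> //.
by rewrite -!mulmxA !sc_mulE scaler_sumr; apply: eq_bigr => i _; rewrite [(k *: l) 0 i]mxE scalerA.
Qed.

Lemma perp_coefZ k b : perp_coef b -> perp_coef (k *: b).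
Proof.
move=> [m [y [l [s [cy Gs ->]]]]]; exists m, y, (k *: l), s; split=> //.
by rewrite -!mulmxA !sc_mulE scaler_sumr; apply: eq_bigr => i _; rewrite [(k *: l) 0 i]mxE scalerA.
Qed.

Lemma coef_split a : exists b c, [/\ good_coef b, perp_coef c & a = b + c].
Proof.
have [m [y [l [x [cy ->]]]]] := matrix_coefficient a.
have [x1 [x2 [-> Gx px]]] := perp_decomposition x cy.
exists ((sc H l *m y *m sc H x1) 0 0), ((sc H l *m y *m sc H x2) 0 0); split.
- by exists m, y, l, x1.
- by exists m, y, l, x2.
- by rewrite scD mulmxDr mxE.
Qed.

(** The difference of the two expressions of [a] is a relation on the direct sum of y and z at the
    vector with components s and -t; [split_relation] leaves l s = 0. *)
Lemma good_perp_counit a : good_coef a -> perp_coef a -> counit H a = 0.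
Proof.
move=> [m [y [l [s [cy Gs aE]]]]] [p [z [l' [t [cz pt aE']]]]].
have cyz := corep_block cy cz.
have Gs' : G (block_mx y 0 0 z) (col_mx s 0).
  have -> : col_mx s 0 = col_mx (1%:M : 'M[C]_m) (0 : 'M[C]_(p, m)) *m s.
    by rewrite mul_col_mx mul1mx mul0mx.
  exact: (G_intertwiner cyz cy (block_inl y z) Gs).
have pt' : perp (block_mx y 0 0 z) (col_mx 0 (- t)).
  have -> : col_mx 0 (- t) = col_mx (0 : 'M[C]_(m, p)) (1%:M : 'M[C]_p) *m (- t).
    by rewrite mul_col_mx mul1mx mul0mx.
  by apply: (perp_intertwiner (block_inr y z)); rewrite -scaleN1r; exact: perpZ.
have := split_relation (A := row_mx l l') cyz Gs' pt' _.
rewrite add_col_mx addr0 add0r block_coef mul_row_col mulmx0 addr0 => ls.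
have -> : counit H a = (l *m s) 0 0.
  have := fmx_counit cy => /(congr1 (fun M => (l *m M *m s) 0 0)).
  by rewrite mulmx1 -fmx_scl -fmx_scr mxE -aE.
rewrite ls; first by rewrite mxE.
by apply/matrixP => i j; rewrite !ord1 mxE -aE scN mulmxN; rewrite [X in _ + X]mxE -aE' subrr mxE.
Qed.

Lemma tens_coefE m p (y : 'M[H]_m) (z : 'M[H]_p) (l : 'rV[C]_m) (l' : 'rV[C]_p)
    (s : 'cV[C]_m) (t : 'cV[C]_p) :
  (sc H (tensmx l l' : 'rV_(m * p)) *m tensmx y z *m sc H (tensmx s t : 'cV_(m * p))) 0 0 =
  (sc H l *m y *m sc H s) 0 0 * (sc H l' *m z *m sc H t) 0 0.
Proof.
rewrite -!mulmxA !sc_mulE sum_tensor_index mulr_suml; apply: eq_bigr => i _.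
rewrite mulr_sumr; apply: eq_bigr => j _; rewrite -scalerAl -scalerAr scalerA.
by rewrite [tensmx l l' _ _]mxE !mxtens_indexK /= !ord1 tens_mulE.
Qed.

Lemma good_coefM b c : good_coef b -> good_coef c -> good_coef (b * c).
Proof.
move=> [m [y [l [s [cy Gs ->]]]]] [p [z [l' [t [cz Gt ->]]]]].
exists (m * p)%N, (tensmx y z), (tensmx l l'), (tensmx s t); split.
- exact: corep_tens.
- exact: G_tens.
- by rewrite tens_coefE.
Qed.

Lemma perp_tens m p (y : 'M[H]_m) (z : 'M[H]_p) s t : corep y -> corep z ->
  perp y s -> G z t -> perp (tensmx y z) (tensmx s t).
Proof.
move=> cy cz ys Gt q w r A cw Gr yzA.
(* Regrouping the indices turns a pairing of y ⊗ z with w into one of y with z ⊗ w. In both, the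
   entries of y, z and w are multiplied in this order, which is why the factor from [G] stands on
   the right. *)
pose B : 'M[C]_(m, p * q) := \matrix_(i, k)
  A (mxtens_index (i, (mxtens_unindex k).1)) (mxtens_unindex k).2.
have BE i j k : B i (mxtens_index (j, k)) = A (mxtens_index (i, j)) k.
  by rewrite mxE mxtens_indexK.
have yB : y^T *m sc H B *m tensmx z w = sc H B.
  apply/matrixP => i a; case: (mxtens_indexP a) => j k.
  have /matrixP/(_ (mxtens_index (i, j)) k) := yzA.
  rewrite [RHS]mxE [sc H B _ _]mxE BE => <-.
  rewrite mxE sum_tensor_index exchange_big /= [RHS]mxE; apply: eq_bigr => k' _.
  rewrite [in RHS]mul_scE sum_tensor_index exchange_big mulr_suml.
  apply: eq_bigr => j' _; rewrite mul_scE tensmxE !mulr_suml; apply: eq_bigr => i' _.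
  by rewrite !mxE !mxtens_indexK /= !scalerAl !mulrA.
have := ys _ (tensmx z w) (tensmx t r) B (corep_tens cz cw) (G_tens cz cw Gt Gr) yB.
move=> /matrixP/(_ 0 0) sB; apply/matrixP => a b; rewrite !ord1 -[RHS]sB.
rewrite !mxE sum_tensor_index exchange_big /=; apply: eq_bigr => k _.
rewrite mxE sum_tensor_index exchange_big mulr_suml; apply: eq_bigr => j _.
rewrite mxE !mulr_suml; apply: eq_bigr => i _.
rewrite mxE [tensmx s t _ _]mxE [tensmx t r _ _]mxE !mxtens_indexK /= BE !mxE !ord1.
by rewrite -!mulrA; congr (_ * _); rewrite mulrCA.
Qed.

Lemma perp_coefM b c : perp_coef b -> good_coef c -> perp_coef (b * c).
Proof.
move=> [m [y [l [s [cy ps ->]]]]] [p [z [l' [t [cz Gt ->]]]]].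
exists (m * p)%N, (tensmx y z), (tensmx l l'), (tensmx s t); split.
- exact: corep_tens.
- exact: perp_tens.
- by rewrite tens_coefE.
Qed.

Definition good_augmented (b : H) : Prop := good_coef b /\ counit H b = 0.

(** The left ideal generated by [good_augmented], encoded by its induction principle. *)
Definition good_ideal (a : H) : Prop := forall J : H -> Prop,
  J 0 -> (forall b c, J b -> J c -> J (b + c)) ->
  (forall h b, good_augmented b -> J (h * b)) -> J a.

(** In a generator h b, the constructible part of h times b is again constructible of counit 0, and
    the orthogonal part times b is orthogonal. *)
Lemma good_ideal_split a : good_ideal a ->
  exists b c, [/\ perp_coef b, good_augmented c & a = b + c].
Proof.
move=> /(_ (fun a => exists b c, [/\ perp_coef b, good_augmented c & a = b + c])); apply.
- exists 0, 0; split; [|split|by rewrite addr0]; last by rewrite linear0.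
    exists 0, 1%:M, 0, 0; split; [exact: corep_one| |by rewrite !sc0 mulmx0 mxE].
    by move=> p z t A _ _ _; rewrite trmx0 !mul0mx.
  exists 0, 1%:M, 0, 0; split; [exact: corep_one|exact: G0|by rewrite !sc0 mulmx0 mxE].
- move=> _ _ [b [c [pb [gc c0] ->]]] [b' [c' [pb' [gc' c0'] ->]]].
  exists (b + b'), (c + c'); split; [exact: perp_coefD|split|exact: addrACA].
    exact: good_coefD.
  by rewrite linearD /= c0 c0' addr0.
- move=> h b [gb b0]; have [c [d [gc pd ->]]] := coef_split h.
  exists (d * b), (c * b); split; [exact: perp_coefM|split|by rewrite mulrDl addrC].
    exact: good_coefM.
  by rewrite rmorphM /= b0 mulr0.
Qed.

Lemma entry_coef m (y : 'M[H]_m) (t : 'cV[C]_m) k :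
  (y *m sc H t) k 0 = (sc H (delta_mx 0 k : 'rV[C]_m) *m y *m sc H t) 0 0 :> H.
Proof.
rewrite -mulmxA sc_mulE (bigD1 k) //= [delta_mx _ _ _ _]mxE !eqxx scale1r.
rewrite big1 ?addr0 // => j /negPf jk.
by rewrite [delta_mx _ _ _ _]mxE jk andbF scale0r.
Qed.

Lemma good_entry m (y : 'M[H]_m) (t : 'cV[C]_m) k : corep y -> G y t ->
  good_coef ((y *m sc H t) k 0) /\ counit H ((y *m sc H t) k 0) = t k 0.
Proof.
move=> cy Gt; split; first by exists m, y, (delta_mx 0 k), t; split=> //; exact: entry_coef.
have := fmx_scr (counit H) y t; rewrite fmx_counit // mul1mx => /matrixP/(_ k 0).
by rewrite mxE.
Qed.

Lemma good_coef1 : good_coef 1.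
Proof.
exists 1, 1%:M, 1%:M, 1%:M; split; [exact: corep_one|exact: G_one|].
by rewrite mulmx1 sc1 mulmx1 mxE.
Qed.

Lemma good_coef_sum I (r : seq I) (E : I -> H) :
  (forall i, good_coef (E i)) -> good_coef (\sum_(i <- r) E i).
Proof.
move=> gE; apply: (big_ind good_coef) => //; last exact: good_coefD.
by rewrite -(scale0r (1 : H)); exact: good_coefZ good_coef1.
Qed.

(** The entries are combinations of coefficients of z ⊗ y ⊗ conj z at the vector that inserts [t]
    between the two legs of the invariant tensor [invmx S]. *)
Lemma good_insert p (z : 'M[H]_p) (S : 'M[C]_p) b i j : corep z -> unitary_for S z ->
  good_augmented b -> good_augmented ((z *m (sc H (invmx S) *m b%:M) *m hstar z) i j).
Proof.
move=> cz uz [[m [y [l [t [cy Gt bE]]]]] b0]; split; last first.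
  rewrite mxE linear_sum big1 // => s _; rewrite rmorphM /= mxE rmorph_sum big1 ?mul0r // => r _.
  rewrite rmorphM /= sc_mulE rmorph_sum big1 ?mulr0 // => k _ /=.
  rewrite linearZ_LR [b%:M _ _]mxE rmorphMn /= b0 mul0rn.
  exact: scaler0.
have zcz := corep_conj cz; pose Y := tensmx (tensmx z y) (conjmx z).
have cY : corep Y by apply: corep_tens => //; exact: corep_tens.
pose T := insert_vec t (invmx S).
have GT : G Y T := G_insert cy cz uz Gt.
suff -> : (z *m (sc H (invmx S) *m b%:M) *m hstar z) i j =
    \sum_k l 0 k *: (Y *m sc H T) (mxtens_index (mxtens_index (i, k), j)) 0.
  by apply: good_coef_sum => k; apply: good_coefZ; exact: (good_entry _ cY GT).1.
under eq_bigr => k _ do rewrite insert_mulE scaler_sumr.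
rewrite mxE exchange_big; apply: eq_bigr => s _.
under eq_bigr => k _ do rewrite scaler_sumr.
rewrite mxE exchange_big /= mulr_suml; apply: eq_bigr => r _.
rewrite sc_mulE (bigD1 s) //= [b%:M _ _]mxE eqxx mulr1n big1 ?addr0; last first.
  by move=> k /negPf ks; rewrite [b%:M _ _]mxE ks scaler0.
rewrite bE -mulmxA sc_mulE -scalerAr mulr_sumr scaler_sumr mulr_suml [hstar z s j]mxE [z^T s j]mxE.
apply: eq_bigr => k _; rewrite -scalerAr scalerA -!scalerAl scalerA.
by rewrite mulrC.
Qed.

Lemma good_idealD a b : good_ideal a -> good_ideal b -> good_ideal (a + b).
Proof. by move=> Ia Ib J J0 JD JM; exact: (JD _ _ (Ia J J0 JD JM) (Ib J J0 JD JM)). Qed.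

Lemma good_ideal0 : good_ideal 0.
Proof. by move=> J J0. Qed.

Lemma good_ideal_aug h b : good_augmented b -> good_ideal (h * b).
Proof. by move=> gb J _ _; apply. Qed.

Lemma good_ideal_mull h a : good_ideal a -> good_ideal (h * a).
Proof.
move=> /(_ (fun a => good_ideal (h * a))); apply.
- by rewrite mulr0; exact: good_ideal0.
- by move=> b c; rewrite mulrDr; exact: good_idealD.
- by move=> h' b gb; rewrite mulrA; exact: good_ideal_aug.
Qed.

Lemma good_ideal_sum I (r : seq I) (E : I -> H) :
  (forall i, good_ideal (E i)) -> good_ideal (\sum_(i <- r) E i).
Proof.
move=> gE; apply: (big_ind good_ideal) => [|b c|i _];
  [exact: good_ideal0|exact: good_idealD|exact: gE].
Qed.

Lemma good_aug_mulr b c : good_augmented b -> good_ideal (b * c).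
Proof.
move=> gb; elim/entry_ind: c => [|c d Ic Id|k c Ic|p w i j cw].
- by rewrite mulr0; exact: good_ideal0.
- by rewrite mulrDr; exact: good_idealD.
- by rewrite -scalerAr -mulr_algl; exact: good_ideal_mull.
have cz : corep (conjmx w) := corep_conj cw.
have [S uz] := cqg_unitary cqgH cz; have [Sp zS _] := uz.
(* With z the conjugate of w, z^* S z S^-1 = 1. So b passes to the right of z^* once it is
   conjugated by z, and the entries of z^* are those of w. *)
have : b%:M *m hstar (conjmx w) = hstar (conjmx w) *m sc H S *m
    (conjmx w *m (sc H (invmx S) *m b%:M) *m hstar (conjmx w)).
  rewrite !mulmxA zS -[_ *m sc H (invmx S)]scM mulmxV ?sc1 ?mul1mx //.
  exact: posdef_unit.
move=> /matrixP/(_ j i); rewrite mul_scalar_mx mxE [hstar _ j i]mxE mxE mxE starK => ->.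
rewrite mxE; apply: good_ideal_sum => k; apply: good_ideal_aug.
exact: good_insert.
Qed.

Lemma good_ideal_mulr a c : good_ideal a -> good_ideal (a * c).
Proof.
move=> /(_ (fun a => good_ideal (a * c))); apply.
- by rewrite mul0r; exact: good_ideal0.
- by move=> b d; rewrite mulrDl; exact: good_idealD.
- by move=> h b gb; rewrite -mulrA; apply: good_ideal_mull; exact: good_aug_mulr.
Qed.

Lemma stab_good_ideal a : stab_mem u P a -> good_ideal a.
Proof.
apply; first split.
- exact: good_ideal0.
- exact: good_idealD.
- by move=> k b Ib; rewrite -mulr_algl; exact: good_ideal_mull.
- exact: good_ideal_mull.
- by move=> b c; exact: good_ideal_mulr.
move=> i p q; pose X := P i *m invmx Q; have [Qp uQ uQ'] := uu.
pose D := u *m sc H X *m hstar u - sc H X.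
(* The entries of D = u X u^* - X are constructible of counit 0 by [G_proj]. *)
have cE : commutator u P i = D *m (sc H Q *m u).
  rewrite /D mulmxBl !mulmxA -[_ *m hstar u *m _]mulmxA -[_ *m (_ *m _) *m u]mulmxA uQ.
  rewrite -mulmxA -!scM /X -mulmxA mulVmx ?mulmx1 //; exact: posdef_unit.
rewrite cE mxE; apply: good_ideal_sum => k; apply: good_aug_mulr.
have cY := corep_tens cu (corep_conj cu).
have [gY eY] := good_entry (mxtens_index (p, k)) cY (G_proj i).
have DE : D p k = (tensmx u (conjmx u) *m sc H (vecmx X)) (mxtens_index (p, k)) 0 - X p k *: 1.
  by rewrite vecmx_mulE /D mxBE [sc H X p k]mxE.
rewrite DE; split.
  rewrite -scaleN1r scalerA; apply: good_coefD; [exact: gY|apply: good_coefZ].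
  exact: good_coef1.
rewrite linearB linearZ_LR /= rmorph1 eY mxE mxtens_indexK /=.
by rewrite [_ *: _]mulr1 subrr.
Qed.

Theorem stabilizer_duality m (y : 'M[H]_m) (x : 'cV[C]_m) : corep y ->
  (forall i, stab_mem u P ((y *m sc H x - sc H x) i 0)) -> G y x.
Proof.
move=> cy; have [x1 [x2 [-> Gx px]]] := perp_decomposition x cy => xI.
suff -> : x2 = 0 by rewrite addr0.
apply/matrixP => i j; rewrite ord1 mxE.
have [I0 ID IZ _ _] := stab_mem_ideal u P.
have : stab_mem u P ((y *m sc H x2 - sc H x2) i 0).
  have -> : y *m sc H x2 - sc H x2 = (y *m sc H (x1 + x2) - sc H (x1 + x2)) +
      (-1) *: (y *m sc H x1 - sc H x1).
    by rewrite scaleN1r !scD mulmxDr opprD addrACA [X in _ = X - _]addrC addrK.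
  rewrite mxE; apply: ID => //; rewrite mxE mulN1r -scaleN1r; apply: IZ.
  exact: G_stab.
move=> /stab_good_ideal/good_ideal_split[b [c [pb [gc c0]]]].
rewrite mxBE [sc H x2 i 0]mxE => E.
have : counit H (x2 i 0 *: 1 + c) = 0.
  apply: good_perp_counit.
    by apply: good_coefD => //; apply: good_coefZ; exact: good_coef1.
  have -> : x2 i 0 *: 1 + c = (y *m sc H x2) i 0 + (-1) *: b.
    have -> : (y *m sc H x2) i 0 = b + c + x2 i 0 *: 1 by rewrite -E subrK.
    by rewrite scaleN1r -[b + c + _]addrA [b + _]addrC addrK addrC.
  apply: perp_coefD; last exact: perp_coefZ.
  by exists m, y, (delta_mx 0 i), x2; split=> //; exact: entry_coef.
by rewrite linearD linearZ_LR /= rmorph1 c0 addr0 => <-; rewrite [_ *: _]mulr1.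
Qed.

End Duality.

(** * Rational families of invariant vectors *)

Section RegularFunctions.
Variables (R : realType) (c : nat).
Local Notation C := (R[i]).
Local Notation pt := 'rV[R]_c.

Definition polynomial_fun (g : pt -> R) : Prop :=
  exists p : mpoly.mpoly c R, forall x, g x = mpoly.meval (fun k => x 0 k) p.

Lemma polynomial_fun_cst a : polynomial_fun (fun=> a).
Proof. by exists (mpoly.mpolyC c a) => x; rewrite mpoly.mevalC. Qed.

Lemma polynomial_funD f g : polynomial_fun f -> polynomial_fun g ->
  polynomial_fun (fun x => f x + g x).
Proof. by move=> [p pE] [q qE]; exists (p + q) => x; rewrite mpoly.mevalD pE qE. Qed.

Lemma polynomial_funM f g : polynomial_fun f -> polynomial_fun g ->
  polynomial_fun (fun x => f x * g x).
Proof. by move=> [p pE] [q qE]; exists (p * q) => x; rewrite mpoly.mevalM pE qE. Qed.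

(* Everywhere defined real rational functions.                                *)
Definition real_regular (f : pt -> R) : Prop := exists p q,
  [/\ polynomial_fun p, polynomial_fun q, forall x, q x != 0
    & forall x, f x = p x / q x].

Lemma real_regular_poly p : polynomial_fun p -> real_regular p.
Proof.
move=> pp; exists p, (fun=> 1); split=> // [|x]; last by rewrite divr1.
exact: polynomial_fun_cst.
Qed.

Lemma real_regularD f g : real_regular f -> real_regular g ->
  real_regular (fun x => f x + g x).
Proof.
move=> [p [q [pp pq q0 fE]]] [p' [q' [pp' pq' q'0 gE]]].
exists (fun x => p x * q' x + p' x * q x), (fun x => q x * q' x); split.
- by apply: polynomial_funD; apply: polynomial_funM.
- exact: polynomial_funM.
- by move=> x; rewrite mulf_neq0.
- by move=> x; rewrite fE gE addf_div.
Qed.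

Lemma real_regularM f g : real_regular f -> real_regular g ->
  real_regular (fun x => f x * g x).
Proof.
move=> [p [q [pp pq q0 fE]]] [p' [q' [pp' pq' q'0 gE]]].
exists (fun x => p x * p' x), (fun x => q x * q' x); split.
- exact: polynomial_funM.
- exact: polynomial_funM.
- by move=> x; rewrite mulf_neq0.
- by move=> x; rewrite fE gE mulf_div.
Qed.

Lemma real_regularN f : real_regular f -> real_regular (fun x => - f x).
Proof.
move=> rf; rewrite (_ : (fun x => _) = (fun x => (-1) * f x)).
  by apply: real_regularM => //; apply/real_regular_poly/polynomial_fun_cst.
by apply: funext => x; rewrite mulN1r.
Qed.

Lemma real_regularV f : real_regular f -> (forall x, f x != 0) ->
  real_regular (fun x => (f x)^-1).
Proof.
move=> [p [q [pp pq q0 fE]]] f0; exists q, p; split=> // x; last by rewrite fE invf_div.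
by have := f0 x; rewrite fE mulf_eq0 negb_or => /andP[].
Qed.

Definition regular (f : pt -> C) : Prop :=
  real_regular (fun x => complex.Re (f x)) /\ real_regular (fun x => complex.Im (f x)).

Lemma regular_cst a : regular (fun=> a).
Proof. by split; apply/real_regular_poly/polynomial_fun_cst. Qed.

Lemma regularD f g : regular f -> regular g -> regular (fun x => f x + g x).
Proof.
move=> [f1 f2] [g1 g2]; split.
  rewrite (_ : (fun x => _) = (fun x => complex.Re (f x) + complex.Re (g x))).
    exact: real_regularD.
  by apply: funext => x; case: (f x) => a b; case: (g x) => a' b'.
rewrite (_ : (fun x => _) = (fun x => complex.Im (f x) + complex.Im (g x))).
  exact: real_regularD.
by apply: funext => x; case: (f x) => a b; case: (g x) => a' b'.
Qed.

Lemma regularM f g : regular f -> regular g -> regular (fun x => f x * g x).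
Proof.
move=> [f1 f2] [g1 g2]; split.
  rewrite (_ : (fun x => _) = (fun x => complex.Re (f x) * complex.Re (g x)
     + - (complex.Im (f x) * complex.Im (g x)))).
    by apply: real_regularD; [|apply: real_regularN]; exact: real_regularM.
  by apply: funext => x; case: (f x) => a b; case: (g x) => a' b'.
rewrite (_ : (fun x => _) = (fun x => complex.Re (f x) * complex.Im (g x)
     + complex.Im (f x) * complex.Re (g x))).
  by apply: real_regularD; exact: real_regularM.
by apply: funext => x; case: (f x) => a b; case: (g x) => a' b'.
Qed.

Lemma regular_conj f : regular f -> regular (fun x => Num.conj (f x)).
Proof.
move=> [f1 f2]; split.
  rewrite (_ : (fun x => _) = (fun x => complex.Re (f x))) //.
  by apply: funext => x; case: (f x) => a b.
rewrite (_ : (fun x => _) = (fun x => - complex.Im (f x))); first exact: real_regularN.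
by apply: funext => x; case: (f x) => a b.
Qed.

(** The inverse is conj f over |f|^2, whose real denominator has no zero. *)
Lemma regularV f : regular f -> (forall x, f x != 0) -> regular (fun x => (f x)^-1).
Proof.
move=> [f1 f2] f0.
pose n x := complex.Re (f x) * complex.Re (f x) + complex.Im (f x) * complex.Im (f x).
have n0 x : n x != 0.
  have := f0 x; rewrite /n; case: (f x) => a b /=; rewrite eq_complex /= => ab.
  by rewrite -!expr2 paddr_eq0 ?sqr_ge0 // !sqrf_eq0.
have nr : real_regular (fun x => (n x)^-1).
  by apply: real_regularV n0; apply: real_regularD; exact: real_regularM.
split.
  rewrite (_ : (fun x => _) = (fun x => complex.Re (f x) * (n x)^-1)).
    exact: real_regularM.
  by apply: funext => x; rewrite /n; case: (f x) => a b /=; rewrite -!expr2.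
rewrite (_ : (fun x => _) = (fun x => - (complex.Im (f x) * (n x)^-1))).
  by apply: real_regularN; exact: real_regularM.
by apply: funext => x; rewrite /n; case: (f x) => a b /=; rewrite -!expr2.
Qed.

Lemma regular_sum I (r : seq I) (f : I -> pt -> C) :
  (forall i, regular (f i)) -> regular (fun x => \sum_(i <- r) f i x).
Proof.
move=> fr; elim: r => [|i r IHr].
  rewrite (_ : (fun x => _) = fun=> 0); first exact: regular_cst.
  by apply: funext => x; rewrite big_nil.
rewrite (_ : (fun x => _) = (fun x => f i x + \sum_(j <- r) f j x)); first exact: regularD.
by apply: funext => x; rewrite big_cons.
Qed.

Lemma regular_prod I (r : seq I) (f : I -> pt -> C) :
  (forall i, regular (f i)) -> regular (fun x => \prod_(i <- r) f i x).
Proof.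
move=> fr; elim: r => [|i r IHr].
  rewrite (_ : (fun x => _) = fun=> 1); first exact: regular_cst.
  by apply: funext => x; rewrite big_nil.
rewrite (_ : (fun x => _) = (fun x => f i x * \prod_(j <- r) f j x)); first exact: regularM.
by apply: funext => x; rewrite big_cons.
Qed.

(** The real or the imaginary part of [f x0] is nonzero; the polynomial is the numerator of that
    part. *)
Lemma regular_neq0 f x0 : regular f -> f x0 != 0 ->
  exists2 p : mpoly.mpoly c R, mpoly.meval (fun k => x0 0 k) p != 0 &
    forall x : pt, mpoly.meval (fun k => x 0 k) p != 0 -> f x != 0.
Proof.
move=> [[p [q [[p' pE] _ q0 fE]]] [r [s [[r' rE] _ s0 fE']]]].
have [p0|p0] := eqVneq (complex.Re (f x0)) 0; last first.
  move=> _; exists p' => [|x]; rewrite -pE.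
    by move: p0; rewrite fE mulf_eq0 negb_or => /andP[].
  move=> px; apply/eqP => fx0; move: (fE x); rewrite fx0 /= => /esym/eqP.
  by rewrite mulf_eq0 invr_eq0 (negPf px) (negPf (q0 x)).
move=> f0; have {f0} r0 : complex.Im (f x0) != 0.
  by move: f0 p0; case: (f x0) => a b /= ab a0; move: ab; rewrite eq_complex /= a0 eqxx.
exists r' => [|x]; rewrite -rE.
  by move: r0; rewrite fE' mulf_eq0 negb_or => /andP[].
move=> px; apply/eqP => fx0; move: (fE' x); rewrite fx0 /= => /esym/eqP.
by rewrite mulf_eq0 invr_eq0 (negPf px) (negPf (s0 x)).
Qed.

Definition regular_mx m n (M : pt -> 'M[C]_(m, n)) : Prop :=
  forall i j, regular (fun x => M x i j).

Lemma regular_eq f g : f =1 g -> regular f -> regular g.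
Proof. by move=> /funext ->. Qed.

Lemma regular_mx_cst m n (A : 'M[C]_(m, n)) : regular_mx (fun=> A).
Proof. by move=> i j; exact: regular_cst. Qed.

Lemma regular_mxD m n (A B : pt -> 'M[C]_(m, n)) :
  regular_mx A -> regular_mx B -> regular_mx (fun x => A x + B x).
Proof.
move=> rA rB i j; apply: (regular_eq (f := fun x => A x i j + B x i j)).
  by move=> x; rewrite mxE.
exact: regularD.
Qed.

Lemma regular_mxM m n p (A : pt -> 'M[C]_(m, n)) (B : pt -> 'M[C]_(n, p)) :
  regular_mx A -> regular_mx B -> regular_mx (fun x => A x *m B x).
Proof.
move=> rA rB i j; apply: (regular_eq (f := fun x => \sum_k A x i k * B x k j)).
  by move=> x; rewrite mxE.
by apply: regular_sum => k; exact: regularM.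
Qed.

Lemma regular_mxZ m n k (A : pt -> 'M[C]_(m, n)) :
  regular_mx A -> regular_mx (fun x => k *: A x).
Proof.
move=> rA i j; apply: (regular_eq (f := fun x => k * A x i j)).
  by move=> x; rewrite mxE.
by apply: regularM => //; exact: regular_cst.
Qed.

Lemma regular_mx_conj m n (A : pt -> 'M[C]_(m, n)) :
  regular_mx A -> regular_mx (fun x => map_mx Num.conj (A x)).
Proof.
move=> rA i j; apply: (regular_eq (f := fun x => Num.conj (A x i j))).
  by move=> x; rewrite mxE.
exact: regular_conj.
Qed.

Lemma regular_mx_ctr m n (A : pt -> 'M[C]_(m, n)) :
  regular_mx A -> regular_mx (fun x => ctr (A x)).
Proof.
move=> rA i j; apply: (regular_eq (f := fun x => Num.conj (A x j i))).
  by move=> x; rewrite !mxE.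
exact: regular_conj.
Qed.

Lemma regular_tensmx m n p q (A : pt -> 'M[C]_(m, n)) (B : pt -> 'M[C]_(p, q)) :
  regular_mx A -> regular_mx B -> regular_mx (fun x => tensmx (A x) (B x)).
Proof.
move=> rA rB i j; apply: (regular_eq (f := fun x => A x (mxtens_unindex i).1 (mxtens_unindex j).1
   * B x (mxtens_unindex i).2 (mxtens_unindex j).2)).
  by move=> x; rewrite mxE.
exact: regularM.
Qed.

Lemma regular_det n (A : pt -> 'M[C]_n) :
  regular_mx A -> regular (fun x => \det (A x)).
Proof.
move=> rA; apply: regular_sum => s; apply: regularM; first exact: regular_cst.
by apply: regular_prod => i; exact: rA.
Qed.

Lemma regular_mx_inv n (A : pt -> 'M[C]_n) : regular_mx A ->
  (forall x, A x \in unitmx) -> regular_mx (fun x => invmx (A x)).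
Proof.
move=> rA uA i j.
apply: (regular_eq (f := fun x => (\det (A x))^-1 * cofactor (A x) j i)).
  by move=> x; rewrite /invmx uA !mxE.
apply: regularM.
  apply: regularV; first exact: regular_det.
  by move=> x; have := uA x; rewrite unitmxE unitfE.
apply: regularM; first exact: regular_cst.
apply: regular_det => k l.
by apply: (regular_eq (f := fun x => A x (lift j k) (lift i l))) => // x; rewrite !mxE.
Qed.

End RegularFunctions.

(** * Extension of invariant vectors to regular families *)

Section RegularInvariants.
Variables (R : realType) (H : hopfStarAlgebra R) (cqgH : cqg H) (c : nat).
Local Notation C := (R[i]).
Local Notation pt := 'rV[R]_c.
Variables (n : nat) (u : 'M[H]_n) (Q : 'M[C]_n) (F : Type) (P : pt -> F -> 'M[C]_n).
Hypotheses (cu : corep u) (uu : unitary_for Q u)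
  (PQ : forall x i, Q *m P x i = ctr (P x i) *m Q)
  (rP : forall i, regular_mx (fun x => P x i)).

Definition invariant x m (y : 'M[H]_m) (t : 'cV[C]_m) : Prop :=
  stab_mx u (P x) (y *m sc H t - sc H t).

Definition regular_invariant (x0 : pt) m (y : 'M[H]_m) (t0 : 'cV[C]_m) : Prop :=
  exists t : pt -> 'cV[C]_m,
    [/\ regular_mx t, forall x, invariant x y (t x) & t x0 = t0].

Let stabD x a b : stab_mem u (P x) a -> stab_mem u (P x) b -> stab_mem u (P x) (a + b).
Proof. by have [_ ID _ _ _] := stab_mem_ideal u (P x); exact: ID. Qed.

Lemma invariantD x m (y : 'M[H]_m) s t :
  invariant x y s -> invariant x y t -> invariant x y (s + t).
Proof.
move=> ys yt i j; rewrite scD mulmxDr opprD addrACA mxE.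
by apply: stabD; [exact: ys|exact: yt].
Qed.

Lemma invariantZ x m (y : 'M[H]_m) k t : invariant x y t -> invariant x y (k *: t).
Proof.
move=> yt; rewrite /invariant -mul_mx_scalar scM mulmxA -mulmxBl.
exact: stab_mx_mulr.
Qed.

Lemma invariant_intertwiner x m p (y : 'M[H]_m) (z : 'M[H]_p) (A : 'M[C]_(m, p)) t :
  y *m sc H A = sc H A *m z -> invariant x z t -> invariant x y (A *m t).
Proof.
move=> yA zt; rewrite /invariant scM mulmxA yA -mulmxA -mulmxBr.
exact: stab_mx_mull.
Qed.

Lemma invariant_tens x m p (y : 'M[H]_m) (z : 'M[H]_p) (s : 'cV[C]_m) (t : 'cV[C]_p) :
  invariant x y s -> invariant x z t ->
  invariant x (tensmx y z) (tensmx s t : 'cV_(m * p)).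
Proof.
have [_ _ IZ Il Ir] := stab_mem_ideal u (P x).
move=> ys zt k j; rewrite [j]ord1; case: (mxtens_indexP k) => a b.
rewrite mxBE [sc H _ _ _]mxE tens_mulE [tensmx s t _ _]mxE !mxtens_indexK /= !ord1.
have -> : (y *m sc H s) a 0 * (z *m sc H t) b 0 - (s a 0 * t b 0) *: 1 =
   ((y *m sc H s) a 0 - s a 0 *: 1) * (z *m sc H t) b 0 +
   s a 0 *: ((z *m sc H t) b 0 - t b 0 *: 1).
  by rewrite mulrBl scalerBr scalerA mulr_algl addrA subrK.
have := ys a 0; rewrite mxBE [sc H _ _ _]mxE => ya.
have := zt b 0; rewrite mxBE [sc H _ _ _]mxE => zb.
by apply: stabD; [exact: Ir|exact: IZ].
Qed.

Lemma invariant_conj x m (y : 'M[H]_m) t :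
  invariant x y t -> invariant x (conjmx y) (map_mx Num.conj t).
Proof.
move=> yt i j; suff -> : conjmx y *m sc H (map_mx Num.conj t) - sc H (map_mx Num.conj t) =
    conjmx (y *m sc H t - sc H t).
  by rewrite mxE; apply: (stab_star cu uu (PQ x)); exact: yt.
apply/matrixP => a b; rewrite [RHS]mxE !mxBE starB; congr (_ - _); last first.
  by rewrite [sc H t a b]mxE starZ star1 [sc H _ a b]mxE mxE.
rewrite !mul_scE star_sum; apply: eq_bigr => k _.
by rewrite starZ [conjmx y a k]mxE mxE.
Qed.

Lemma invariant_one x : invariant x (1%:M : 'M[H]_1) 1%:M.
Proof.
have [I0 _ _ _ _] := stab_mem_ideal u (P x).
by move=> i j; rewrite mul1mx subrr mxE.
Qed.

(** Modulo the ideal y t may be replaced by t, and what remains is the identity z S^-1 z^* =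
    S^-1. *)
Lemma invariant_insert x m p (y : 'M[H]_m) (z : 'M[H]_p) (S : 'M[C]_p) t :
  unitary_for S z -> invariant x y t ->
  invariant x (tensmx (tensmx z y) (conjmx z)) (insert_vec t (invmx S)).
Proof.
have [_ _ IZ Il Ir] := stab_mem_ideal u (P x).
move=> [_ _ zS] yt a b; rewrite [b]ord1; case: (mxtens_indexP a) => d j.
case: (mxtens_indexP d) => i k {a d}.
rewrite mxBE [sc H _ _ _]mxE insert_mulE [insert_vec _ _ _ _]mxE !mxtens_indexK /=.
have ytE : (y *m sc H t) k 0 = (y *m sc H t - sc H t) k 0 + t k 0 *: 1.
  by rewrite mxBE [sc H t k 0]mxE subrK.
have -> : \sum_s \sum_r invmx S r s *: (z i r * (y *m sc H t) k 0) * star (z j s) =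
    \sum_s \sum_r invmx S r s *: (z i r * (y *m sc H t - sc H t) k 0) * star (z j s) +
    (t k 0 * invmx S i j) *: 1.
  have zE : (z *m sc H (invmx S) *m hstar z) i j = invmx S i j *: 1 by rewrite zS mxE.
  rewrite -scalerA -zE [(z *m _ *m _) i j]mxE scaler_sumr -big_split; apply: eq_bigr => s _ /=.
  rewrite [(z *m sc H (invmx S)) i s]mul_scE mulr_suml scaler_sumr -big_split.
  apply: eq_bigr => r _ /=; rewrite [in LHS]ytE mulrDr scalerDr mulrDl; congr (_ + _).
  rewrite [hstar z s j]mxE [z^T s j]mxE -!scalerAr mulr1 scalerA -!scalerAl scalerA.
  by rewrite mulrC.
rewrite addrK; apply: stab_sum => s _; apply: stab_sum => r _.
by apply: Ir; apply: IZ; apply: Il; exact: yt.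
Qed.

Lemma invariant_proj x i :
  invariant x (tensmx u (conjmx u)) (vecmx (P x i *m invmx Q)).
Proof.
move=> a b; rewrite [b]ord1; case: (mxtens_indexP a) => k l {a b}.
rewrite mxBE [sc H _ _ _]mxE vecmx_mulE [vecmx _ _ _]mxE mxtens_indexK /=.
have [_ _ uQ] := uu; set X := P x i *m invmx Q.
have -> : (u *m sc H X *m hstar u) k l - X k l *: 1 =
    (commutator u (P x) i *m (sc H (invmx Q) *m hstar u)) k l.
  rewrite /commutator mulmxBl !mulmxA -[in RHS](mulmxA (sc H (P x i))) -(mulmxA (sc H (P x i))).
  by rewrite uQ -scM -[u *m _ *m sc H (invmx Q)]mulmxA -scM [RHS]mxBE [sc H X k l in RHS]mxE.
apply: stab_mx_mulr => p q; exact: stab_commutator.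
Qed.

(** The duality is applied at the single point [x0]. Each of its constructions makes sense at every
    x and keeps invariance for the ideal at x, and only the vectors of the projections depend on
    x. *)
Theorem regular_invariant_extension x0 m (y : 'M[H]_m) (v : 'cV[C]_m) :
  corep y -> invariant x0 y v -> regular_invariant x0 y v.
Proof.
move=> cy yv.
apply: (stabilizer_duality cqgH cu uu (P := P x0) (G := regular_invariant x0)) => //.
- move=> p z; exists (fun=> 0); split=> // [|x]; first exact: regular_mx_cst.
  by rewrite -(scale0r (0 : 'cV_p)); apply: invariantZ => i j; rewrite sc0 mulmx0 subrr mxE;
     case: (stab_mem_ideal u (P x)).
- move=> p z _ _ [s [rs zs <-]] [t [rt zt <-]]; exists (fun x => s x + t x); split=> //.
    exact: regular_mxD.
  by move=> x; exact: invariantD.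
- move=> p z k _ [t [rt zt <-]]; exists (fun x => k *: t x); split=> //.
    exact: regular_mxZ.
  by move=> x; exact: invariantZ.
- move=> p q z w A _ cz cw zA [t [rt wt <-]]; exists (fun x => A *m t x); split=> //.
    by apply: regular_mxM => //; exact: regular_mx_cst.
  by move=> x; exact: invariant_intertwiner zA _.
- move=> p q z w _ _ cz cw [s [rs zs <-]] [t [rt wt <-]].
  exists (fun x => tensmx (s x) (t x)); split=> //.
    exact: (@regular_tensmx R c p 1 q 1 s t rs rt).
  by move=> x; exact: invariant_tens.
- move=> p z _ cz [t [rt zt <-]]; exists (fun x => map_mx Num.conj (t x)); split=> //.
    exact: regular_mx_conj.
  by move=> x; exact: invariant_conj.
- exists (fun=> 1%:M); split=> //; [exact: regular_mx_cst|exact: invariant_one].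
- move=> p q z w S _ cz cw uw [t [rt zt <-]].
  exists (fun x => insert_vec (t x) (invmx S)); split=> //.
    move=> i j; apply: (regular_eq (f := fun x =>
      t x (mxtens_unindex (mxtens_unindex i).1).2 0 *
      invmx S (mxtens_unindex (mxtens_unindex i).1).1 (mxtens_unindex i).2)).
      by move=> x; rewrite mxE.
    by apply: regularM; [exact: rt|exact: regular_cst].
  by move=> x; exact: invariant_insert.
- move=> i; exists (fun x => vecmx (P x i *m invmx Q)); split=> //; last first.
    by move=> x; exact: invariant_proj.
  move=> k j; apply: (regular_eq (f := fun x =>
      (P x i *m invmx Q) (mxtens_unindex k).1 (mxtens_unindex k).2)).
    by move=> x; rewrite [RHS]mxE.
  by apply: regular_mxM; [exact: rP|exact: regular_mx_cst].
- by move=> p z _ i cz [t [rt zt <-]]; exact: zt.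
Qed.

End RegularInvariants.

(** * Constrained comodules *)

Section MatrixPolynomials.
Variable C : closedFieldType.

(** Powers as iterates, so that size 0 is covered uniformly. *)
Definition pw d (b : 'M[C]_d) (i : nat) : 'M[C]_d := iter i (mulmx b) 1%:M.

Lemma pw_horner d (b : 'M[C]_d.+1) (p : {poly C}) :
  \sum_(i < size p) p`_i *: pw b i = horner_mx b p.
Proof.
have pwE i : pw b i = b ^+ i by elim: i => [|i IHi]; rewrite ?expr0 // exprS -IHi.
rewrite -[in RHS](coefK p) poly_def rmorph_sum; apply: eq_bigr => i _.
by rewrite /= linearZ /= rmorphXn /= horner_mx_X pwE.
Qed.

(** A multiple of the characteristic polynomial vanishes at b and is 1 at a chosen k outside the
    spectrum. *)
Lemma non_eigenvalue d (b : 'M[C]_d) : exists (k : C) N (a : 'I_N -> C),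
  \sum_i a i *: pw b i = 0 /\ \sum_i a i * k ^+ i = 1.
Proof.
case: d b => [|d] b.
  (* In size 0 the constant polynomial 1 vanishes at b. *)
  by exists 0, 1, (fun=> 1); split; [apply/matrixP => -[]|rewrite big_ord1 mulr1].
pose p := char_poly b; have p0 : p != 0 by apply/monic_neq0/char_poly_monic.
have [k kp] : exists k, ~~ root p k.
  have [k] := closed_nonrootP p p0; by exists k.
exists k, (size p), (fun i => p.[k]^-1 * p`_i); split.
  under eq_bigr => i _ do rewrite -scalerA.
  by rewrite -scaler_sumr pw_horner Cayley_Hamilton scaler0.
under eq_bigr => i _ do rewrite -mulrA.
by rewrite -mulr_sumr -horner_coef mulVf.
Qed.

(** Linear factors X - k are stripped from a polynomial p with A p(b) = 0. Once the quotient q has A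
    q(b) nonzero, this matrix is the eigenvector. *)
Lemma eigenvector_in_orbit r d (A : 'M[C]_(r, d)) (b : 'M[C]_d) : A != 0 ->
  exists (k : C) N (a : 'I_N -> C), let A' := A *m \sum_i a i *: pw b i in
    A' != 0 /\ A' *m b = k *: A'.
Proof.
case: d A b => [|d] A b A0.
  by case/eqP: A0; apply/matrixP => i [].
have [n pn] : exists n, exists p : {poly C}, [/\ (size p <= n)%N, p != 0 & A *m horner_mx b p = 0].
  exists (size (char_poly b)), (char_poly b); split=> //.
    exact/monic_neq0/char_poly_monic.
  by rewrite Cayley_Hamilton mulmx0.
elim: n pn => [|n IHn] [p [pn p0 Ap]].
  by move: pn; rewrite leqn0 size_poly_eq0 (negPf p0).
have [/size_poly1P[a a0 pE]|] := boolP (size p == 1).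
  case/eqP: A0; move: Ap; rewrite pE horner_mx_C mul_mx_scalar => /eqP.
  by rewrite scaler_eq0 (negPf a0) => /eqP.
move=> /closed_rootP[k /factor_theorem[q pE]].
have q0 : q != 0 by apply: contraNneq p0 => q0; rewrite pE q0 mul0r.
have [Aq|Aq] := eqVneq (A *m horner_mx b q) 0.
  apply: IHn; exists q; split=> //.
  by move: pn; rewrite pE size_Mmonic ?monicXsubC // size_XsubC addn2.
exists k, (size q), (fun i => q`_i); rewrite /= pw_horner; split=> //.
have := Ap; rewrite pE rmorphM rmorphB /= horner_mx_X horner_mx_C -mulmxE mulmxA.
by rewrite mulmxBr mul_mx_scalar => /eqP; rewrite subr_eq0 => /eqP.
Qed.

End MatrixPolynomials.

Section Colinear.
Variables (R : realType) (H : hopfStarAlgebra R).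
Local Notation C := (R[i]).

Lemma tmap_ext (U V U' V' : lmodType C) (f f' : U -> U') (g g' : V -> V') x :
  f =1 f' -> g =1 g' -> tmap f g x = tmap f' g' x.
Proof. by move=> ff gg; apply: tlift_ext => u v; rewrite ff gg. Qed.

Lemma tmap_comp (U V U' V' U'' V'' : lmodType C) (f : {linear U -> U'})
  (g : {linear V -> V'}) (f' : {linear U' -> U''}) (g' : {linear V' -> V''}) x :
  tmap f' g' (tmap f g x) = tmap (f' \o f) (g' \o g) x.
Proof. by rewrite {1}/tmap tlift_tmap //; exact: balanced_linear. Qed.

Section HomMatrix.
Variables (X Y : vectType C) (d r : nat) (e : d.-tuple X) (e' : r.-tuple Y).
Hypotheses (eb : basis_of fullv e) (eb' : basis_of fullv e').

Definition hom_of_mx (A : 'M[C]_(r, d)) (x : X) : Y :=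
  vec_of_col e' (A *m coord_col e x).

Fact vec_of_col_linear : linear (vec_of_col e').
Proof.
move=> k a b; rewrite /vec_of_col scaler_sumr -big_split; apply: eq_bigr => i _ /=.
by rewrite !mxE scalerDl scalerA.
Qed.

Fact hom_of_mx_linear A : linear (hom_of_mx A).
Proof.
by move=> k x y; rewrite /hom_of_mx linearP mulmxDr -scalemxAr vec_of_col_linear.
Qed.
HB.instance Definition _ A :=
  GRing.isLinear.Build C X Y *:%R (hom_of_mx A) (hom_of_mx_linear A).

Variables (sigma : X -> X ⊗ H) (tau : Y -> Y ⊗ H).
Hypotheses (sl : linear sigma) (tl : linear tau).
Let x := coaction_mx e sigma.
Let y := coaction_mx e' tau.

Lemma hom_of_mx_colinear A w : y *m sc H A = sc H A *m x ->
  tau (hom_of_mx A w) = tmap (hom_of_mx A) idfun (sigma w).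
Proof.
move=> yA; rewrite (coaction_mx_vec eb' tl) -/y /hom_of_mx (vec_of_colK eb').
rewrite (coaction_mx_vec eb sl) -/x (linear_sum (tmap (hom_of_mx A) idfun)).
rewrite scM mulmxA yA -mulmxA.
transitivity (\sum_i \sum_k tens (A k i *: tnth e' k) ((x *m sc H (coord_col e w)) i 0)).
  rewrite exchange_big; apply: eq_bigr => k _; rewrite sc_mulE tens_sumr.
  by apply: eq_bigr => i _; rewrite tensZl tensZr.
apply: eq_bigr => i _; rewrite /= tmap_tens /= /hom_of_mx (coord_col_tnth eb) -colE tens_suml.
by apply: eq_bigr => k _; rewrite [col i A k 0]mxE.
Qed.

(** Stated at one vector, because the map of a subquotient is colinear only on the subcomodule Z. *)
Lemma colinear_mx (q : 'Hom(X, Y)) w : tau (q w) = tmap q idfun (sigma w) ->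
  let A := \matrix_(k, i) vcoord e' k (q (tnth e i)) in
  y *m sc H (A *m coord_col e w) = sc H A *m (x *m sc H (coord_col e w)).
Proof.
move=> qw A; apply/matrixP => k j; rewrite ord1.
have AE : A *m coord_col e w = coord_col e' (q w).
  apply/matrixP => a b; rewrite ord1 [RHS]mxE {2}[w](basis_expand eb) !linear_sum mxE.
  by apply: eq_bigr => i _; rewrite !mxE !linearZ_LR mulrC.
rewrite AE -[LHS](slicel_basis eb' (fun k => (y *m sc H (coord_col e' (q w))) k 0)).
rewrite -(coaction_mx_vec eb' tl) qw (coaction_mx_vec eb sl).
rewrite (linear_sum (tmap q idfun)) (linear_sum (slicel _)) sc_mulE.
by apply: eq_bigr => i _; rewrite /= tmap_tens slicel_tens [A k i]mxE.
Qed.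

End HomMatrix.

Lemma limg_subcomodule (X Y : vectType C) (sigma : X -> X ⊗ H) (tau : Y -> Y ⊗ H)
    (f : 'Hom(X, Y)) :
  (forall w, tau (f w) = tmap f idfun (sigma w)) -> subcomodule tau (limg f).
Proof.
move=> ft w /memv_imgP[v _ ->]; rewrite ft.
exists (tmap (@vsproj _ _ (limg f) \o f) idfun (sigma v)).
rewrite tmap_comp; apply: tmap_ext => // s /=.
by rewrite vsprojK // memv_img // memvf.
Qed.

End Colinear.

Section VectorProjections.
Variables (R : realType).
Local Notation C := (R[i]).
Variables (X : vectType C) (d : nat) (e : d.-tuple X) (eb : basis_of fullv e).

Definition tuple_mx k (b : k.-tuple X) : 'M[C]_(d, k) :=
  \matrix_(i, j) vcoord e i (tnth b j).

Lemma tuple_mx_mul k (b : k.-tuple X) (c : 'cV[C]_k) :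
  tuple_mx b *m c = coord_col e (\sum_j c j 0 *: tnth b j).
Proof.
apply/matrixP => i j; rewrite ord1 mxE [RHS]mxE linear_sum.
by apply: eq_bigr => l _; rewrite mxE linearZ_LR mulrC.
Qed.

Lemma coord_col_inj w w' : coord_col e w = coord_col e w' -> w = w'.
Proof. by move=> ww; rewrite -[w](coord_colK eb) ww coord_colK. Qed.

Lemma tuple_mx_inj k (W : {vspace X}) (b : k.-tuple X) :
  basis_of W b -> injmx (tuple_mx b).
Proof.
move=> Wb c; rewrite tuple_mx_mul -(linear0 (coord_col e)) => /coord_col_inj cb.
apply/matrixP => j l; rewrite ord1 [RHS]mxE.
move/freeP: (basis_free Wb) => /(_ (fun j => c j 0)) H; apply: H.
by rewrite -[RHS]cb; apply: eq_bigr => i _; rewrite (tnth_nth 0).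
Qed.

Lemma oproj_projects_onto k (Q : 'M[C]_d) (W : {vspace X}) (b : k.-tuple X) :
  posdef Q -> basis_of W b -> projects_onto e W (oproj Q (tuple_mx b)).
Proof.
move=> Qp Wb; have bi := tuple_mx_inj Wb; split; first exact: oproj_idem.
have sumE w : w \in W -> w = \sum_j (\col_j vcoord b j w) j 0 *: tnth b j.
  move=> wW; rewrite [LHS](coord_basis Wb wW).
  by apply: eq_bigr => j _; rewrite mxE (tnth_nth 0).
move=> w; split=> [/sumE wE|wE].
  rewrite {2}wE -tuple_mx_mul; rewrite [in LHS]wE -tuple_mx_mul mulmxA oproj_id //.
have -> : w = \sum_j (invmx (ctr (tuple_mx b) *m Q *m tuple_mx b) *m
     (ctr (tuple_mx b) *m Q) *m coord_col e w) j 0 *: tnth b j.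
  by apply: coord_col_inj; rewrite -tuple_mx_mul !mulmxA -[LHS]wE /oproj !mulmxA.
apply: rpred_sum => j _; apply: rpredZ; apply: (basis_mem Wb); exact: mem_tnth.
Qed.

Lemma projects_onto_exists (P : 'M[C]_d) : P *m P = P ->
  exists W, projects_onto e W P.
Proof.
move=> PP; exists (limg (linfun (hom_of_mx e e P))); split=> // w; split.
  move=> /memv_imgP[v _ ->]; rewrite lfunE /= /hom_of_mx (vec_of_colK eb).
  by rewrite mulmxA PP.
move=> Pw; apply/memv_imgP; exists w; rewrite ?memvf // lfunE /= /hom_of_mx Pw.
by rewrite coord_colK.
Qed.

Lemma projects_onto_col (W : {vspace X}) (P : 'M[C]_d) j : projects_onto e W P ->
  vec_of_col e (col j P) \in W.
Proof. by move=> [PP PW]; apply/PW; rewrite (vec_of_colK eb) colE mulmxA PP. Qed.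

Lemma projects_onto_sub (W Z : {vspace X}) (P S : 'M[C]_d) :
  projects_onto e W P -> projects_onto e Z S -> (Z <= W)%VS -> P *m S = S.
Proof.
move=> [_ PW] ZS ZW; apply/matrixP => i j.
have /PW/matrixP/(_ i 0) := subvP ZW _ (projects_onto_col j ZS).
rewrite (vec_of_colK eb) [RHS]mxE => <-; rewrite !mxE.
by apply: eq_bigr => k _; rewrite mxE.
Qed.

End VectorProjections.

(** * Decomposition into irreducible summands *)

Section Decomposition.
Variables (R : realType) (K : hopfStarAlgebra R).
Local Notation C := (R[i]).
Variables (X : vectType C) (sigma : X -> X ⊗ K) (sP : is_comodule sigma).

Lemma tassoc_natural (U V : vectType C) (p : {linear U -> V}) (A B : lmodType C)
    (T : (U ⊗ A) ⊗ B) :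
  tassoc (tmap (tmap p idfun) idfun T) = tmap p idfun (tassoc T).
Proof.
apply: (@tensor_ext _ _ _ _ (@tassoc _ V A B \o tmap (tmap p idfun) idfun)
  (tmap p idfun \o @tassoc _ U A B)) => [y z|y z|y b] /=; rewrite ?linearD //.
rewrite tmap_tens /=.
apply: (@tensor_ext _ _ _ _ (fun y => tassoc (tens (tmap p idfun y) b))
  (fun y => tmap p idfun (tassoc (tens y b)))) => [z w|z w|u a] /=.
- by rewrite linearD /= tensDl linearD.
- by rewrite tensDl !linearD.
- by rewrite tmap_tens !tassoc_tens tmap_tens.
Qed.

Lemma subcoaction_comodule (Z : {vspace X}) : subcomodule sigma Z ->
  is_comodule (@subcoaction R K X sigma Z).
Proof.
move=> Zs; have [sl sA s1] := sP.
pose sL : {linear X -> X ⊗ K} := HB.pack sigma (GRing.isLinear.Build _ _ _ _ sigma sl).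
have tl : linear (@subcoaction R K X sigma Z).
  by move=> k v w; rewrite /subcoaction linearP sl linearP.
split=> // w.
- transitivity (tassoc (tmap (tmap (@vsproj _ _ Z) idfun) idfun
    (tmap sL idfun (tmap (@vsval _ _ Z) idfun (subcoaction sigma w))))).
    by rewrite !tmap_comp.
  rewrite tassoc_natural subcoactionE // sA /subcoaction.
  by rewrite !tmap_comp; exact: tmap_ext.
- transitivity (vsproj Z (slicer (counit K) (sigma (vsval w)))); last first.
    by rewrite -[RHS]vsvalK; congr (vsproj Z _); exact: s1.
  apply: (@tensor_ext _ _ _ _ (slicer (counit K) \o tmap (@vsproj _ _ Z) idfun)
    (vsproj Z \o slicer (counit K))) => [y z|y z|u v] /=; rewrite ?linearD //.
  by rewrite tmap_tens /= !slicer_tens linearZ.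
Qed.

(** A nonzero subcomodule of least dimension inside [W] is irreducible, since its own subcomodules
    are subcomodules of X. *)
Lemma irreducible_subcomodule (W : {vspace X}) : subcomodule sigma W -> W <> 0%VS ->
  exists Z : {vspace X}, [/\ (Z <= W)%VS, subcomodule sigma Z, Z <> 0%VS &
    irreducible_comodule (@subcoaction R K X sigma Z)].
Proof.
move=> Ws W0.
pose p k := `[< exists Z : {vspace X}, [/\ (Z <= W)%VS, subcomodule sigma Z, Z <> 0%VS
  & \dim Z = k] >].
have p0 : exists k, p k by exists (\dim W); apply/asboolP; exists W.
case: (ex_minnP p0) => k /asboolP[Z [ZW Zs Z0 <-]] kmin.
exists Z; split=> //; split; first exact: subcoaction_comodule.
  rewrite dimvf -[X in X != _]dimvf.
  apply/eqP => dZ; apply: Z0; apply/eqP; rewrite -dimv_eq0 -[\dim Z]/(dim (subvs_of Z)).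
  by rewrite -dimvf dZ.
move=> Y Ys.
pose j : 'Hom(subvs_of Z, X) := linfun vsval.
have jE s : j s = vsval s by rewrite lfunE.
have jinj : lker j = 0%VS.
  apply/eqP/lker0P => s t; rewrite !jE; exact: val_inj.
have dY : \dim (j @: Y)%VS = \dim Y.
  by have := limg_ker_dim j Y; rewrite jinj capv0 dimv0.
have [->|Y0] := eqVneq Y 0%VS; [by left|right].
have jYZ : (j @: Y <= Z)%VS.
  by apply/subvP => w /memv_imgP[s _ ->]; rewrite jE subvsP.
have jYs : subcomodule sigma (j @: Y)%VS.
  move=> w /memv_imgP[s sY ->]; rewrite jE -subcoactionE //.
  have [t <-] := Ys s sY.
  exists (tmap (@vsproj _ _ (j @: Y)%VS \o vsval \o vsval) idfun t).
  rewrite !tmap_comp; apply: tmap_ext => // r /=.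
  by rewrite vsprojK // -jE memv_img // subvsP.
apply/eqP; rewrite eqEdim subvf /= dimvf -[dim _]/(\dim Z) -dY; apply: kmin.
apply/asboolP; exists (j @: Y)%VS; split=> //; first exact: subv_trans jYZ ZW.
by move=> jY0; move: Y0; rewrite -dimv_eq0 -dY jY0 dimv0 eqxx.
Qed.

Variables (d : nat) (e : d.-tuple X) (eb : basis_of fullv e).
Let x := coaction_mx e sigma.
Variables (Q : 'M[C]_d) (ux : unitary_for Q x).

Definition is_coprojection (P : 'M[C]_d) : Prop :=
  [/\ P *m P = P, Q *m P = ctr P *m Q & x *m sc K P = sc K P *m x].

(** Complete reducibility as an induction principle: the orthogonal projection onto an irreducible
    part of the image is split off. The factorization B B' records the dimension of that part. *)
Lemma coprojection_ind (Phi : 'M[C]_d -> Prop) : Phi 0 ->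
  (forall P' (Z : {vspace X}) (B : 'M[C]_(d, \dim Z)) B',
     is_coprojection P' -> is_coprojection (B *m B') -> projects_onto e Z (B *m B') ->
     irreducible_comodule (@subcoaction R K X sigma Z) ->
     P' *m (B *m B') = 0 -> (B *m B') *m P' = 0 ->
     Phi P' -> Phi (P' + B *m B')) ->
  forall P, is_coprojection P -> Phi P.
Proof.
move=> Phi0 PhiS P Pc; have [PP PQ xP] := Pc; have [Qp _ _] := ux.
have [W PW] := projects_onto_exists eb PP.
have [m] := ubnP (\dim W); elim: m W P Pc PP PQ xP PW => // m IHm W P Pc PP PQ xP PW Wm.
have Ws : subcomodule sigma W by apply/(subcomodule_mx eb sP ux PW PQ).
have [W0|/eqP W0] := eqVneq W 0%VS.
  suff -> : P = 0 by [].
  apply/matrixP => i j; have := projects_onto_col eb j PW; rewrite W0 memv0 => /eqP.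
  move=> /(congr1 (coord_col e)); rewrite (vec_of_colK eb) linear0 => /matrixP/(_ i 0).
  by rewrite !mxE.
have [Z [ZW Zs Z0 Zirr]] := irreducible_subcomodule Ws W0.
pose B := tuple_mx e (vbasis Z); pose B' := invmx (ctr B *m Q *m B) *m (ctr B *m Q).
have ZP : projects_onto e Z (B *m B') := oproj_projects_onto eb Qp (vbasisP Z).
set S := B *m B' in ZP.
have Sc : is_coprojection S.
  have SQ : Q *m S = ctr S *m Q := oproj_adj B Qp.
  split=> //; first by case: ZP.
  by apply/(subcomodule_mx eb sP ux ZP SQ).
have [SS SQ xS] := Sc.
have PS : P *m S = S := projects_onto_sub eb PW ZP ZW.
(* The adjoint of P S = S. *)
have SP : S *m P = S.
  apply: (can_inj (mulKmx (posdef_unit Qp))); rewrite mulmxA SQ -mulmxA PQ mulmxA.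
  by rewrite -ctrM PS -SQ.
have ctrB (M N : 'M[C]_d) : ctr (M - N) = ctr M - ctr N.
  by apply/matrixP => i j; rewrite !mxE rmorphB.
have P'c : is_coprojection (P - S).
  split.
  - by rewrite mulmxBl !mulmxBr PP PS SP SS subrr subr0.
  - by rewrite mulmxBr ctrB mulmxBl PQ SQ.
  - by rewrite scB mulmxBr mulmxBl xP xS.
rewrite -(subrK S P); apply: PhiS => //.
- by rewrite mulmxBl PS SS subrr.
- by rewrite mulmxBr SP SS subrr.
have [PP' PQ' xP'] := P'c.
have [W' PW'] := projects_onto_exists eb PP'.
apply: (IHm W') => //; rewrite -ltnS; apply: leq_trans Wm; rewrite ltnS.
rewrite ltn_neqAle; have W'W : (W' <= W)%VS.
  apply/subvP => w /PW'.2 w'; apply/PW.2.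
  by rewrite -[in LHS]w' mulmxA mulmxBr PP PS w'.
rewrite dimvS // andbT; apply/eqP => dW.
have WW' : W' = W by apply/eqP; rewrite eqEdim W'W /= dW.
apply: Z0; apply/eqP; rewrite -subv0; apply/subvP => z zZ.
have /PW'.2 : z \in W' by rewrite WW'; exact: (subvP ZW).
have /ZP.2 Sz := zZ; rewrite mulmxBl Sz -{1}Sz mulmxA PS Sz subrr => /esym z0.
by rewrite memv0 -[z](coord_colK eb) z0 /vec_of_col big1 // => i _; rewrite mxE scale0r.
Qed.

End Decomposition.

(** * Generation by l vectors under one endomorphism *)

Section Cyclic.
Variables (C : closedFieldType) (d l : nat).
Implicit Types (b : 'M[C]_d) (t : 'M[C]_(d, l)).

(* The matrices whose columns lie in the span of all [b^i t_j]: the columns   *)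
(* of [t] generate everything under [b] when this span contains 1.            *)
Inductive cyclic_span b t : 'M[C]_d -> Prop :=
| cyclic_gen M : cyclic_span b t (t *m M)
| cyclic_act Y : cyclic_span b t Y -> cyclic_span b t (b *m Y)
| cyclic_add Y Z : cyclic_span b t Y -> cyclic_span b t Z -> cyclic_span b t (Y + Z).

Lemma cyclic_mulr b t Y (M : 'M[C]_d) : cyclic_span b t Y -> cyclic_span b t (Y *m M).
Proof.
elim=> [M'|{}Y _ IHY|{}Y Z _ IHY _ IHZ].
- by rewrite -mulmxA; exact: cyclic_gen.
- by rewrite -mulmxA; exact: cyclic_act.
- by rewrite mulmxDl; exact: cyclic_add.
Qed.

Lemma cyclic_scale b t Y (k : C) : cyclic_span b t Y -> cyclic_span b t (k *: Y).
Proof. by move=> /(cyclic_mulr k%:M); rewrite mul_mx_scalar. Qed.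

Lemma cyclic_pw b t Y i : cyclic_span b t Y -> cyclic_span b t (pw b i *m Y).
Proof.
move=> Yb; elim: i => [|i IHi]; first by rewrite mul1mx.
by rewrite /pw iterS -mulmxA; exact: cyclic_act.
Qed.

Lemma cyclic_orbit b t N (a : 'I_N -> C) M :
  cyclic_span b t ((\sum_i a i *: pw b i) *m t *m M).
Proof.
rewrite -mulmxA mulmx_suml; apply: big_ind => [||i _].
- by rewrite -(mulmx0 _ t); exact: cyclic_gen.
- exact: cyclic_add.
- by rewrite -scalemxAl; apply/cyclic_scale/cyclic_pw/cyclic_gen.
Qed.

(** After multiplication by [A] the matrix b is a scalar, so that its powers contribute nothing new.
    For Y = 1 this bounds the rank of [A] by l. *)
Lemma cyclic_eigen r b t Y (A : 'M[C]_(r, d)) k :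
  A *m b = k *: A -> cyclic_span b t Y -> exists M, A *m Y = A *m t *m M.
Proof.
move=> Ab; elim=> [M'|{}Y _ [M AY]|{}Y Z _ [M AY] _ [M' AZ]].
- by exists M'; rewrite mulmxA.
- by exists (k *: M); rewrite mulmxA Ab -scalemxAl AY -scalemxAr.
- by exists (M + M'); rewrite !mulmxDr AY AZ.
Qed.

End Cyclic.

Section CyclicSum.
Variables (C : closedFieldType) (d l r : nat).
Variables (P b' : 'M[C]_d) (t' : 'M[C]_(d, l)) (B : 'M[C]_(d, r)) (B' : 'M[C]_(r, d)).
Variables (S : 'M[C]_d) (SB : S = B *m B').
Hypotheses (rl : (r <= l)%N) (SS : S *m S = S) (PS : P *m S = 0) (SP : S *m P = 0).
Hypotheses (Pb : P *m b' = b') (bP : b' *m P = b') (Pt : P *m t' = t').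

(* On the new block [b] acts by a scalar that is not an eigenvalue of [b'],   *)
(* so that a polynomial in [b] separates the two blocks.                      *)
Lemma cyclic_sum : cyclic_span b' t' P -> exists k (t : 'M[C]_(d, l)),
  (P + S) *m t = t /\ cyclic_span (b' + k *: S) t (P + S).
Proof.
move=> Pc; have [k [N [a [ab ak]]]] := non_eigenvalue b'.
(* The r columns of S B, padded with zero columns up to l. *)
pose z : 'M[C]_(d, l) := S *m B *m pid_mx r.
have zE : z *m (pid_mx r *m B') = S.
  have pp : (pid_mx r : 'M[C]_(r, l)) *m (pid_mx r : 'M[C]_(l, r)) = 1%:M.
    by rewrite pid_mx_id // pid_mx_1.
  by rewrite /z -(mulmxA (S *m B)) (mulmxA (pid_mx r)) pp mul1mx -mulmxA -SB.
have Sz : S *m z = z by rewrite /z !mulmxA SS.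
have Pz : P *m z = 0 by rewrite /z !mulmxA PS !mul0mx.
have St : S *m t' = 0 by rewrite -Pt mulmxA SP mul0mx.
have Sb : S *m b' = 0 by rewrite -Pb mulmxA SP mul0mx.
have bS : b' *m S = 0 by rewrite -bP -mulmxA PS mulmx0.
exists k, (t' + z); set b := b' + k *: S; set t := t' + z.
have pwt i : pw b i *m t' = pw b' i *m t' /\ S *m (pw b' i *m t') = 0.
  elim: i => [|i [IH1 IH2]]; first by rewrite !mul1mx.
  rewrite /pw !iterS -/(pw b i) -/(pw b' i) -!mulmxA IH1 mulmxDl -scalemxAl IH2.
  by rewrite scaler0 addr0; split=> //; rewrite mulmxA Sb mul0mx.
have pwz i : pw b i *m z = k ^+ i *: z.
  elim: i => [|i IHi]; first by rewrite mul1mx scale1r.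
  rewrite /pw iterS -/(pw b i) -mulmxA IHi -scalemxAr mulmxDl -scalemxAl Sz.
  by rewrite -{1}Sz mulmxA bS mul0mx add0r scalerA -exprSr.
(* The polynomial kills t', as it annihilates b', and takes the value 1 at k; so z belongs to the
   orbit of t. *)
have tz : (\sum_i a i *: pw b i) *m t = z.
  rewrite mulmxDr; have -> : (\sum_i a i *: pw b i) *m t' = 0.
    transitivity ((\sum_i a i *: pw b' i) *m t'); last by rewrite ab mul0mx.
    by rewrite !mulmx_suml; apply: eq_bigr => i _; rewrite -!scalemxAl (pwt i).1.
  rewrite add0r mulmx_suml -[RHS]scale1r -ak scaler_suml; apply: eq_bigr => i _.
  by rewrite -scalemxAl pwz scalerA.
have zc U : cyclic_span b t (z *m U) by rewrite -tz; exact: cyclic_orbit.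
split; first by rewrite mulmxDl !mulmxDr Pt Pz St Sz addr0 add0r.
apply: cyclic_add; last by rewrite -zE.
suff H Y : cyclic_span b' t' Y -> P *m Y = Y /\ cyclic_span b t Y.
  by have [] := H _ Pc.
elim=> [U|{}Y _ [PY Yc]|{}Y Z _ [PY Yc] _ [PZ Zc]].
- rewrite mulmxA Pt; split=> //.
  have -> : t' *m U = t *m U + z *m (- U) by rewrite mulmxDl mulmxN addrK.
  by apply: cyclic_add => //; exact: cyclic_gen.
- rewrite mulmxA Pb; split=> //.
  have -> : b' *m Y = b *m Y.
    by rewrite mulmxDl -scalemxAl -PY !mulmxA SP mul0mx scaler0 addr0 bP.
  exact: cyclic_act.
- by rewrite mulmxDr PY PZ; split=> //; exact: cyclic_add.
Qed.

End CyclicSum.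

(** * Matrix criteria for constrained comodules *)

Section Constrained.
Variables (R : realType) (K : hopfStarAlgebra R).
Local Notation C := (R[i]).

Lemma coaction_fixed (X : vectType C) (sigma : X -> X ⊗ K) (sl : linear sigma)
    (d : nat) (e : d.-tuple X) (eb : basis_of fullv e) (v : X) :
  sigma v = tens v 1 <->
  coaction_mx e sigma *m sc K (coord_col e v) = sc K (coord_col e v).
Proof.
have vE : tens v (1 : K) = \sum_i tens (tnth e i) (sc K (coord_col e v) i 0).
  rewrite {1}[v](basis_expand eb) tens_suml; apply: eq_bigr => i _.
  by rewrite !mxE tensZl tensZr.
rewrite (coaction_mx_vec eb sl) vE; split=> [E|->//].
apply/matrixP => i j; rewrite ord1.
rewrite -[LHS](slicel_basis eb (fun i => (coaction_mx e sigma *m sc K (coord_col e v)) i 0)).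
by rewrite E slicel_basis.
Qed.

Variables (X : vectType C) (sigma : X -> X ⊗ K) (sP : is_comodule sigma).
Variables (d : nat) (e : d.-tuple X) (eb : basis_of fullv e).
Let x := coaction_mx e sigma.
Variables (Q : 'M[C]_d) (ux : unitary_for Q x).

Lemma dim_regular : \dim {:C^o} = 1%N.
Proof. by rewrite dimvf. Qed.

Lemma trivial_dim (Y : vectType C) (tau : Y -> Y ⊗ K) :
  comodule_iso tau (@trivial_coaction R K) -> \dim {:Y} = 1%N.
Proof.
move=> [f [f0 f1 _]]; have := limg_ker_dim f fullv.
by rewrite f0 capv0 dimv0 add0n f1 dim_regular.
Qed.

Lemma trivial_fixed (Y : vectType C) (tau : Y -> Y ⊗ K) :
  comodule_iso tau (@trivial_coaction R K) -> forall v, tau v = tens v 1.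
Proof.
move=> [f [f0 _ ft]] v; pose g := (f^-1)%VF.
have gf w : g (f w) = w by apply: lker0_lfunK; rewrite f0.
transitivity (tmap g idfun (tmap f idfun (tau v))).
  rewrite tmap_comp; have gf' : g \o f =1 idfun by [].
  rewrite (tmap_ext _ gf' (g' := idfun)) //.
  elim/tensor_ind: (tau v) => [|y h z IHz]; first by rewrite tmap0.
  by rewrite tmapD -IHz tmap_tens.
by rewrite -ft /trivial_coaction tmap_tens /= gf.
Qed.

Lemma irreducible_subquotient (Z : {vspace X}) : subcomodule sigma Z ->
  subquotient sigma (@subcoaction R K X sigma Z).
Proof.
move=> Zs; exists Z, (linfun (vsproj Z)); split=> // [|z zZ].
  apply/vspaceP => s; rewrite memvf.
  by apply/memv_imgP; exists (vsval s); rewrite ?subvsP // lfunE /= vsvalK.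
by rewrite lfunE /subcoaction /= vsprojK //; apply: tmap_ext => // w; rewrite lfunE.
Qed.

Lemma sc_col m r (j : 'I_r) (A : 'M[C]_(m, r)) : sc K (col j A) = col j (sc K A).
Proof. by apply/matrixP => a b; rewrite !mxE. Qed.

Lemma colM (S : pzSemiRingType) m p r (A : 'M[S]_(m, p)) (B : 'M[S]_(p, r)) j :
  col j (A *m B) = A *m col j B.
Proof. by rewrite !colE mulmxA. Qed.

Lemma sc_comm_scale m r (y : 'M[K]_m) (z : 'M[K]_r) (A : 'M[C]_(m, r)) k :
  y *m sc K A = sc K A *m z -> y *m sc K (k *: A) = sc K (k *: A) *m z.
Proof.
move=> yA; apply/matrixP => i j.
have := congr1 (fun M : 'M[K]__ => k *: M i j) yA; rewrite /= sc_mulE mul_scE.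
rewrite !scaler_sumr => E; rewrite [LHS]mul_scE [RHS]sc_mulE.
under eq_bigr do rewrite mxE -scalerA; rewrite E.
by apply: eq_bigr => l _; rewrite mxE -scalerA.
Qed.

Lemma constrained_cyclic l : (0 < l)%N -> constrained l sigma ->
  exists b (t : 'M[C]_(d, l)), x *m sc K b = sc K b *m x /\ cyclic_span b t 1%:M.
Proof.
move=> l0 lc; have [Qp _ _] := ux.
pose Phi (P : 'M[C]_d) := exists b (t : 'M[C]_(d, l)),
    [/\ P *m b = b, b *m P = b, P *m t = t, x *m sc K b = sc K b *m x &
      cyclic_span b t P].
suff PhiP P : is_coprojection sigma e Q P -> Phi P.
  case: (PhiP 1%:M) => [|b [t [_ _ _ bx bt]]]; last by exists b, t.
  by split; rewrite ?sc1 ?mulmx1 ?ctr1 ?mul1mx.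
apply: (coprojection_ind sP eb ux (Phi := Phi)) => {P}[|P Z B B' _ [SS SQ xS] ZP Zirr PS SP].
  exists 0, 0; rewrite !mulmx0 sc0 mulmx0 mul0mx; split=> //.
  have := @cyclic_gen _ d l (0 : 'M[C]_d) (0 : 'M[C]_(d, l)) 0; rewrite mulmx0 => H; exact: H.
have Zs : subcomodule sigma Z by apply/(subcomodule_mx eb sP ux ZP SQ).
have Zl : (\dim Z <= l)%N.
  have dZ : \dim {:subvs_of Z} = \dim Z by rewrite dimvf.
  (* The constraint exempts a trivial summand, but this has dimension 1, at most l because l is
     positive. *)
  have [iso|niso] := pselect (comodule_iso (subcoaction sigma (W := Z)) (@trivial_coaction R K)).
    by rewrite -dZ (trivial_dim iso).
  by rewrite -dZ; apply: (lc _ _ Zirr _ niso); exact: irreducible_subquotient.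
move=> [b [t [Pb bP Pt xb bt]]].
have [k [t1 [Pt1 bt1]]] := cyclic_sum erefl Zl SS PS SP Pb bP Pt bt.
have Sb : B *m B' *m b = 0 by rewrite -Pb mulmxA SP mul0mx.
have bS : b *m (B *m B') = 0 by rewrite -bP -mulmxA PS mulmx0.
exists (b + k *: (B *m B')), t1; split=> //.
- rewrite mulmxDl !mulmxDr Pb -!scalemxAr PS SS scaler0 addr0.
  by rewrite Sb add0r.
- rewrite mulmxDr !mulmxDl bP -!scalemxAl SP SS scaler0 addr0.
  by rewrite bS add0r.
- rewrite scD mulmxDr mulmxDl xb; congr (_ + _).
  exact: sc_comm_scale.
Qed.

Section IrreducibleTarget.
Variables (M : vectType C) (tau : M -> M ⊗ K) (Mirr : irreducible_comodule tau).
Let e' := vbasis (fullv : {vspace M}).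
Let y := coaction_mx e' tau.

(** The projection onto [Z] commutes with the coaction, so that its composition with q is colinear
    on all of X. *)
Lemma subquotient_intertwiner (Z : {vspace X}) (q : 'Hom(X, M)) :
  subcomodule sigma Z -> (q @: Z)%VS = fullv ->
  (forall z, z \in Z -> tau (q z) = tmap q idfun (sigma z)) ->
  exists A, A != 0 /\ y *m sc K A = sc K A *m x.
Proof.
move=> Zs qZ qt; have [tP M0 _] := Mirr; have [sl _ _] := sP; have [tl _ _] := tP.
have [Qp _ _] := ux; have eb' : basis_of fullv e' := vbasisP _.
have [P [PZ xP]] : exists P, projects_onto e Z P /\ x *m sc K P = sc K P *m x.
  have PZ := oproj_projects_onto eb Qp (vbasisP Z).
  exists (oproj Q (tuple_mx e (vbasis Z))); split=> //.
  exact/(subcomodule_mx eb sP ux PZ (oproj_adj _ Qp)).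
pose A0 := \matrix_(k, i) vcoord e' k (q (tnth e i)).
have A0P : y *m sc K (A0 *m P) = sc K A0 *m (x *m sc K P).
  apply/matrixP => i j.
  have := colinear_mx eb eb' sl tl (qt _ (projects_onto_col eb j PZ)).
  rewrite (vec_of_colK eb) /= -/A0 -colM !sc_col -!colM => /matrixP/(_ i 0).
  by rewrite [X in X = _ -> _]mxE [X in _ = X -> _]mxE.
exists (A0 *m P); split; last by rewrite A0P xP mulmxA scM.
apply: contraNneq M0 => AP; rewrite -qZ dimv_eq0 -subv0.
apply/subvP => m /memv_imgP[z /PZ.2 zZ ->]; rewrite memv0.
have : A0 *m coord_col e z = coord_col e' (q z).
  apply/matrixP => k j; rewrite ord1 [RHS]mxE {2}[z](basis_expand eb) !linear_sum mxE.
  by apply: eq_bigr => i _; rewrite !mxE !linearZ_LR mulrC.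
rewrite -zZ mulmxA AP mul0mx -(linear0 (coord_col e')) => /(coord_col_inj eb') <-.
by [].
Qed.

(** The image is a nonzero subcomodule of an irreducible comodule. *)
Lemma intertwiner_surjective (A : 'M[C]_(_, d)) :
  A != 0 -> y *m sc K A = sc K A *m x -> exists D, A *m D = 1%:M.
Proof.
move=> A0 yA; have [tP _ Mmin] := Mirr; have [sl _ _] := sP; have [tl _ _] := tP.
have eb' : basis_of fullv e' := vbasisP _.
pose f := linfun (hom_of_mx e e' A).
have fE v : coord_col e' (f v) = A *m coord_col e v by rewrite lfunE /= /hom_of_mx vec_of_colK.
have fs w : tau (f w) = tmap f idfun (sigma w).
  rewrite lfunE /= (hom_of_mx_colinear eb eb' sl tl w yA).
  by apply: tmap_ext => // v; rewrite lfunE.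
have [f0|f1] := Mmin _ (limg_subcomodule fs).
  case/eqP: A0; apply/matrixP => i j.
  have := fE (tnth e j); rewrite coord_col_tnth // -colE.
  have /eqP -> : f (tnth e j) == 0 by rewrite -memv0 -f0 memv_img // memvf.
  by rewrite linear0 => /matrixP/(_ i 0); rewrite !mxE.
have Aw k : exists v, A *m v = delta_mx k 0 :> 'cV_(\dim {:M}).
  have /memv_imgP[v _ kv] : tnth e' k \in limg f by rewrite f1 memvf.
  by exists (coord_col e v); rewrite -fE -kv coord_col_tnth.
have [D DE] := choice Aw.
exists (\matrix_(i, k) D k i 0); apply/matrixP => i k.
have /matrixP/(_ i 0) := DE k; rewrite !mxE eqxx andbT => <-.
by apply: eq_bigr => j _; rewrite mxE.
Qed.

End IrreducibleTarget.

(** Multiplying an intertwiner onto M by a polynomial in b makes it an eigenvector of b. It remains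
    onto, and by [cyclic_eigen] it factors through the l columns of t. *)
Lemma cyclic_constrained l b (t : 'M[C]_(d, l)) :
  x *m sc K b = sc K b *m x -> cyclic_span b t 1%:M -> constrained l sigma.
Proof.
move=> xb bt M tau Mirr [Z [q [Zs qZ qt]]] _.
have [] := Mirr => tP M0 Mmin; have [sl _ _] := sP; have [tl _ _] := tP.
have [Qp _ _] := ux.
pose e' := vbasis (fullv : {vspace M}); have eb' : basis_of fullv e' := vbasisP _.
pose y := coaction_mx e' tau.
have [A [A0 yA]] := subquotient_intertwiner Mirr Zs qZ qt.
have [k [N [a [A1 Ab]]]] := eigenvector_in_orbit b A0.
set A' := A *m _ in A1 Ab.
have yA' : y *m sc K A' = sc K A' *m x.
  have xpw i : x *m sc K (pw b i) = sc K (pw b i) *m x.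
    elim: i => [|i IHi]; first by rewrite sc1 mulmx1 mul1mx.
    by rewrite /pw iterS -/(pw b i) scM mulmxA xb -mulmxA IHi mulmxA.
  have xs : x *m sc K (\sum_i a i *: pw b i) = sc K (\sum_i a i *: pw b i) *m x.
    apply: (big_ind (fun B => x *m sc K B = sc K B *m x)) => [|B B' xB xB'|i _].
    - by rewrite sc0 mulmx0 mul0mx.
    - by rewrite scD mulmxDr mulmxDl xB xB'.
    - exact: sc_comm_scale.
  by rewrite scM mulmxA yA -mulmxA xs mulmxA.
have [D A'D] : exists D, A' *m D = 1%:M.
  exact: (intertwiner_surjective Mirr A1 yA').
have [U] := cyclic_eigen Ab bt; rewrite mulmx1 => A'U.
have : (A' *m t) *m (U *m D) = 1%:M by rewrite mulmxA -A'U.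
by move/mulmx1_min.
Qed.

(** Irreducible summands have positive dimension, so that for l = 0 none of them is non-trivial. *)
Lemma constrained0_fixed : constrained 0 sigma -> x = 1%:M.
Proof.
move=> c0; have [Qp _ _] := ux; have [sl _ _] := sP.
pose Phi (P : 'M[C]_d) := x *m sc K P = sc K P.
suff PhiP P : is_coprojection sigma e Q P -> Phi P.
  rewrite -[x]mulmx1 -sc1 (PhiP 1%:M) ?sc1 //.
  by split; rewrite ?sc1 ?mulmx1 ?ctr1 ?mul1mx.
apply: (coprojection_ind sP eb ux (Phi := Phi)) => {P}[|P Z B B' _ [SS SQ xS] ZP Zirr PS SP].
  by rewrite /Phi sc0 mulmx0.
rewrite /Phi scD mulmxDr => ->; congr (_ + _).
have Zs : subcomodule sigma Z by apply/(subcomodule_mx eb sP ux ZP SQ).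
have Zt : comodule_iso (subcoaction sigma (W := Z)) (@trivial_coaction R K).
  apply: contrapT => niso; have [_ dZ _] := Zirr.
  have := c0 _ _ Zirr (irreducible_subquotient Zs) niso.
  by rewrite leqn0 (negPf dZ).
apply/matrixP => i j; have /= jZ := projects_onto_col eb j ZP.
have : sigma (vec_of_col e (col j (B *m B'))) = tens (vec_of_col e (col j (B *m B'))) 1.
  rewrite -{1}(vsprojK jZ) -subcoactionE // (trivial_fixed Zt) tmap_tens /=.
  by rewrite vsprojK.
move/(coaction_fixed sl eb); rewrite vec_of_colK // sc_col -!colM.
by move=> /matrixP/(_ i 0); rewrite [X in X = _ -> _]mxE [X in _ = X -> _]mxE.
Qed.

(** An irreducible subquotient contains a nonzero fixed vector; the line of this vector is a
    subcomodule, hence everything, and the subquotient is trivial. *)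
Lemma fixed_constrained l : x = 1%:M -> constrained l sigma.
Proof.
move=> x1 M tau Mirr [Z [q [Zs qZ qt]]] niso; exfalso; apply: niso.
have [tP M0 Mmin] := Mirr; have [sl _ _] := sP; have [tl _ _] := tP.
pose e' := vbasis (fullv : {vspace M}); have eb' : basis_of fullv e' := vbasisP _.
have [A [A0]] := subquotient_intertwiner Mirr Zs qZ qt; rewrite x1 mulmx1 => yA.
have [j Aj] : exists j, col j A != 0.
  apply: contrapT => /forallNP A_0; case/eqP: A0; apply/matrixP => i j.
  by have /negP/negPn/eqP/matrixP/(_ i 0) := A_0 j; rewrite !mxE.
pose m := vec_of_col e' (col j A).
have mE : coord_col e' m = col j A by rewrite vec_of_colK.
have m0 : m != 0 by apply: contraNneq Aj => m0; rewrite -mE m0 linear0.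
have tm : tau m = tens m 1.
  apply/(coaction_fixed tl eb'); by rewrite mE sc_col -colM yA.
have tl0 k : tau (k *: m) = tens (k *: m) 1.
  pose tL : {linear M -> M ⊗ K} := HB.pack tau (GRing.isLinear.Build _ _ _ _ tau tl).
  by rewrite -[LHS]/(tL _) linearZ_LR /= tm tensZl.
have ms : subcomodule tau <[m]>%VS.
  move=> w /vlineP[k ->]; exists (tens (vsproj <[m]>%VS (k *: m)) 1).
  by rewrite tmap_tens /= vsprojK ?tl0 // memvZ // memv_line.
have m1 : <[m]>%VS = fullv.
  by case: (Mmin _ ms) => // /eqP; rewrite -dimv_eq0 dim_vline m0.
have mb : basis_of fullv [tuple m].
  by rewrite -m1 /basis_of /= span_seq1 eqxx /free /= span_seq1 dim_vline m0.
have mco v : v = vcoord [tuple m] 0 v *: m.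
  by rewrite {1}(coord_basis mb (memvf v)) big_ord1.
pose f : 'Hom(M, C^o) := linfun (vcoord [tuple m] 0 : {linear M -> C^o}).
have fE v : f v = vcoord [tuple m] 0 v by rewrite lfunE.
have f0 : lker f = 0%VS.
  apply/eqP; rewrite -subv0; apply/subvP => v; rewrite memv_ker fE memv0 => /eqP v0.
  by rewrite [v]mco v0 scale0r.
exists f; split=> // [|v].
  apply/eqP; rewrite eqEdim subvf dim_regular limg_dim_eq ?f0 ?capv0 //.
  by rewrite -m1 dim_vline m0.
by rewrite [in RHS](mco v) tl0 tmap_tens -mco.
Qed.

End Constrained.

(** * Openness in a chart *)

Section SubspaceCorep.
Variables (R : realType) (K : hopfStarAlgebra R).
Local Notation C := (R[i]).
Variables (n d : nat) (v : 'M[K]_n) (y : 'M[K]_d).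
Variables (B : 'M[C]_(n, d)) (B' : 'M[C]_(d, n)).
Hypotheses (B'B : B' *m B = 1%:M) (vB : v *m sc K B = sc K B *m y).
Hypothesis vP : v *m sc K (B *m B') = sc K (B *m B') *m v.

Lemma left_inverse_intertwines : y *m sc K B' = sc K B' *m v.
Proof.
have -> : y = sc K B' *m v *m sc K B by rewrite -mulmxA vB mulmxA -scM B'B sc1 mul1mx.
by rewrite -mulmxA -scM -mulmxA vP mulmxA -scM mulmxA B'B mul1mx.
Qed.

Lemma extend_commuting b : y *m sc K b = sc K b *m y ->
  v *m sc K (B *m b *m B') = sc K (B *m b *m B') *m v.
Proof.
move=> yb; rewrite !scM !mulmxA vB -(mulmxA _ y) yb -!mulmxA.
by rewrite left_inverse_intertwines.
Qed.

Lemma restrict_commuting b : v *m sc K b = sc K b *m v ->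
  y *m sc K (B' *m b *m B) = sc K (B' *m b *m B) *m y.
Proof.
move=> vb; rewrite !scM !mulmxA left_inverse_intertwines -(mulmxA _ v) vb -!mulmxA.
by rewrite vB.
Qed.

Lemma fixed_subspace : y = 1%:M <-> v *m sc K B = sc K B.
Proof.
split=> [y1|vB1]; first by rewrite vB y1 mulmx1.
by rewrite -[y]mul1mx -sc1 -B'B scM -mulmxA -vB vB1 -scM.
Qed.

End SubspaceCorep.

Section RegularGenerators.
Variables (R : realType) (c d l : nat).
Local Notation C := (R[i]).
Local Notation pt := 'rV[R]_c.

(** The construction of Y from b x0 and t is repeated with b x, while t and the other constants stay
    fixed. *)
Lemma regular_cyclic_span (b : pt -> 'M[C]_d) x0 (t : 'M[C]_(d, l)) Y :
  regular_mx b -> cyclic_span (b x0) t Y ->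
  exists Z : pt -> 'M[C]_d,
    [/\ regular_mx Z, Z x0 = Y & forall x, cyclic_span (b x) t (Z x)].
Proof.
move=> rb; elim=> [M|{}Y _ [Z [rZ <- Zb]]|{}Y Y' _ [Z [rZ <- Zb]] _ [Z' [rZ' <- Zb']]].
- exists (fun=> t *m M); split=> // [|x]; first exact: regular_mx_cst.
  exact: cyclic_gen.
- exists (fun x => b x *m Z x); split=> // [|x]; first exact: regular_mxM.
  exact: cyclic_act.
- exists (fun x => Z x + Z' x); split=> // [|x]; first exact: regular_mxD.
  exact: cyclic_add.
Qed.

End RegularGenerators.

Section KernelConstraint.
Variables (R : realType) (H : hopfStarAlgebra R).
Local Notation C := (R[i]).

(* In terms of the matrix [v] of the coaction, [B] of a basis of a            *)
(* subcomodule and a left inverse [B'] of [B], this is the condition of being *)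
(* [l]-constrained on the subcomodule.                                        *)
Definition constraint_mx (K : hopfStarAlgebra R) n d (v : 'M[K]_n)
    (B : 'M[C]_(n, d)) (B' : 'M[C]_(d, n)) (l : nat) : Prop :=
  (l = 0 /\ v *m sc K B = sc K B) \/
  (0 < l)%N /\ exists b (t : 'M[C]_(d, l)),
    v *m sc K b = sc K b *m v /\ cyclic_span (B' *m b *m B) t 1%:M.

Lemma kernel_mx_eq (K : hopfStarAlgebra R) (pi : {lrmorphism H -> K}) (J : H -> Prop) :
  (forall a, pi a = 0 <-> J a) -> forall p q (M N : 'M[H]_(p, q)),
  (forall i k, J ((M - N) i k)) <-> map_mx pi M = map_mx pi N.
Proof.
move=> piE p q M N; split=> [MN|/matrixP MN i k].
  by apply/eqP; rewrite -subr_eq0 -map_mxB; apply/eqP/matrixP => i k; rewrite !mxE;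
     have /piE := MN i k; rewrite !mxE.
by apply/piE; have := MN i k; rewrite !mxE rmorphB => /= ->; rewrite subrr.
Qed.

(** The condition consists of equations between images of matrices over [H], which depend on the
    kernel alone. *)
Lemma constraint_kernel (K K' : hopfStarAlgebra R) (pi : {lrmorphism H -> K})
    (pi' : {lrmorphism H -> K'}) (J : H -> Prop) n d (u : 'M[H]_n) (B : 'M[C]_(n, d)) B' l :
  (forall a, pi a = 0 <-> J a) -> (forall a, pi' a = 0 <-> J a) ->
  constraint_mx (map_mx pi u) B B' l -> constraint_mx (map_mx pi' u) B B' l.
Proof.
move=> piE piE' [[l0]|[l0 [b [t [+ bt]]]]]; rewrite -!(map_sc pi) -!map_mxM.
  by move/(kernel_mx_eq piE)/(kernel_mx_eq piE'); rewrite !map_mxM !map_sc; left.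
move/(kernel_mx_eq piE)/(kernel_mx_eq piE'); rewrite !map_mxM !map_sc => vb.
by right; split=> //; exists b, t.
Qed.

End KernelConstraint.

(** * Persistence of the constraint *)

Section ConstraintExtension.
Variables (R : realType) (H : hopfStarAlgebra R) (cqgH : cqg H) (c : nat).
Local Notation C := (R[i]).
Local Notation pt := 'rV[R]_c.
Variables (n : nat) (u : 'M[H]_n) (Q : 'M[C]_n) (F : Type) (P : pt -> F -> 'M[C]_n).
Hypotheses (cu : corep u) (uu : unitary_for Q u)
  (PQ : forall x i, Q *m P x i = ctr (P x i) *m Q)
  (rP : forall i, regular_mx (fun x => P x i)).
Variables (K : pt -> hopfStarAlgebra R) (pi : forall x, {lrmorphism H -> K x}).
Hypotheses (pim : forall x, is_hopf_star_morphism (pi x))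
  (piE : forall x a, pi x a = 0 <-> stab_mem u (P x) a).
Variables (j : F) (d : nat) (B : pt -> 'M[C]_(n, d)) (B' : pt -> 'M[C]_(d, n)).
Hypotheses (rB : regular_mx B) (rB' : regular_mx B')
  (B'B : forall x, B' x *m B x = 1%:M) (PE : forall x, P x j = B x *m B' x).

Let v x := map_mx (pi x) u.

Let stab_mx_eq x p q (M N : 'M[H]_(p, q)) :
  stab_mx u (P x) (M - N) <-> map_mx (pi x) M = map_mx (pi x) N.
Proof. exact: kernel_mx_eq (piE x) _ _ _ _. Qed.

Let constraint l x := constraint_mx (v x) (B x) (B' x) l.

Definition unvecmx (t : 'cV[C]_(n * n)) : 'M[C]_n :=
  \matrix_(i, k) t (mxtens_index (i, k)) 0.

Lemma vecmxK : cancel (@vecmx R n n) unvecmx.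
Proof. by move=> A; apply/matrixP => i k; rewrite !mxE mxtens_indexK. Qed.

(** As a matrix, an invariant vector X of u ⊗ conj u satisfies v X v^* = X, and unitarity for [Q]
    makes this the commutation of v with X Q. *)
Lemma invariant_conjugate x t :
  invariant u P x (tensmx u (conjmx u)) t <->
  v x *m sc _ (unvecmx t *m Q) = sc _ (unvecmx t *m Q) *m v x.
Proof.
have [Qp _ _] := uu; have Qu := posdef_unit Qp.
have [_ vQ vQ'] := unitary_map (pim x) uu.
transitivity (v x *m sc _ (unvecmx t) *m hstar (v x) = sc _ (unvecmx t)).
  rewrite /v -map_hstar // -!(map_sc (pi x)) -!map_mxM -stab_mx_eq.
  have tE : vecmx (unvecmx t) = t.
    apply/matrixP => a b; rewrite ord1 !mxE; case: (mxtens_indexP a) => i k.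
    by rewrite mxtens_indexK.
  split=> [it i k|it a b].
    have := it (mxtens_index (i, k)) 0; rewrite -[t in X in X -> _]tE !mxBE vecmx_mulE.
    by rewrite [sc _ _ _ _]mxE [vecmx _ _ _]mxE mxtens_indexK [sc _ _ i k]mxE.
  rewrite [b]ord1; case: (mxtens_indexP a) => i k.
  have := it i k; rewrite -[t in X in _ -> X]tE !mxBE vecmx_mulE [sc _ (vecmx _) _ _]mxE.
  by rewrite [vecmx _ _ _]mxE mxtens_indexK [sc _ _ i k]mxE.
rewrite !scM; split=> [E|E].
  by rewrite -{2}E -!mulmxA (mulmxA (hstar _)) vQ !mulmxA.
have cE : sc (K x) (unvecmx t) = sc _ (unvecmx t) *m sc _ Q *m sc _ (invmx Q).
  by rewrite -!scM mulmxK.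
rewrite mulmxA in E.
by rewrite {1}cE !mulmxA E -!mulmxA (mulmxA (v x)) vQ' mulmxA -cE.
Qed.

Lemma constraint_extension l x0 : constraint l x0 -> exists f : pt -> C,
  [/\ regular f, f x0 != 0 & forall x, f x != 0 -> constraint l x].
Proof.
move=> [[l0 vB]|[l0 [b [t [vb bt]]]]].
  have inv0 p : invariant u P x0 u (col p (B x0)).
    apply/stab_mx_eq; rewrite map_mxM map_sc -/(v x0) sc_col -colM vB //.
  have [T TE] := choice (fun p => regular_invariant_extension cqgH cu uu PQ rP cu (inv0 p)).
  pose S x := \matrix_(i, p) T p x i 0.
  have colS x p : col p (S x) = T p x by apply/matrixP => i k; rewrite ord1 !mxE.
  have vS x : v x *m sc _ (S x) = sc _ (S x).
    apply/matrixP => i p; have [_ /(_ x) /stab_mx_eq + _] := TE p.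
    rewrite map_mxM map_sc -/(v x) -colS sc_col -colM => /matrixP/(_ i 0).
    by rewrite [X in X = _ -> _]mxE [X in _ = X -> _]mxE.
  have S0 : S x0 = B x0.
    by apply/matrixP => i p; have [_ _ Tp] := TE p; rewrite mxE Tp mxE.
  (* At x0 the matrix is B' B = 1. Where it is invertible, the columns of B are combinations of
     those of P S, which are fixed because P commutes with v. *)
  exists (fun x => \det (B' x *m S x)); split.
  - apply: regular_det; apply: regular_mxM => // i p.
    have [rT _ _] := TE p; apply: (regular_eq (f := fun x => T p x i 0)) => //.
    by move=> x; rewrite mxE.
  - by rewrite S0 B'B det1 oner_eq0.
  move=> x fx; left; split=> //; set X := B' x *m S x in fx.
  have Xu : X \in unitmx by rewrite unitmxE unitfE.
  have vP : v x *m sc _ (P x j) = sc _ (P x j) *m v x.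
    rewrite /v -!(map_sc (pi x)) -!map_mxM; apply/stab_mx_eq => i k; exact: stab_commutator.
  have -> : B x = P x j *m S x *m invmx X by rewrite PE -!mulmxA (mulmxA (B' x)) mulmxV ?mulmx1.
  by rewrite !scM !mulmxA vP -(mulmxA _ (v x)) vS.
have : invariant u P x0 (tensmx u (conjmx u)) (vecmx (b *m invmx Q)).
  have [Qp _ _] := uu; have Qu := posdef_unit Qp.
  by apply/invariant_conjugate; rewrite vecmxK mulmxKV.
have cuu := corep_tens cu (corep_conj cu).
move=> /(regular_invariant_extension cqgH cu uu PQ rP cuu)[T [rT iT T0]].
pose b' x := unvecmx (T x) *m Q.
have b'0 : b' x0 = b.
  have [Qp _ _] := uu; have Qu := posdef_unit Qp.
  by rewrite /b' T0 vecmxK mulmxKV.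
have rb : regular_mx (fun x => B' x *m b' x *m B x).
  apply: regular_mxM => //; apply: regular_mxM => //; apply: regular_mxM; last first.
    exact: regular_mx_cst.
  move=> i k; apply: (regular_eq (f := fun x => T x (mxtens_index (i, k)) 0)) => //.
  by move=> x; rewrite mxE.
rewrite -b'0 in bt; have [Z [rZ Z0 Zb]] := regular_cyclic_span rb bt.
(* Z is 1 at x0; where it is invertible, the span contains Z Z^-1 = 1. *)
exists (fun x => \det (Z x)); split; first exact: regular_det.
  by rewrite Z0 det1 oner_eq0.
move=> x fx; right; split=> //; exists (b' x), t; split.
  exact/invariant_conjugate.
have Zu : Z x \in unitmx by rewrite unitmxE unitfE.
by rewrite -(mulmxV Zu); apply: cyclic_mulr.
Qed.

End ConstraintExtension.

(** * The constraint on a subcomodule in terms of the ambient matrix *)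

Section SubcomoduleConstraint.
Variables (R : realType) (K : hopfStarAlgebra R) (cqgK : cqg K).
Local Notation C := (R[i]).
Variables (V : vectType C) (sigma : V -> V ⊗ K) (sP : is_comodule sigma).
Variables (n : nat) (e : n.-tuple V) (eb : basis_of fullv e).
Variables (W : {vspace V}) (Ws : subcomodule sigma W).
Variables (d : nat) (b : d.-tuple V) (Wb : basis_of W b).
Let v := coaction_mx e sigma.
Let B := tuple_mx e b.

Definition sub_tuple : d.-tuple (subvs_of W) := [tuple vsproj W (tnth b i) | i < d].

Lemma sub_tuple_basis : basis_of fullv sub_tuple.
Proof.
rewrite basisEdim; apply/andP; split; last first.
  by rewrite size_tuple dimvf -[dim _]/(\dim W) -(size_basis Wb).
apply/subvP => s _; rewrite -[s]vsvalK (coord_basis Wb (subvsP s)) linear_sum.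
apply: rpred_sum => i _; rewrite linearZ_LR; apply: rpredZ; apply: memv_span.
by apply/tnthP; exists i; rewrite tnth_mktuple (tnth_nth 0).
Qed.

Lemma sub_coaction_mx :
  v *m sc K B = sc K B *m coaction_mx sub_tuple (subcoaction sigma (W := W)).
Proof.
have [sl _ _] := sP; have [tl _ _] := subcoaction_comodule sP Ws.
have tb := sub_tuple_basis.
pose q : 'Hom(subvs_of W, V) := linfun vsval.
apply/matrixP => i p.
have qp : sigma (q (tnth sub_tuple p)) =
    tmap q idfun (subcoaction sigma (tnth sub_tuple p)).
  by rewrite lfunE /= -subcoactionE //; apply: tmap_ext => // s; rewrite lfunE.
have := colinear_mx tb eb tl sl qp; rewrite /= (coord_col_tnth tb).
have -> : \matrix_(k, i0) vcoord e k (q (tnth sub_tuple i0)) = B.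
  apply/matrixP => a k; rewrite !mxE lfunE /= tnth_mktuple vsprojK //.
  by rewrite (basis_mem Wb) // mem_tnth.
rewrite -[delta_mx _ _]mul1mx -colE -colM !sc_col sc1 -!colM !mulmx1 => /matrixP/(_ i 0).
by rewrite [X in X = _ -> _]mxE [X in _ = X -> _]mxE.
Qed.

(** Endomorphisms b of [W] and of V correspond by B b B' and B' b B, as B B' commutes with v. This
    keeps the condition inside the fixed corepresentation on V. *)
Lemma constrained_mx (B' : 'M[C]_(d, n)) l :
  B' *m B = 1%:M -> v *m sc K (B *m B') = sc K (B *m B') *m v ->
  constrained l (subcoaction sigma (W := W)) <-> constraint_mx v B B' l.
Proof.
move=> B'B vP; have tP := subcoaction_comodule sP Ws; have tb := sub_tuple_basis.
have [tl _ _] := tP; set y := coaction_mx sub_tuple (subcoaction sigma (W := W)).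
have cy : corep y by apply/(comodule_corep tb tl).
have [S uy] := cqg_unitary cqgK cy.
have vB : v *m sc K B = sc K B *m y := sub_coaction_mx.
split=> [lc|[[-> /(fixed_subspace B'B vB) y1]|[l0 [b0 [t [vb bt]]]]]].
- case: (posnP l) lc => [->|l0] lc; [left|right]; split=> //.
    exact/(fixed_subspace B'B vB)/(constrained0_fixed tP tb uy lc).
  have [b0 [t [yb bt]]] := constrained_cyclic tP tb uy l0 lc.
  exists (B *m b0 *m B'), t; split; first exact: (extend_commuting B'B vB vP yb).
  by rewrite !mulmxA B'B mul1mx -mulmxA B'B mulmx1.
- exact: (fixed_constrained tP tb uy).
- exact: (cyclic_constrained tP tb uy (restrict_commuting B'B vB vP vb) bt).
Qed.

End SubcomoduleConstraint.

(** * The constraint in a chart of the Grassmannian *)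

Section Chart.
Variables (R : realType) (H : hopfStarAlgebra R) (cqgH : cqg H).
Local Notation C := (R[i]).
Variables (V : vectType C) (rho : V -> V ⊗ H) (rhoP : is_comodule rho).
Variables (F : finType) (F' : {set F}) (d : F -> nat).
Variables (l : {j : F | j \in F'} -> nat).
Variables (fr : forall i, frame V (d i)).
Local Notation pt := 'rV[R]_#|{: coord V d}|.

Let e := vbasis (fullv : {vspace V}).
Let eb : basis_of fullv e := vbasisP _.
Let u := coaction_mx e rho.
Variables (Q : 'M[C]_(\dim {:V})) (uu : unitary_for Q u).

Let graph i (x : pt) := graph_tuple (fr i) (coord_mx x i).
Let B i (x : pt) := tuple_mx e (graph i x).
Let B' i x := invmx (ctr (B i x) *m Q *m B i x) *m (ctr (B i x) *m Q).
Let P x i := oproj Q (B i x).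

Lemma graph_basis i x : basis_of (val (chart fr x i)) (graph i x).
Proof.
by rewrite basisEfree subvv size_tuple /free !(eqP (dim_graph _ _)) size_tuple !leqnn eqxx.
Qed.

Lemma regular_graph i : regular_mx (B i).
Proof.
move=> a p; apply: (regular_eq (f := fun x => vcoord e a (tnth (val (fr i)).1 p) +
   \sum_q coord_mx x i p q * vcoord e a (tnth (val (fr i)).2 q))).
  move=> x; rewrite mxE tnth_mktuple linearD linear_sum; congr (_ + _).
  by apply: eq_bigr => q _; rewrite linearZ_LR.
apply: regularD; first exact: regular_cst.
apply: regular_sum => q; apply: regularM; last exact: regular_cst.
by split; apply: real_regular_poly;
   [exists (mpoly.mpolyX R (mpoly.mnm1 (enum_rank (entry p q false))))
   |exists (mpoly.mpolyX R (mpoly.mnm1 (enum_rank (entry p q true))))] => x;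
   rewrite mpoly.mevalXU mxE.
Qed.

Let Qp : posdef Q. Proof. by case: uu. Qed.

Let B'B i x : B' i x *m B i x = 1%:M.
Proof. exact: (oproj_left Qp (tuple_mx_inj eb (graph_basis i x))). Qed.

Let PW x i : projects_onto e (val (chart fr x i)) (P x i).
Proof. exact: (oproj_projects_onto eb Qp (graph_basis i x)). Qed.

Let PQ x i : Q *m P x i = ctr (P x i) *m Q.
Proof. exact: oproj_adj. Qed.

Let rB' i : regular_mx (B' i).
Proof.
have rB := @regular_graph i.
have rBQ : regular_mx (fun x => ctr (B i x) *m Q).
  by apply: regular_mxM; [exact: regular_mx_ctr|exact: regular_mx_cst].
apply: regular_mxM => //; apply: regular_mx_inv; first exact: regular_mxM.
move=> x; apply: posdef_unit; apply: posdef_sub Qp _.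
exact: (tuple_mx_inj eb (graph_basis i x)).
Qed.

Let rP i : regular_mx (fun x => P x i).
Proof. exact: regular_mxM (@regular_graph i) (@rB' i). Qed.

Let cu : corep u.
Proof. by have [rl _ _] := rhoP; apply/(comodule_corep eb rl). Qed.

Lemma initial_constraint x (K : hopfStarAlgebra R) (pi : {lrmorphism H -> K}) j k :
  initial_stabilizing rho (fun i => val (chart fr x i)) pi ->
  constrained k (@subcoaction R K V (push_coaction pi rho) (val (chart fr x j))) <->
  constraint_mx (map_mx pi u) (B j x) (B' j x) k.
Proof.
move=> [cqgK pim Ws _]; have [rl _ _] := rhoP.
have pl := push_linear pi rl.
have pE := push_mx pi rho e.
have pP : is_comodule (push_coaction pi rho).
  by apply/(comodule_corep eb pl); rewrite pE; exact: corep_map.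
rewrite -pE; apply: (constrained_mx cqgK pP eb (Ws j) (graph_basis j x) _ (B'B j x)).
have uP : unitary_for Q (coaction_mx e (push_coaction pi rho)).
  by rewrite pE; exact: unitary_map.
exact/(subcomodule_mx eb pP uP (PW x j) (PQ x j)).
Qed.

(** The given quotient at [x0] has the kernel of the explicit one, so that the constraint transfers
    to it and extends from there. The product over [F'] merges the conditions into one function. *)
Lemma constrained_locus_polynomial x0 : constrained_locus rho d l (chart fr x0) ->
  exists2 p : mpoly.mpoly _ R, mpoly.meval (fun k => x0 0 k) p != 0 &
    forall x : pt, mpoly.meval (fun k => x 0 k) p != 0 ->
      constrained_locus rho d l (chart fr x).
Proof.
move=> [K0 [pi0 [init0 con0]]].
have quot x : exists Kpi : {K : hopfStarAlgebra R & {lrmorphism H -> K}},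
    initial_stabilizing rho (fun i => val (chart fr x i)) (projT2 Kpi) /\
    forall a, projT2 Kpi a = 0 <-> stab_mem u (P x) a.
  have [K [pi Kpi]] := initial_quotient cqgH rhoP eb uu (PW x) (PQ x).
  by exists (existT _ K pi).
have [Kpi KpiE] := choice quot.
pose K x := projT1 (Kpi x); pose pi x : {lrmorphism H -> K x} := projT2 (Kpi x).
have pim x : is_hopf_star_morphism (pi x) by have [[]] := KpiE x.
have piE x a : pi x a = 0 <-> stab_mem u (P x) a by have [_] := KpiE x.
have pi0E a : pi0 a = 0 <-> stab_mem u (P x0) a.
  exact: (initial_kernel cqgH rhoP eb uu (PW x0) (PQ x0) a init0).
have ext (j : {j : F | j \in F'}) : exists f : pt -> C,
    [/\ regular f, f x0 != 0 & forall x, f x != 0 ->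
       constraint_mx (map_mx (pi x) u) (B (val j) x) (B' (val j) x) (l j)].
  apply: (constraint_extension cqgH cu uu PQ rP pim piE (@regular_graph (val j)) (@rB' (val j))
    (B'B (val j)) (fun=> erefl)).
  apply: (constraint_kernel pi0E (piE x0)).
  by apply/(initial_constraint _ _ init0)/con0.
have [f fE] := choice ext.
have rf : regular (fun x => \prod_j f j x).
  by apply: regular_prod => j; have [] := fE j.
have f0 : \prod_j f j x0 != 0 by apply/prodf_neq0 => j _; have [] := fE j.
have [p p0 pf] := regular_neq0 rf f0; exists p => // x /pf/prodf_neq0 fx.
have [init _] := KpiE x; exists (K x), (pi x); split=> // j.
apply/(initial_constraint _ _ init); have [_ _] := fE j; apply.
exact: fx.
Qed.

End Chart.

(** * Density *)

Import numFieldNormedType.Exports.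
Local Open Scope classical_set_scope.

Section CommonComplement.
Variables (K : fieldType) (V : vectType K).
Implicit Types U W : {vspace V}.

(** If x avoids U but lies in W, and y avoids W but lies in U, then x + y avoids both. *)
Lemma outside_two U W : U != fullv -> W != fullv -> exists v, v \notin U /\ v \notin W.
Proof.
have out (Y : {vspace V}) : Y != fullv -> exists x, x \notin Y.
  move=> Yf; have /subvPn[x _ xY] : ~~ (fullv <= Y)%VS.
    by apply: contraNN Yf => fY; rewrite eqEsubv subvf.
  by exists x.
move=> /out[x xU] /out[y yW].
have [xW|xW] := boolP (x \in W); last by exists x.
have [yU|yU] := boolP (y \in U); last by exists y.
by exists (x + y); rewrite (rpredDr _ yU) (rpredDl _ xW).
Qed.

(** A vector outside both subspaces is added to both, which keeps their dimensions equal. *)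
Lemma common_complement k U W : (\dim U + k)%N = \dim {:V} -> \dim U = \dim W ->
  exists b : k.-tuple V, (U + <<b>>)%VS = fullv /\ (W + <<b>>)%VS = fullv.
Proof.
elim: k U W => [|k IHk] U W dU UW.
  have full (Y : {vspace V}) : \dim Y = \dim {:V} -> Y = fullv.
    by move=> dY; apply/eqP; rewrite eqEdim subvf dY leqnn.
  exists [tuple]; rewrite /= span_nil !addv0.
  by split; apply: full; rewrite -?UW -dU addn0.
have nf (Y : {vspace V}) : \dim Y = \dim U -> Y != fullv.
  move=> dY; apply/eqP => Yf; move: dU; rewrite -dY Yf => /eqP.
  by rewrite -[eqbRHS]addn0 eqn_add2l.
have [v [vU vW]] := outside_two (nf _ erefl) (nf _ (esym UW)).
have dimS (Y : {vspace V}) : v \notin Y -> \dim (Y + <[v]>) = (\dim Y).+1.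
  move=> vY; have v0 : v != 0 by apply: contraNneq vY => ->; rewrite mem0v.
  rewrite dimv_disjoint_sum ?dim_vline ?v0 ?addn1 //.
  apply/eqP; rewrite -subv0; apply/subvP => w; rewrite memv_cap => /andP[wY /vlineP[a wE]].
  move: wY; rewrite wE; have [->|a0] := eqVneq a 0; first by rewrite scale0r !mem0v.
  by rewrite rpredZeq (negPf a0) (negPf vY).
have [||b [Ub Wb]] := IHk (U + <[v]>)%VS (W + <[v]>)%VS.
- by rewrite dimS // -dU addSnnS.
- by rewrite !dimS // UW.
exists [tuple of v :: b]; rewrite /= span_cons !addvA.
by split.
Qed.

End CommonComplement.

Section Density.
Variables (R : realType) (V : vectType R[i]).
Local Notation C := (R[i]).

(** A common complement is the second half of the frame: w0 is then the origin, and each basis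
    vector of w0 is moved into w1 by a vector of the complement. *)
Lemma common_chart d (w0 w1 : grassmannian V d) :
  exists (fr : frame V d) A0 A1, graph_point fr A0 = w0 /\ graph_point fr A1 = w1.
Proof.
have dw w : \dim (val (w : grassmannian V d)) = d by apply/eqP; exact: valP w.
have dV : (d <= \dim {:V})%N by rewrite -(dw w0); exact/dimvS/subvf.
have [||b [b0 b1]] := @common_complement _ V (\dim {:V} - d) (val w0) (val w1).
- by rewrite dw subnKC.
- by rewrite !dw.
pose a := tcast (dw w0) (vbasis (val w0)).
have aw : <<a>>%VS = val w0 by rewrite val_tcast; exact/span_basis/vbasisP.
have ab : basis_of fullv (a ++ b).
  rewrite basisEdim span_cat aw b0 subvv /= size_cat !size_tuple subnKC //.
pose fr : frame V d := exist _ (a, b) ab.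
exists fr, 0.
have ap p : exists c : 'I_(\dim {:V} - d) -> C,
    tnth a p + \sum_q c q *: tnth b q \in val w1.
  have : tnth a p \in (val w1 + <<b>>)%VS by rewrite b1 memvf.
  move=> /memv_addP[w ww1 [z /coord_span zE ->]].
  exists (fun q => - vcoord b q z); rewrite {1}zE -addrA -big_split big1 /= ?addr0 //.
  by move=> q _; rewrite (tnth_nth 0) scaleNr subrr.
have [c cE] := choice ap; exists (\matrix_(p, q) c p q).
split; apply: val_inj.
  rewrite -[LHS]/(<<graph_tuple fr 0>>%VS) -[RHS]aw.
  apply: (congr1 (fun t : d.-tuple V => <<t>>%VS)).
  apply: eq_from_tnth => p.
  by rewrite tnth_mktuple big1 ?addr0 // => q _; rewrite mxE scale0r.
rewrite -[LHS]/(<<graph_tuple fr _>>%VS).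
apply/eqP; rewrite eqEdim (eqP (dim_graph _ _)) dw leqnn andbT.
apply/span_subvP => v /tnthP[p ->]; rewrite tnth_mktuple.
by under eq_bigr do rewrite mxE; exact: cE.
Qed.

Variables (F : finType) (d : F -> nat).
Local Notation pt := 'rV[R]_#|{: coord V d}|.

Definition point_of (A : forall i, 'M[C]_(d i, \dim {:V} - d i)) : pt :=
  \row_k let: (existT i (p, q), b) := enum_val k in
    if b then complex.Im (A i p q) else complex.Re (A i p q).

Lemma point_ofK A i : coord_mx (point_of A) i = A i.
Proof.
apply/matrixP => p q; rewrite !mxE !enum_rankK /=.
by case: (A i p q).
Qed.

Lemma common_multichart (w0 w1 : multigrass V d) :
  exists (fr : forall i, frame V (d i)) x0 x1, chart fr x0 = w0 /\ chart fr x1 = w1.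
Proof.
pose T i := (frame V (d i) * 'M[C]_(d i, \dim {:V} - d i) * 'M[C]_(d i, \dim {:V} - d i))%type.
have ex i : exists t : T i, graph_point t.1.1 t.1.2 = w0 i /\ graph_point t.1.1 t.2 = w1 i.
  by have [fr [A0 [A1 AE]]] := common_chart (w0 i) (w1 i); exists (fr, A0, A1).
pose t i := projT1 (cid (ex i)); have tE i := projT2 (cid (ex i)).
exists (fun i => (t i).1.1), (point_of (fun i => (t i).1.2)), (point_of (fun i => (t i).2)).
by split; apply: functional_extensionality_dep => i; rewrite /chart point_ofK;
   case: (tE i).
Qed.

Lemma line_polynomial c (p : mpoly.mpoly c R) (x y : 'rV[R]_c) : exists G : {poly R},
  forall t, G.[t] = mpoly.meval (fun k => (x + t *: y) 0 k) p.
Proof.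
exists (\sum_(m <- mpoly.msupp p) (mpoly.mcoeff m p)%:P *
  \prod_i ((x 0 i)%:P + 'X * (y 0 i)%:P) ^+ mpoly.fun_of_multinom m i) => t.
rewrite mpoly.mevalE horner_sum; apply: eq_bigr => m _.
rewrite hornerM hornerC horner_prod; congr (_ * _); apply: eq_bigr => i _.
by rewrite horner_exp !hornerE !mxE.
Qed.

Lemma nonroot_near0 (G : {poly R}) (eps : R) : G != 0 -> 0 < eps ->
  exists t, [/\ 0 < t, t < eps & G.[t] != 0].
Proof.
move=> G0 e0; apply: contrapT => noroot.
(* Denominators from 2 on keep the points strictly below eps, and there are more of them than
   roots. *)
pose ts := [seq eps / k.+2%:R | k <- iota 0 (size G)].
have : (size ts < size G)%N.
  apply: max_poly_roots => //; last first.
    rewrite map_inj_uniq ?iota_uniq // => i j.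
    move=> /(mulfI (lt0r_neq0 e0))/invr_inj/eqP; rewrite eqr_nat => /eqP[] //.
  apply/allP => _ /mapP[k _ ->]; apply: contrapT => /negP Gk; apply: noroot.
  exists (eps / k.+2%:R); split=> //; first by rewrite divr_gt0.
  by rewrite ltr_pdivrMr // -{1}[eps]mulr1 ltr_pM2l // ltr1n.
by rewrite size_map size_iota ltnn.
Qed.

Lemma open_line c (O : set 'rV[R]_c) (x y : 'rV[R]_c) : open O -> O x ->
  exists2 eps : R, 0 < eps & forall t, 0 < t -> t < eps -> O (x + t *: y).
Proof.
move=> Oo Ox; have /nbhs_ballP[e /= e0 xO] : nbhs x O by exact: open_nbhs_nbhs.
(* The summand 1 keeps M positive when y = 0. *)
pose M := 1 + \sum_j `|y 0 j|.
have M0 : 0 < M by rewrite ltr_wpDr // sumr_ge0.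
exists (e / M); first by rewrite divr_gt0.
move=> t t0 te; apply: xO; split=> // i j; rewrite ord1 !mxE /ball /= opprD addNKr normrN normrM.
rewrite gtr0_norm //; apply: le_lt_trans (_ : t * M < e); last by rewrite -ltr_pdivlMr.
apply: ler_wpM2l; first exact: ltW.
rewrite /M (bigD1 j) //= addrCA lerDl addr_ge0 // sumr_ge0 //.
Qed.

Lemma polynomial_locus_dense (S : set (multigrass V d)) :
  (forall (fr : forall i, frame V (d i)) x0, S (chart fr x0) ->
    exists2 p : mpoly.mpoly _ R, mpoly.meval (fun k => x0 0 k) p != 0 &
      forall x : pt, mpoly.meval (fun k => x 0 k) p != 0 -> S (chart fr x)) ->
  S !=set0 -> dense S.
Proof.
move=> Sp [w0 Sw0] O [w1 Ow1] Oo; have cO : chart_open O := Oo.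
have [fr [x0 [x1 [c0 c1]]]] := common_multichart w0 w1.
rewrite -c0 in Sw0; rewrite -c1 in Ow1.
have [p p0 pS] := Sp _ _ Sw0.
have [G GE] := line_polynomial p x1 (x0 - x1).
have G0 : G != 0.
  (* At t = 1 the line passes through x0. *)
  apply: contraNneq p0 => G0; have := GE 1.
  by rewrite G0 horner0 scale1r subrKC => <-.
have [e e0 Oe] := open_line (x0 - x1) (cO fr) Ow1.
have [t [t0 te Gt]] := nonroot_near0 G0 e0.
exists (chart fr (x1 + t *: (x0 - x1))); split; first exact: Oe.
by apply: pS; rewrite -GE.
Qed.

Lemma polynomial_locus_open (S : set (weil_multigrass V d)) :
  (forall (fr : forall i, frame V (d i)) x0, S (chart fr x0) ->
    exists2 p : mpoly.mpoly _ R, mpoly.meval (fun k => x0 0 k) p != 0 &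
      forall x : pt, mpoly.meval (fun k => x 0 k) p != 0 -> S (chart fr x)) ->
  open S.
Proof.
move=> Sp; rewrite -[open S]/(zariski_open S) => fr.
(* The equations are all polynomials whose nonvanishing implies membership in [S]; the complement of
   [S] is their common zero set. *)
exists [set p : mpoly.mpoly _ R | forall x : pt,
  mpoly.meval (fun k => x 0 k) p != 0 -> S (chart fr x)].
apply/seteqP; split=> x /=.
  by move=> Sx p pS; apply/eqP; apply: contra_notT Sx; exact: pS.
move=> px Sx; have [p /eqP p0 pS] := Sp _ _ Sx; apply: p0; exact: px.
Qed.

End Density.

Theorem theorem1p11 (R : realType) (H : hopfStarAlgebra R) (cqgH : cqg H)
    (V : vectType R[i]) (rho : V -> V ⊗ H) (rhoP : is_comodule rho)
    (F : finType) (F' : {set F}) (d : F -> nat)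
    (l : {j : F | j \in F'} -> nat)
    (ld : forall j : {j : F | j \in F'}, (l j <= d (val j))%N) :
  @open (weil_multigrass V d) (constrained_locus rho d l) /\
  (constrained_locus rho d l !=set0 ->
   @dense (multigrass V d) (constrained_locus rho d l)).
Proof.
have eb := vbasisP (fullv : {vspace V}); have [rl _ _] := rhoP.
have [Q uu] := cqg_unitary cqgH ((comodule_corep eb rl).1 rhoP).
split; [apply: polynomial_locus_open|apply: polynomial_locus_dense] => fr x0;
  exact: (constrained_locus_polynomial cqgH rhoP uu).
Qed.
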